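(* For every integer $K\ge 3$ there is a constant $C_{\mathscr B,ind}>0$ depending only on $K$ such that the following holds. Let $n,p\ge1$, and let $X_1,\dots,X_n\in\mathbb R^p$ be independent (not necessarily identically distributed) random vectors with $\mathbf E X_i=0$, $\operatorname{Var}(X_i)$ positive definite and $\mathbf E(\|X_i\|^K)<\infty$ for all $i$. Suppose there exist independent random vectors $Y_1,\dots,Y_n\in\mathbb R^p$, independent of $X_1,\dots,X_n$, such that for each $i$: $\mathbf E(\|Y_i\|^K)<\infty$, $\mathbf E(X_i^k)=\mathbf E(Y_i^k)$ for all $k=1,\dots,K-1$, and $Y_i\overset{d}{=}Z_i+U_i$ for some independent random vectors $Z_i,U_i\in\mathbb R^p$ with $\mathbf E Z_i=\mathbf E U_i=0$ and $Z_i\sim\mathcal N(0,\Sigma_{z,i})$ for some symmetric positive definite matrix $\Sigma_{z,i}$. Put $\bar\Sigma_z:=n^{-1}\sum_{i=1}^n\Sigma_{z,i}$, $\bar C_z:=\|\bar\Sigma_z^{-1/2}\|$, $S_n:=n^{-1/2}\sum_{i=1}^nX_i$ and $\tilde S_n:=n^{-1/2}\sum_{i=1}^nY_i$. Then $$\sup_{B\in\mathscr B}\bigl|\mathbf P(S_n\in B)-\mathbf P(\tilde S_n\in B)\bigr|\le C_{\mathscr B,ind}\Bigl\{\bar C_z^K\sum_{i=1}^n\mathbf E\bigl(\|X_i\|^K+\|Y_i\|^K\bigr)\,n^{-K/2}\Bigr\}^{1/(K+1)}.$$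
   Context: $\|\cdot\|$ is the Euclidean norm for vectors and the operator norm for matrices. $\mathscr B$ is the set of all closed Euclidean balls in $\mathbb R^p$. For a vector $X\in\mathbb R^p$, $X^k$ denotes the tensor power $X^{\otimes k}$; thus $\mathbf E(X^k)=\mathbf E(Y^k)$ means $\mathbf E(x_{i_1}\cdots x_{i_k})=\mathbf E(y_{i_1}\cdots y_{i_k})$ for all indices $1\le i_1,\dots,i_k\le p$, where $x_j,y_j$ are the coordinates of $X,Y$. *)

(* Defs.v *)
From HB Require Import structures.
From mathcomp Require Import all_boot all_order all_algebra.
From mathcomp Require Import all_classical all_reals all_analysis.
Set Implicit Arguments.
Unset Strict Implicit.
Unset Printing Implicit Defensive.
Import Order.TTheory GRing.Theory Num.Theory.
Import numFieldNormedType.Exports.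
Local Open Scope classical_set_scope.
Local Open Scope ring_scope.

(* Borel sigma-algebra on matrices; a column vector 'cV[R]_p is a point of
   R^p, and {RV P >-> 'cV[R]_p} is the type of random vectors *)
Section borel_matrix.
Context (R : realType) (m n : nat).
Let G : set (set 'M[R]_(m, n)) := @open 'M[R]_(m, n).

HB.instance Definition _ := @isMeasurable.Build (sigma_display G)
  'M[R]_(m, n) <<s G >> (@sigma_algebra0 _ setT G) (@sigma_algebraC _ G)
  (@sigma_algebra_bigcup _ setT G).

End borel_matrix.

Section euclidean.
Context {R : realType}.

(* the library norm `|x| on matrices is the sup norm, hence this definition *)
Definition enorm {p} (x : 'cV[R]_p) : R :=
  Num.sqrt (\sum_(j < p) x j ord0 ^+ 2).

Definition eball {p} (c : 'cV[R]_p) (r : R) : set 'cV[R]_p :=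
  [set x | enorm (x - c) <= r].

Definition closed_balls p : set (set 'cV[R]_p) :=
  [set B | exists c r, 0 <= r /\ B = eball c r].

Definition opnorm {p} (A : 'M[R]_p) : R :=
  sup [set enorm (A *m x) | x in [set x | enorm x <= 1]].

Definition posdefmx {p} (A : 'M[R]_p) : Prop :=
  A^T = A /\ forall x : 'cV[R]_p, x != 0 -> 0 < (x^T *m A *m x) ord0 ord0.

(* A^{1/2} for A positive definite: the unique positive definite W with
   W W = A (and 0 when there is none) *)
Definition sqrtmx {p} (A : 'M[R]_p) : 'M[R]_p :=
  xget 0 [set W | posdefmx W /\ W *m W = A].

End euclidean.

Arguments closed_balls R p : clear implicits.

Section independence.
Local Open Scope ereal_scope.
Context {R : realType} {d} {T : measurableType d} (P : probability T R).

Definition independent_systems (F G : set_system T) : Prop :=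
  forall A B, F A -> G B -> P (A `&` B) = P A * P B.

Definition mutually_independent_systems {I : finType} (F : I -> set_system T) :
    Prop :=
  forall (J : {set I}) (A : I -> set T), (forall i, i \in J -> F i (A i)) ->
    P (\bigcap_(i in [set` J]) A i) = \prod_(i in J) P (A i).

Context {d'} {T' : measurableType d'}.

Definition independent_RV (X Y : {RV P >-> T'}) : Prop :=
  independent_systems (g_sigma_algebra_preimage X) (g_sigma_algebra_preimage Y).

Definition mutually_independent_RV {n} (X : 'I_n -> {RV P >-> T'}) : Prop :=
  mutually_independent_systems (fun i => g_sigma_algebra_preimage (X i)).

Definition independent_families {n} (X Y : 'I_n -> {RV P >-> T'}) : Prop :=
  independent_systems (g_sigma_preimage (fun i => X i : T -> T'))
                      (g_sigma_preimage (fun i => Y i : T -> T')).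

End independence.

Section random_vectors.
Local Open Scope ereal_scope.
Context {R : realType} {d} {T : measurableType d} (P : probability T R).
Context {p : nat}.
Implicit Types X Y : T -> 'cV[R]_p.

(* forces every coordinate to be integrable: the library integral of a
   non-integrable function is infinite *)
Definition centered X : Prop := forall j, 'E_P[fun w => X w j ord0] = 0.

Definition covmx X : 'M[R]_p :=
  \matrix_(j, k) fine (covariance P (fun w => X w j ord0)
                                    (fun w => X w k ord0)).

Definition moment K X : \bar R := 'E_P[fun w => enorm (X w) ^+ K]%R.

(* E (X^{\otimes k}) = E (Y^{\otimes k}), entry by entry *)
Definition same_tensor_moment k X Y : Prop :=
  forall s : 'I_k -> 'I_p,
    'E_P[fun w => \prod_(l < k) X w (s l) ord0]%R =
    'E_P[fun w => \prod_(l < k) Y w (s l) ord0]%R.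

(* Z ~ N(0, S), for S positive definite: every nontrivial linear combination
   a^T Z has law N(0, a^T S a). The second argument of normal_prob is the
   standard deviation; the case a = 0 is left out since normal_prob at
   standard deviation 0 is not a Dirac mass. *)
Definition centered_normal (S : 'M[R]_p) (Z : T -> 'cV[R]_p) : Prop :=
  forall a : 'cV[R]_p, a != 0%R -> forall A : set R, measurable A ->
    P ((fun w => (a^T *m Z w)%R ord0 ord0) @^-1` A) =
    normal_prob 0 (Num.sqrt ((a^T *m S *m a)%R ord0 ord0)) A.

End random_vectors.

(* restricted to measurable sets: `distribution P X` also takes
   (irrelevant) values on the others *)
Definition eq_in_law {R : realType} {d1 d2 d'} {T1 : measurableType d1}
    {T2 : measurableType d2} {T' : measurableType d'} (P : probability T1 R)
    (Q : probability T2 R) (X : T1 -> T') (Y : T2 -> T') : Prop :=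
  forall A, measurable A -> P (X @^-1` A) = Q (Y @^-1` A).

Definition normalized_sum {R : realType} {T : Type} {n p}
    (X : 'I_n -> T -> 'cV[R]_p) : T -> 'cV[R]_p :=
  fun w => (Num.sqrt n%:R)^-1 *: \sum_(i < n) X i w.

(* Main.v *)
(* Lindeberg's replacement scheme is run on a C^K function of |x - c|^2 equal to
   1 on the ball of radius r and to 0 outside the ball of radius r + eps. Its
   K-th directional derivatives are O(eps^-K |h|^K) with a constant free of the
   dimension and, the moments of X_i and Y_i agreeing up to order K - 1, swapping
   all the summands costs O(eps^-K) sum_i E (|X_i|^K + |Y_i|^K) n^(-K/2).
   Returning to indicators costs P (r < |S~ - c| <= r + eps), where S~ is the
   normalized sum of the Y_i. The characteristic function of S~ is that of
   sigma G + W, with sigma = 1 / (2 C_z) and G a standard Gaussian vector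
   independent of W: the covariance of the Gaussian part of S~ dominates
   sigma^2. Characteristic functions determine E exp (- k |S~ - c|^2), hence,
   approximating steps by polynomials, the law of |S~ - c|.
   For a shift G + u, Stein's identity is applied to the field rho(|x|) x / |x|,
   where rho = O(eps) is a smooth ramp increasing across the shell: its divergence
   exceeds (p - 1) rho(|x|) / |x| by at least a constant on the shell, while
   <G, rho(|x|) x / |x|> - (p - 1) rho(|x|) / |x| has mean O(eps) uniformly in p
   because |G|^2 - p has variance 2 p. So the shell has probability O(eps).
   The theorem follows by choosing eps. *)

Require Import Defs.
From HB Require Import structures.
From mathcomp Require Import complex.
From mathcomp Require Import all_boot all_order all_algebra.
From mathcomp Require Import all_classical all_reals all_analysis.
From mathcomp Require Import measurable_realfun.
From mathcomp Require Import ring lra.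
Import Order.TTheory GRing.Theory Num.Theory.
Import numFieldNormedType.Exports.
Local Open Scope classical_set_scope.
Local Open Scope ring_scope.

Set Implicit Arguments.
Unset Strict Implicit.
Unset Printing Implicit Defensive.

(** * Expectations, independence and coordinates *)

(** Each Y_i is only equal in law to Z_i + U_i, on a space of its own, so the given space carries no
    Gaussian part of the normalized sum and no U_i to condition on. Hence everything passes through
    laws, in the form E cos(<a, x> + theta): the phase theta covers the real and imaginary parts
    together and absorbs any summand that is held fixed. Balls are favourable because |x - c|^2 is
    quadratic along every line, so the derivatives of a function of it have constants that do not
    see p. In the shell bound the divergence of the field contains (p - 1) rho(|x|) / |x|, which may
    be of size sqrt(p) eps. It is subtracted on both sides of Stein's identity, where it cancels the
    mean p of |G|^2 and leaves fluctuations of order sqrt(p + |u|^2), divided by |G + u|, which is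
    typically of the same order. The exponent 1 / (K + 1) comes from equating the two costs delta /
    eps^K and C_z eps, where delta = n^(-K/2) sum_i E (|X_i|^K + |Y_i|^K). *)

Notation Ex P f := (Rintegral P setT f).

Section expectation.
Context {R : realType} {d} {T : measurableType d} (P : probability T R).
Implicit Types f g : T -> R.

Lemma bounded_integrable f (M : R) : measurable_fun setT f ->
  (forall x, `|f x| <= M) -> P.-integrable setT (EFin \o f).
Proof.
move=> mf fM; apply: measurable_bounded_integrable => //.
  by rewrite fin_num_fun_lty //; exact: fin_num_measure.
exists M; split; first exact: num_real.
by move=> y My x _ /=; exact: le_trans (fM x) (ltW My).
Qed.

Lemma Ex_cst (c : R) : Ex P (fun=> c) = c.
Proof. by rewrite Rintegral_cst// [X in fine X](probability_setT P) mulr1. Qed.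

Lemma Ex_indic (A : set T) : measurable A -> Ex P \1_A = fine (P A).
Proof. by move=> mA; rewrite /Rintegral integral_indic// setIT. Qed.

Lemma eq_Ex f g : f =1 g -> Ex P f = Ex P g.
Proof. by move=> fg; apply: eq_Rintegral => x _; exact: fg. Qed.

Lemma le_Ex f g : P.-integrable setT (EFin \o f) ->
  P.-integrable setT (EFin \o g) -> (forall x, f x <= g x) -> Ex P f <= Ex P g.
Proof. by move=> ? ? fg; apply: le_Rintegral. Qed.

Lemma le_normr_Ex f (M : R) : measurable_fun setT f -> (forall x, `|f x| <= M) ->
  `|Ex P f| <= M.
Proof.
move=> mf fM; have fi := bounded_integrable mf fM.
apply: le_trans (le_normr_Rintegral _ _) _ => //.
rewrite -[leRHS](Ex_cst M); apply: le_Ex => //.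
- exact: integrable_norm fi.
- by apply: (@bounded_integrable _ `|M|).
Qed.

Lemma measurable_preimage_le f (c : R) : measurable_fun setT f ->
  measurable [set x | f x <= c].
Proof.
move=> mf; rewrite (_ : [set _ | _] = setT `&` f @^-1` `]-oo, c]).
  by apply: mf.
by rewrite setTI; apply/seteqP; split => x /=; rewrite in_itv.
Qed.

Lemma measurable_preimage_gt f (c : R) : measurable_fun setT f ->
  measurable [set x | c < f x].
Proof.
move=> mf; rewrite (_ : [set _ | _] = setT `&` f @^-1` `]c, +oo[).
  by apply: mf.
by rewrite setTI; apply/seteqP; split => x /=; rewrite in_itv/= andbT.
Qed.

End expectation.

Section fubini_bounded.
Context {R : realType} {d1 d2} {T1 : measurableType d1} {T2 : measurableType d2}.
Context (P1 : probability T1 R) (P2 : probability T2 R).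
Variables (f : T1 * T2 -> R) (M : R).
Hypotheses (mf : measurable_fun setT f) (fM : forall z, `|f z| <= M).

Let fi : (P1 \x P2)%E.-integrable setT (EFin \o f).
Proof. exact: bounded_integrable mf fM. Qed.

Lemma bounded_section1 x : P2.-integrable setT (fun y => (f (x, y))%:E).
Proof.
apply: (@bounded_integrable _ _ _ _ (fun y => f (x, y)) M) => //.
by apply: measurableT_comp => //; exact: measurable_fun_pair.
Qed.

Lemma bounded_section2 y : P1.-integrable setT (fun x => (f (x, y))%:E).
Proof.
apply: (@bounded_integrable _ _ _ _ (fun x => f (x, y)) M) => //.
by apply: measurableT_comp => //; exact: measurable_fun_pair.
Qed.

Let EFinEx1 x : (Ex P2 (fun y => f (x, y)))%:E = (\int[P2]_y (f (x, y))%:E)%E.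
Proof. by rewrite fineK// integrable_fin_num//; exact: bounded_section1. Qed.

Let EFinEx2 y : (Ex P1 (fun x => f (x, y)))%:E = (\int[P1]_x (f (x, y))%:E)%E.
Proof. by rewrite fineK// integrable_fin_num//; exact: bounded_section2. Qed.

Lemma measurable_Ex1 : measurable_fun setT (fun x => Ex P2 (fun y => f (x, y))).
Proof.
apply/measurable_EFinP; rewrite (_ : _ \o _ = fubini_F P2 (EFin \o f)).
  exact: (measurable_fubini_F fi).
by apply/funext => x /=; rewrite EFinEx1.
Qed.

Lemma measurable_Ex2 : measurable_fun setT (fun y => Ex P1 (fun x => f (x, y))).
Proof.
apply/measurable_EFinP; rewrite (_ : _ \o _ = fubini_G P1 (EFin \o f)).
  exact: (measurable_fubini_G fi).
by apply/funext => x /=; rewrite EFinEx2.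
Qed.

Lemma Ex_prod1 : Ex (P1 \x P2)%E f = Ex P1 (fun x => Ex P2 (fun y => f (x, y))).
Proof.
congr fine; rewrite -integral12_prod_meas1//.
by apply: eq_integral => x _; rewrite EFinEx1.
Qed.

Lemma Ex_prod2 : Ex (P1 \x P2)%E f = Ex P2 (fun y => Ex P1 (fun x => f (x, y))).
Proof.
congr fine; rewrite -integral21_prod_meas1//.
by apply: eq_integral => x _; rewrite EFinEx2.
Qed.

Lemma Ex_swap : Ex P1 (fun x => Ex P2 (fun y => f (x, y))) =
                Ex P2 (fun y => Ex P1 (fun x => f (x, y))).
Proof. by rewrite -Ex_prod1 Ex_prod2. Qed.

End fubini_bounded.

Section law.
Context {R : realType} {d1 d2 d'} {T1 : measurableType d1}
  {T2 : measurableType d2} {T' : measurableType d'}.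
Context (P1 : probability T1 R) (P2 : probability T2 R).
Context (X1 : T1 -> T') (X2 : T2 -> T').
Hypotheses (mX1 : measurable_fun setT X1) (mX2 : measurable_fun setT X2).
Hypothesis lawE : forall A, measurable A -> P1 (X1 @^-1` A) = P2 (X2 @^-1` A).

Let X1' : {mfun T1 >-> T'} := HB.pack X1 (isMeasurableFun.Build _ _ _ _ _ mX1).
Let X2' : {mfun T2 >-> T'} := HB.pack X2 (isMeasurableFun.Build _ _ _ _ _ mX2).

Lemma Ex_law (f : T' -> R) (M : R) : measurable_fun setT f ->
  (forall x, `|f x| <= M) -> Ex P1 (fun x => f (X1 x)) = Ex P2 (fun x => f (X2 x)).
Proof.
move=> mf fM; congr fine.
have mf' : measurable_fun setT (EFin \o f) by exact/measurable_EFinP.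
have /= <- := @integral_distribution _ _ _ _ _ P1 X1' _ mf'.
  have /= <- := @integral_distribution _ _ _ _ _ P2 X2' _ mf'.
    by apply: eq_measure_integral => A mA _; exact: lawE.
  by apply: (@bounded_integrable _ _ _ _ (f \o X2) M) => [|x]; [exact: (measurableT_comp mf mX2)|exact: fM].
by apply: (@bounded_integrable _ _ _ _ (f \o X1) M) => [|x]; [exact: (measurableT_comp mf mX1)|exact: fM].
Qed.

End law.

Section independence.
Context {R : realType} {d} {T : measurableType d} (P : probability T R).
Implicit Types F G : set_system T.

(** Both P(A ∩ B) and P(A) P(B) are finite measures in A, so their agreement on a pi-system
    containing the whole space extends to the generated sigma-algebra. *)
Let indep_gen1 F (B : set T) : F `<=` measurable -> F setT -> setI_closed F ->
  measurable B -> (forall A, F A -> P (A `&` B) = P A * P B)%E ->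
  forall A, <<s F >> A -> (P (A `&` B) = P A * P B)%E.
Proof.
move=> mF FT IF mB FB A FA.
have rB : 0 <= fine (P B) by rewrite fine_ge0.
pose m2 := mscale (NngNum rB) P.
have e A' : m2 A' = (P A' * P B)%E.
  by rewrite /m2 /mscale/= fineK ?fin_num_measure// muleC.
have cov : \bigcup_(k : nat) [set: T] = setT by rewrite bigcup_const//; exists 0%N.
have := @g_sigma_algebra_measure_unique _ R T F mF (fun=> setT) (fun=> FT)
  cov (mrestr P mB) (mscale (NngNum rB) P) IF.
move=> /(_ _ _ A FA) h; rewrite -e; apply: h => [A' FA'|k].
  exact: etrans (FB _ FA') (esym (e A')).
by rewrite /= /mrestr /= setTI -ge0_fin_numE// fin_num_measure.
Qed.

(** One argument is extended at a time: first [F] with the other event fixed in the generated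
    sigma-algebra of [G], then [G] with the first event still in [F]. *)
Lemma independent_generated F G : F `<=` measurable -> G `<=` measurable ->
  F setT -> G setT -> setI_closed F -> setI_closed G ->
  independent_systems P F G -> independent_systems P <<s F >> <<s G >>.
Proof.
move=> mF mG FT GT IF IG FG A B FA GB.
have mA : measurable A by exact: (smallest_sub (@sigma_algebra_measurable _ T) mF).
apply: (@indep_gen1 F) => // [|A' FA'].
  exact: (smallest_sub (@sigma_algebra_measurable _ T) mG).
rewrite setIC muleC; apply: (@indep_gen1 G) => // [|B' GB']; first exact: mF.
by rewrite setIC muleC; exact: FG.
Qed.

(* The two factors carry the sigma-algebras generated by [F] and [G], so that
   [h] is only required to be measurable for these. *)
Lemma Ex_independent F G (h : g_sigma_algebraType F * g_sigma_algebraType G -> R)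
    (M : R) : F `<=` measurable -> G `<=` measurable ->
  independent_systems P <<s F >> <<s G >> ->
  measurable_fun setT h -> (forall z, `|h z| <= M) ->
  Ex P (fun w => h (w, w)) = Ex P (fun w => Ex P (fun w' => h (w, w'))).
Proof.
move=> mF mG FG mh hM.
have sF := smallest_sub (@sigma_algebra_measurable _ T) mF.
have sG := smallest_sub (@sigma_algebra_measurable _ T) mG.
have mi1 : measurable_fun setT (id : T -> g_sigma_algebraType F).
  by move=> _ A FA; rewrite setTI; exact: sF.
have mi2 : measurable_fun setT (id : T -> g_sigma_algebraType G).
  by move=> _ A GA; rewrite setTI; exact: sG.
have mpq : measurable_fun setT (fun z : T * T =>
  ((z.1, z.2) : g_sigma_algebraType F * g_sigma_algebraType G)%type).
  apply/measurable_fun_pairP; split; [exact: (measurableT_comp mi1 measurable_fst)|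
    exact: (measurableT_comp mi2 measurable_snd)].
have mdiag : measurable_fun setT (fun z : T =>
  ((z, z) : g_sigma_algebraType F * g_sigma_algebraType G)%type).
  by apply/measurable_fun_pairP; split.
have mh2 : measurable_fun setT (fun z : T * T => h (z.1, z.2)).
  exact: (measurableT_comp mh mpq).
rewrite -(@Ex_prod1 _ _ _ _ _ P P (fun z => h (z.1, z.2)) M)//.
apply: (@Ex_law _ _ _ _ _ _ _ P (P \x P)%E _ _ mdiag mpq _ h M) => // A mA.
pose i1 : {mfun T >-> g_sigma_algebraType F} :=
  HB.pack (id : T -> g_sigma_algebraType F) (isMeasurableFun.Build _ _ _ _ _ mi1).
pose i2 : {mfun T >-> g_sigma_algebraType G} :=
  HB.pack (id : T -> g_sigma_algebraType G) (isMeasurableFun.Build _ _ _ _ _ mi2).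
pose D : {mfun T >-> (g_sigma_algebraType F * g_sigma_algebraType G)%type} :=
  HB.pack (fun z : T => ((z, z) : g_sigma_algebraType F * g_sigma_algebraType G)%type)
   (isMeasurableFun.Build _ _ _ _ _ mdiag).
pose D2 : {mfun (T * T)%type >-> (g_sigma_algebraType F * g_sigma_algebraType G)%type} :=
  HB.pack (fun z : T * T => ((z.1, z.2) : g_sigma_algebraType F * g_sigma_algebraType G)%type)
   (isMeasurableFun.Build _ _ _ _ _ mpq).
(* The law of the diagonal w -> (w, w) is the product of the two restrictions of [P]: on rectangles
   this is the independence hypothesis, and rectangles determine a product measure. *)
transitivity ((distribution P i1 \x distribution P i2)%E A).
  have h1 := product_measure_unique (m1 := distribution P i1)
    (m2 := distribution P i2) (m' := distribution P D).
  by apply/esym/h1 => // A1 A2 mA1 mA2; exact: FG.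
have h2 := product_measure_unique (m1 := distribution P i1)
  (m2 := distribution P i2) (m' := distribution (P \x P)%E D2).
apply: h2 => // A1 A2 mA1 mA2.
have e : (fun z : T * T => ((z.1, z.2) :
    g_sigma_algebraType F * g_sigma_algebraType G)%type) @^-1` (A1 `*` A2) =
    (A1 : set T) `*` (A2 : set T) by apply/seteqP; split => -[].
apply: etrans (congr1 (P \x P)%E e) _.
by rewrite product_measure1E//; [exact: sF | exact: sG].
Qed.

End independence.

Section coordinates.
Context {R : realType}.

(** Measurability is asked coordinate by coordinate, so that it passes to sums, multiples and
    product spaces without any topology on vectors; [mcoord_RV] supplies it for Borel random
    vectors. *)
Definition mcoord {d} {T : measurableType d} {p} (X : T -> 'cV[R]_p) : Prop :=
  forall j, measurable_fun setT (fun w => X w j ord0).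

(* [F] is measurable for the sigma-algebra generated by the coordinates *)
Definition cmeas {p} (F : 'cV[R]_p -> R) : Prop :=
  forall d (T : measurableType d) (X : T -> 'cV[R]_p), mcoord X ->
  measurable_fun setT (fun w => F (X w)).

Definition dotp {p} (a x : 'cV[R]_p) : R := \sum_(j < p) a j ord0 * x j ord0.

Definition normsq {p} (x : 'cV[R]_p) : R := \sum_(j < p) x j ord0 ^+ 2.

Section mcoord_theory.
Context {d} {T : measurableType d} {p : nat}.
Implicit Types X Y : T -> 'cV[R]_p.

Lemma mcoord_cst (c : 'cV[R]_p) : mcoord (fun _ : T => c).
Proof. by move=> j; exact: measurable_cst. Qed.

Lemma mcoordD X Y : mcoord X -> mcoord Y -> mcoord (fun w => X w + Y w).
Proof.
move=> mX mY j; under eq_fun do rewrite mxE.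
by apply: measurable_funD; [exact: mX|exact: mY].
Qed.

Lemma mcoordB X Y : mcoord X -> mcoord Y -> mcoord (fun w => X w - Y w).
Proof.
move=> mX mY j; under eq_fun do rewrite !mxE.
by apply: measurable_funB; [exact: mX|exact: mY].
Qed.

Lemma mcoordZ c X : mcoord X -> mcoord (fun w => c *: X w).
Proof.
move=> mX j; under eq_fun do rewrite mxE.
by apply: measurable_funM; [exact: measurable_cst|exact: mX].
Qed.

Lemma mcoord_sum (I : Type) (r : seq I) (Q : pred I) (X : I -> T -> 'cV[R]_p) :
  (forall i, Q i -> mcoord (X i)) -> mcoord (fun w => \sum_(i <- r | Q i) X i w).
Proof.
move=> mX; elim: r => [|i r IH].
  by move=> j; under eq_fun do rewrite big_nil; exact: mcoord_cst.
move=> j; under eq_fun do rewrite big_cons.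
have [Qi|_] := boolP (Q i); last exact: IH.
by apply: (mcoordD _ IH); exact: mX.
Qed.

Lemma mcoord_comp d' (T' : measurableType d') (f : T' -> T) X :
  measurable_fun setT f -> mcoord X -> mcoord (fun w => X (f w)).
Proof. by move=> mf mX j; exact: (measurableT_comp (mX j) mf). Qed.

Lemma measurable_dotp X Y : mcoord X -> mcoord Y ->
  measurable_fun setT (fun w => dotp (X w) (Y w)).
Proof.
move=> mX mY; apply: measurable_sum => j.
by apply: measurable_funM; [exact: mX|exact: mY].
Qed.

Lemma measurable_normsq X : mcoord X ->
  measurable_fun setT (fun w => normsq (X w)).
Proof. by move=> mX; apply: measurable_sum => j; apply: measurable_funX. Qed.

Lemma measurable_enorm X : mcoord X ->
  measurable_fun setT (fun w => enorm (X w)).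
Proof.
move=> mX; have ms : measurable_fun setT (@Num.sqrt R).
  by apply: continuous_measurable_fun; exact: sqrt_continuous.
exact: (measurableT_comp ms (measurable_normsq mX)).
Qed.

End mcoord_theory.

Lemma mcoord_mulmx {d} {T : measurableType d} {p q} (A : 'M[R]_(q, p))
    (X : T -> 'cV[R]_p) : mcoord X -> mcoord (fun w => A *m X w).
Proof.
move=> mX j; under eq_fun do rewrite mxE.
apply: measurable_sum => k; apply: measurable_funM; last exact: mX.
exact: measurable_cst.
Qed.

Lemma measurable_borel_coord {p} (j : 'I_p) :
  measurable_fun setT (fun x : 'cV[R]_p => x j ord0).
Proof.
apply: (measurability _ (RGenOInfty.measurableE R)) => _ [_ [a ->] <-].
rewrite setTI; apply: sub_sigma_algebra; apply: open_comp.
  by move=> x _; exact: coord_continuous.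
exact: interval_open.
Qed.

Lemma mcoord_RV {d} {T : measurableType d} {p} (P : probability T R)
  (X : {RV P >-> 'cV[R]_p}) : mcoord X.
Proof. by move=> j; apply: (measurableT_comp (measurable_borel_coord j)). Qed.

End coordinates.

Section dot_product.
Context {R : realType} {p : nat}.
Implicit Types a x y : 'cV[R]_p.

Lemma normsq_ge0 x : 0 <= normsq x.
Proof. by apply: sumr_ge0 => j _; exact: sqr_ge0. Qed.

Lemma enorm_ge0 x : 0 <= enorm x. Proof. exact: sqrtr_ge0. Qed.

Lemma sqr_enorm x : enorm x ^+ 2 = normsq x.
Proof. by rewrite sqr_sqrtr// normsq_ge0. Qed.

Lemma dotpC x y : dotp x y = dotp y x.
Proof. by apply: eq_bigr => j _; rewrite mulrC. Qed.

Lemma dotpDr a x y : dotp a (x + y) = dotp a x + dotp a y.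
Proof. by rewrite -big_split; apply: eq_bigr => j _; rewrite mxE mulrDr. Qed.

Lemma dotpZr a c x : dotp a (c *: x) = c * dotp a x.
Proof. by rewrite mulr_sumr; apply: eq_bigr => j _; rewrite mxE mulrCA. Qed.

Lemma dotpDl a x y : dotp (x + y) a = dotp x a + dotp y a.
Proof. by rewrite !(dotpC _ a) dotpDr. Qed.

Lemma dotpZl a c x : dotp (c *: x) a = c * dotp x a.
Proof. by rewrite !(dotpC _ a) dotpZr. Qed.

Lemma dotpNr a x : dotp a (- x) = - dotp a x.
Proof. by rewrite -scaleN1r dotpZr mulN1r. Qed.

Lemma dotpBr a x y : dotp a (x - y) = dotp a x - dotp a y.
Proof. by rewrite dotpDr dotpNr. Qed.

Lemma dotp0l a : dotp 0 a = 0.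
Proof. by rewrite -(scale0r 0) dotpZl mul0r. Qed.

Lemma dotp_sumr (I : Type) (r : seq I) (Q : pred I) a (X : I -> 'cV[R]_p) :
  dotp a (\sum_(i <- r | Q i) X i) = \sum_(i <- r | Q i) dotp a (X i).
Proof.
apply: (big_morph (dotp a)) => [x y|]; first exact: dotpDr.
by rewrite dotpC dotp0l.
Qed.

Lemma dotpE a x : dotp a x = (a^T *m x) ord0 ord0.
Proof. by rewrite mxE; apply: eq_bigr => j _; rewrite mxE. Qed.

Lemma normsqE x : normsq x = dotp x x.
Proof. by apply: eq_bigr => j _; rewrite expr2. Qed.

Lemma normsqZ c x : normsq (c *: x) = c ^+ 2 * normsq x.
Proof. by rewrite !normsqE dotpZl dotpZr mulrA expr2. Qed.

Lemma normsqD x y : normsq (x + y) = normsq x + 2 * dotp x y + normsq y.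
Proof. by rewrite !normsqE dotpDl !dotpDr (dotpC y x); ring. Qed.

Lemma enormZ c x : enorm (c *: x) = `|c| * enorm x.
Proof.
by rewrite {1}/enorm -/(normsq _) normsqZ sqrtrM ?sqr_ge0// sqrtr_sqr.
Qed.

Lemma normsq_eq0 x : (normsq x == 0) = (x == 0).
Proof.
rewrite psumr_eq0 => [|j _]; last exact: sqr_ge0.
apply/allP/eqP => [x0|-> j _]; last by rewrite mxE expr0n/= eqxx.
apply/matrixP => j k; rewrite ord1 mxE.
by have := x0 j (mem_index_enum _); rewrite implyTb sqrf_eq0 => /eqP.
Qed.

(** Cauchy-Schwarz, by expanding the squared norm of |y|^2 x - <x, y> y and dividing by |y|^2. *)
Lemma dotp_sqr_le x y : dotp x y ^+ 2 <= normsq x * normsq y.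
Proof.
have [/eqP|y0] := boolP (normsq y == 0).
  rewrite [in X in X -> _](rwP eqP) normsq_eq0 => /eqP ->.
  by rewrite dotpC dotp0l expr0n/= mulr_ge0 ?normsq_ge0.
have y1 : 0 < normsq y by rewrite lt_neqAle eq_sym y0 normsq_ge0.
have := normsq_ge0 (normsq y *: x - dotp x y *: y).
rewrite -scaleNr normsqD !normsqZ dotpZl dotpZr => h.
have : 0 <= normsq y * (normsq x * normsq y - dotp x y ^+ 2).
  by apply: le_trans h _; rewrite le_eqVlt; apply/orP; left; apply/eqP; ring.
by rewrite pmulr_rge0// subr_ge0.
Qed.

Lemma normr_dotp_le x y : `|dotp x y| <= enorm x * enorm y.
Proof.
rewrite -(@ler_pXn2r _ 2)// ?nnegrE ?mulr_ge0 ?enorm_ge0//.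
by rewrite real_normK ?num_real// exprMn !sqr_enorm dotp_sqr_le.
Qed.

End dot_product.

(** * Independence of disjoint blocks of variables *)

Section grouping.
Context {R : realType} {d} {T : measurableType d} (P : probability T R).
Context {I : finType} (F : I -> set_system T).
Hypothesis mF : forall i, F i `<=` measurable.
Hypothesis FT : forall i, F i setT.
Hypothesis IF : forall i, setI_closed (F i).

(* The pi-system generating the sigma-algebra of the events that depend only on
   the indices in [J]. *)
Definition block (J : {set I}) : set_system T :=
  [set B | exists A : I -> set T, [/\ forall i, F i (A i),
    forall i, i \notin J -> A i = setT & B = \bigcap_(i in [set` [set: I]%SET]) A i]].

Lemma block_measurable J : block J `<=` measurable.
Proof.
move=> B [A [FA _ ->]]; apply: fin_bigcap_measurable => // i _.
exact/mF/FA.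
Qed.

Lemma blockT J : block J setT.
Proof. by exists (fun=> setT); split => //; rewrite bigcapT. Qed.

Lemma block_setI J : setI_closed (block J).
Proof.
move=> B1 B2 [A1 [FA1 A1T ->]] [A2 [FA2 A2T ->]].
exists (fun i => A1 i `&` A2 i); split => [i|i iJ|].
- exact: IF.
- by rewrite A1T// A2T// setTI.
- by rewrite bigcapI.
Qed.

Lemma sub_block i (J : {set I}) : i \in J -> F i `<=` <<s block J >>.
Proof.
move=> iJ A FA; apply: sub_sigma_algebra.
exists (fun k => if k == i then A else setT); split => [k|k kJ|].
- by case: eqP => [->|].
- by case: eqP => // ki; rewrite ki iJ in kJ.
- apply/seteqP; split => [w Aw k _ /=|w /(_ i)/=]; first by case: eqP.
  by rewrite eqxx; apply; rewrite inE.
Qed.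

(** The intersection of an event of [block J1] and one of [block J2] is again an intersection over
    all indices, and at each index at least one of the two sets is the whole space; so its
    probability factors. *)
Lemma independent_blocks (J1 J2 : {set I}) :
  (forall A : I -> set T, (forall i, F i (A i)) ->
    P (\bigcap_(i in [set` [set: I]%SET]) A i) = \prod_i P (A i))%E ->
  (forall i, i \in J1 -> i \notin J2) ->
  independent_systems P <<s block J1 >> <<s block J2 >>.
Proof.
move=> indF J12; apply: independent_generated;
  [exact: block_measurable|exact: block_measurable|exact: blockT|exact: blockT|
   exact: block_setI|exact: block_setI|].
move=> B1 B2 [A1 [FA1 A1T ->]] [A2 [FA2 A2T ->]].
rewrite -bigcapI !indF//; last by move=> i; exact: IF.
rewrite -big_split; apply: eq_bigr => i _ /=.
have [iJ1|iJ1] := boolP (i \in J1).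
  by rewrite A2T ?(J12 i iJ1)// setIT probability_setT mule1.
by rewrite A1T// setTI probability_setT mul1e.
Qed.

Lemma sub_block_comp d' (T' : measurableType d') (X : T -> T') i (J : {set I}) :
  i \in J -> (forall A, measurable A -> F i (X @^-1` A)) ->
  measurable_fun setT (X : g_sigma_algebraType (block J) -> T').
Proof.
by move=> iJ FX _ A mA; rewrite setTI; apply: (sub_block iJ); exact: FX.
Qed.

End grouping.

Section two_families.
Context {R : realType} {d} {T : measurableType d} (P : probability T R).
Context {d'} {T' : measurableType d'} {n : nat}.
Variables (X Y : 'I_n -> {RV P >-> T'}).
Hypotheses (indX : mutually_independent_RV X) (indY : mutually_independent_RV Y).
Hypothesis indXY : independent_families X Y.

(** The X_i and the Y_i form a single family of 2n independent sources, so that the sums mixing both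
    kinds in Lindeberg's scheme can be separated by disjoint index sets. *)
Definition joint_systems (i : 'I_n + 'I_n) : set_system T :=
  match i with
  | inl i => g_sigma_algebra_preimage (X i)
  | inr i => g_sigma_algebra_preimage (Y i)
  end.

Let preimage_sys_meas (Z : {RV P >-> T'}) :
  g_sigma_algebra_preimage Z `<=` measurable.
Proof. by move=> _ [A mA <-]; exact: measurable_funPT. Qed.

Let preimage_sysT (Z : {RV P >-> T'}) : g_sigma_algebra_preimage Z setT.
Proof. by exists setT => //; rewrite preimage_setT setTI. Qed.

Let preimage_sysI (Z : {RV P >-> T'}) : setI_closed (g_sigma_algebra_preimage Z).
Proof.
move=> _ _ [A mA <-] [B mB <-]; exists (A `&` B); first exact: measurableI.
by rewrite !setTI preimage_setI.
Qed.

Lemma joint_systems_measurable i : joint_systems i `<=` measurable.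
Proof. by case: i => i; exact: preimage_sys_meas. Qed.

Lemma joint_systemsT i : joint_systems i setT.
Proof. by case: i => i; exact: preimage_sysT. Qed.

Lemma joint_systems_setI i : setI_closed (joint_systems i).
Proof. by case: i => i; exact: preimage_sysI. Qed.

Let bigcap_sigma (Z : 'I_n -> {RV P >-> T'}) (A : 'I_n -> set T) :
  (forall i, g_sigma_algebra_preimage (Z i) (A i)) ->
  g_sigma_preimage (fun i => Z i : T -> T') (\bigcap_(i in [set` [set: 'I_n]%SET]) A i).
Proof.
move=> ZA.
apply: (@fin_bigcap_measurable _ (g_sigma_algebraType (\big[setU/set0]_(i < n)
    preimage_set_system setT (Z i : T -> T') measurable))) => // i _.
apply: sub_sigma_algebra; rewrite -bigcup_seq/=; exists i => /=; [by rewrite mem_index_enum|exact: ZA].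
Qed.

Lemma joint_systems_independent (A : 'I_n + 'I_n -> set T) :
  (forall i, joint_systems i (A i)) ->
  (P (\bigcap_(i in [set` [set: 'I_n + 'I_n]%SET]) A i) = \prod_i P (A i))%E.
Proof.
move=> FA.
have -> : \bigcap_(i in [set` [set: 'I_n + 'I_n]%SET]) A i =
    \bigcap_(i in [set` [set: 'I_n]%SET]) A (inl i) `&`
    \bigcap_(i in [set` [set: 'I_n]%SET]) A (inr i).
  apply/seteqP; split => [w Aw|w [A1 A2] [i|i] _].
  - by split => i _; apply: Aw; rewrite /= inE.
  - by apply: A1; rewrite /= inE.
  - by apply: A2; rewrite /= inE.
rewrite indXY; last 2 first.
- by apply: bigcap_sigma => i; exact: (FA (inl i)).
- by apply: bigcap_sigma => i; exact: (FA (inr i)).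
rewrite big_sumType/=; congr (_ * _)%E.
- apply: (etrans (@indX [set: 'I_n]%SET (fun i => A (inl i)) _)).
    by move=> i _; exact: (FA (inl i)).
  by apply: eq_bigl => i; rewrite inE.
- apply: (etrans (@indY [set: 'I_n]%SET (fun i => A (inr i)) _)).
    by move=> i _; exact: (FA (inr i)).
  by apply: eq_bigl => i; rewrite inE.
Qed.

Lemma joint_blocks_independent (J1 J2 : {set 'I_n + 'I_n}) :
  (forall i, i \in J1 -> i \notin J2) -> independent_systems P
    <<s block joint_systems J1 >> <<s block joint_systems J2 >>.
Proof.
apply: independent_blocks; [exact: joint_systems_measurable|
  exact: joint_systemsT|exact: joint_systems_setI|exact: joint_systems_independent].
Qed.

Lemma measurable_blockl i (J : {set 'I_n + 'I_n}) : inl i \in J ->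
  measurable_fun setT (X i : g_sigma_algebraType (block joint_systems J) -> T').
Proof.
move=> iJ; apply: (sub_block_comp (F := joint_systems) joint_systemsT iJ) => A mA.
by exists A => //; rewrite setTI.
Qed.

Lemma measurable_blockr i (J : {set 'I_n + 'I_n}) : inr i \in J ->
  measurable_fun setT (Y i : g_sigma_algebraType (block joint_systems J) -> T').
Proof.
move=> iJ; apply: (sub_block_comp (F := joint_systems) joint_systemsT iJ) => A mA.
by exists A => //; rewrite setTI.
Qed.

End two_families.

Section Ex_independent_vectors.
Context {R : realType} {d} {T : measurableType d} (P : probability T R).
Context {p : nat}.

(** The form in which independence is used throughout: one summand is frozen while the other is
    averaged. *)
Lemma Ex_independent_vectors (F G : set_system T) (V X : T -> 'cV[R]_p)
    (f : 'cV[R]_p -> R) (M : R) : F `<=` measurable -> G `<=` measurable ->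
  independent_systems P <<s F >> <<s G >> ->
  mcoord (V : g_sigma_algebraType F -> _) ->
  mcoord (X : g_sigma_algebraType G -> _) ->
  cmeas f -> (forall z, `|f z| <= M) ->
  Ex P (fun w => f (V w + X w)) = Ex P (fun w => Ex P (fun w' => f (V w + X w'))).
Proof.
move=> mF mG FG mV mX mf fM.
apply: (@Ex_independent _ _ _ P F G (fun z => f (V z.1 + X z.2)) M) => //.
apply: mf; apply: mcoordD.
  exact: (mcoord_comp (X := V : g_sigma_algebraType F -> _) measurable_fst).
exact: (mcoord_comp (X := X : g_sigma_algebraType G -> _) measurable_snd).
Qed.

End Ex_independent_vectors.

(** * The normal law on the line *)

Section normal_density_integral.
Context {R : realType} (s : R).
Hypothesis s_gt0 : 0 < s.
Local Notation mu := (@lebesgue_measure R).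
Local Notation phi := (normal_pdf 0 s).
Local Notation nu := (normal_prob 0 s).

Let s_neq0 : s != 0. Proof. by rewrite gt_eqF. Qed.

Let bounded_integral_normal (f : measurableTypeR R -> R) (M : R) : measurable_fun setT f ->
  (forall x, `|f x| <= M) ->
  (\int[nu]_x (f x)%:E = \int[mu]_x ((f x)%:E * (phi x)%:E))%E.
Proof.
move=> mf fM; have numu := normal_prob_dominates 0 s.
have fi : nu.-integrable setT (EFin \o f) by exact: bounded_integrable mf fM.
rewrite -(Radon_Nikodym_change_of_variables numu)//=.
have mphi : measurable_fun setT (fun x => (phi x)%:E).
  by apply/measurable_EFinP; exact: measurable_normal_pdf.
apply: ae_eq_integral => //.
- apply: emeasurable_funM; first by apply/measurable_EFinP.
  apply: (measurable_int mu); exact: Radon_Nikodym_integrable.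
- by apply: emeasurable_funM => //; exact/measurable_EFinP.
- apply: ae_eqe_mul2l => /=.
  (* The Radon-Nikodym derivative is an arbitrary representative; it equals [phi] almost everywhere
     because both have the same integral over every measurable set. *)
  rewrite Radon_NikodymE//=.
  case: cid => /= h [h1 h2 h3].
  apply: integral_ae_eq => //=.
  by move=> E E01 mE; rewrite -h3.
Qed.

(** Truncation at height n reduces to bounded functions, and monotone convergence on both sides
    removes the truncation. *)
Lemma ge0_integral_normal (f : measurableTypeR R -> R) : measurable_fun setT f ->
  (forall x, 0 <= f x) ->
  (\int[nu]_x (f x)%:E = \int[mu]_x (f x * phi x)%:E)%E.
Proof.
move=> mf f0.
pose g (n : nat) x := Num.min (f x) n%:R.
have g0 n x : 0 <= g n x by rewrite le_min f0 ler0n.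
have g_le x : {homo (fun n => (g n x)%:E) : n m / (n <= m)%N >-> (n <= m)%E}.
  by move=> a b ab; rewrite lee_fin le_min2// ler_nat.
have g_cvg x : (g n x)%:E @[n --> \oo] --> (f x)%:E.
  apply: cvg_near_cst; near=> n; congr (_%:E); apply/min_idPl.
  by near: n; exact: nbhs_infty_ger.
have mg n : measurable_fun setT (g n) by exact: measurable_minr.
transitivity (limn (fun n => \int[nu]_x (g n x)%:E)%E).
  rewrite -monotone_convergence//=.
  - by apply: eq_integral => x _; apply/esym/cvg_lim => //; exact: g_cvg.
  - by move=> n; exact/measurable_EFinP.
  - by move=> n x _; rewrite lee_fin.
transitivity (limn (fun n => \int[mu]_x (g n x * phi x)%:E)%E).
  apply: congr_lim; apply/funext => n.
  rewrite (@bounded_integral_normal (g n) n%:R)//= => x.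
  by rewrite ger0_norm// ge_min lexx orbT.
rewrite -monotone_convergence//=.
- apply: eq_integral => x _; apply/cvg_lim => //.
  under eq_fun do rewrite EFinM; rewrite EFinM.
  by apply: cvgeZr => //; exact: g_cvg.
- move=> n; apply/measurable_EFinP/measurable_funM => //.
  exact: measurable_normal_pdf.
- by move=> n x _; rewrite lee_fin mulr_ge0// normal_pdf_ge0.
- move=> x _ a b ab; rewrite lee_fin ler_wpM2r ?normal_pdf_ge0//.
  by have := g_le x a b ab; rewrite lee_fin.
Unshelve. all: by end_near. Qed.

Lemma integrable_normal (f : measurableTypeR R -> R) : measurable_fun setT f ->
  mu.-integrable setT (fun x => (f x * phi x)%:E) ->
  nu.-integrable setT (EFin \o f).
Proof.
move=> mf /integrableP[_ fi]; apply/integrableP; split; first exact/measurable_EFinP.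
have /= -> := @ge0_integral_normal (fun x => `|f x|) _ _ => //.
  apply: le_lt_trans fi; rewrite le_eqVlt; apply/orP; left; apply/eqP.
  by apply: eq_integral => x _; rewrite /= normrM (ger0_norm (normal_pdf_ge0 _ _ _)).
exact: measurableT_comp.
Qed.

Lemma Ex_normal (f : measurableTypeR R -> R) : measurable_fun setT f ->
  mu.-integrable setT (fun x => (f x * phi x)%:E) ->
  Ex nu f = \int[mu]_x (f x * phi x).
Proof.
move=> mf fi; congr fine; rewrite integralE [RHS]integralE; congr (_ - _)%E.
- transitivity (\int[nu]_x (Num.max (f x) 0)%:E)%E.
    by apply: eq_integral => x _; rewrite funeposE/= EFin_max.
  rewrite ge0_integral_normal; last 2 first.
  + exact: measurable_maxr.
  + by move=> x; rewrite le_max lexx orbT.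
  apply: eq_integral => x _; rewrite funeposE/= -EFin_max.
  by rewrite maxr_pMl ?normal_pdf_ge0// mul0r.
- transitivity (\int[nu]_x (Num.max (- f x) 0)%:E)%E.
    by apply: eq_integral => x _; rewrite funenegE/= EFin_max.
  rewrite ge0_integral_normal; last 2 first.
  + by apply: measurable_maxr => //; exact: measurableT_comp.
  + by move=> x; rewrite le_max lexx orbT.
  apply: eq_integral => x _; rewrite funenegE/= -EFin_max.
  by rewrite maxr_pMl ?normal_pdf_ge0// mul0r mulNr.
Qed.

End normal_density_integral.

Section integrable_real.
Context {R : realType} {d} {T : measurableType d} (mu : {measure set T -> \bar R}).
Implicit Types f g : T -> R.

Lemma integrable_mulrl (k : R) f : mu.-integrable setT (EFin \o f) ->
  mu.-integrable setT (EFin \o (fun x => k * f x)).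
Proof.
by move=> fi; rewrite /comp; under eq_fun do rewrite EFinM; exact: integrableZl.
Qed.

Lemma integrable_addr f g : mu.-integrable setT (EFin \o f) ->
  mu.-integrable setT (EFin \o g) ->
  mu.-integrable setT (EFin \o (fun x => f x + g x)).
Proof.
by move=> fi gi; rewrite /comp; under eq_fun do rewrite EFinD; exact: integrableD.
Qed.

Lemma integrable_subr f g : mu.-integrable setT (EFin \o f) ->
  mu.-integrable setT (EFin \o g) ->
  mu.-integrable setT (EFin \o (fun x => f x - g x)).
Proof.
by move=> fi gi; rewrite /comp; under eq_fun do rewrite EFinB; exact: integrableB.
Qed.

End integrable_real.

Section integral_of_derivative.
Context {R : realType}.
Local Notation mu := (@lebesgue_measure R).

Lemma integral_derivative_setT (H h : R -> R) :
  (forall x : R, is_derive x 1 H (h x)) -> continuous h ->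
  mu.-integrable setT (EFin \o h) ->
  H x @[x --> +oo] --> 0 -> H x @[x --> -oo] --> 0 ->
  \int[mu]_x h x = 0.
Proof.
move=> dH ch ih Hy HNy.
have mh : measurable_fun setT h by exact: continuous_measurable_fun.
(* The endpoints are n + 1 and not n because the fundamental theorem of calculus is applied on a
   nondegenerate interval. *)
pose D n : set R := `[- n.+1%:R, n.+1%:R]%classic.
have mD n : measurable (D n) by exact: measurable_itv.
have cH : continuous H.
  by move=> x; apply: differentiable_continuous; apply/derivable1_diffP; exact: ex_derive.
have ID n : (\int[mu]_(x in D n) (h x)%:E = (H n.+1%:R)%:E - (H (- n.+1%:R))%:E)%E.
  apply: continuous_FTC2 => //.
  - by rewrite gtrN.
  - exact: continuous_subspaceT.
  - split.
    + by move=> x _; exact: ex_derive.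
    + by apply: cvg_at_right_filter; exact: cH.
    + by apply: cvg_at_left_filter; exact: cH.
  - by move=> x _; rewrite derive1E; exact: derive_val.
have c1 : (\int[mu]_(x in D n) (h x)%:E)%E @[n --> \oo] --> (\int[mu]_x (h x)%:E)%E.
  under eq_fun do rewrite integral_mkcond.
  apply: (@dominated_cvg _ _ _ mu setT measurableT
    (fun n => (EFin \o h) \_ (D n)) (EFin \o h) (fun x => `|h x|%:E)) => //.
  - move=> n; apply/(measurable_restrictT _ (mD n)).
    by apply: measurable_funTS; exact/measurable_EFinP.
  - move=> x _; apply: cvg_near_cst; near=> n.
    rewrite patchE mem_set//= /D/= in_itv/= -ler_norml.
    apply: (@le_trans _ _ n%:R); last by rewrite ler_nat.
    by near: n; exact: nbhs_infty_ger.
  - exact: integrable_norm.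
  - move=> n x _; rewrite patchE; case: ifPn => //=.
    by move=> _; rewrite lee_fin normr0.
have ny : (n.+1%:R : R) @[n --> \oo] --> +oo.
  by rewrite (cvg_shiftS (fun n => n%:R : R)); exact: cvgr_idn.
have c2 : (\int[mu]_(x in D n) (h x)%:E)%E @[n --> \oo] --> 0%E.
  under eq_fun do rewrite ID.
  apply: cvg_EFin; first exact: nearW.
  rewrite /= -(subr0 0); apply: cvgB.
    exact: (cvg_comp _ _ ny Hy).
  move/cvgNy_compNP : HNy => HNy.
  exact: (cvg_comp _ _ ny HNy).
by rewrite /Rintegral (cvg_unique _ c1 c2).
Unshelve. all: by end_near. Qed.

End integral_of_derivative.

(** * Stein's identity on the line *)

Section gaussian_integration_by_parts.
Context {R : realType}.
Local Notation mu := (@lebesgue_measure R).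

Let cvgy_decay (H : R -> R) (C : R) :
  (forall x, `|H x| * (1 + x ^+ 2) <= C) -> H x @[x --> +oo] --> 0.
Proof.
move=> HC; apply/cvgr0Pnorm_lt => eps eps0; near=> x.
have x1 : 1 <= x by near: x; exact: nbhs_pinfty_ge.
have xC : C / eps < x by near: x; apply: nbhs_pinfty_gt; exact: num_real.
have w0 : 0 < 1 + x ^+ 2 by rewrite ltr_pwDl// sqr_ge0.
rewrite -(ltr_pM2r w0); apply: le_lt_trans (HC x) _.
rewrite ltr_pdivrMr// mulrC in xC; apply: lt_le_trans xC _.
rewrite ler_pM2l//; apply: (le_trans (ler_eXnr (n := 2) _ x1)) => //.
by rewrite lerDr.
Unshelve. all: by end_near. Qed.

Lemma cvg_decay (H : R -> R) (C : R) :
  (forall x, `|H x| * (1 + x ^+ 2) <= C) ->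
  H x @[x --> +oo] --> 0 /\ H x @[x --> -oo] --> 0.
Proof.
move=> HC; split; first exact: cvgy_decay HC.
apply/cvgNy_compNP; apply: (@cvgy_decay _ C) => x /=.
by rewrite -(sqrrN x).
Qed.

Variable s : R.
Hypothesis s_gt0 : 0 < s.
Local Notation phi := (normal_pdf 0 s).
Local Notation nu := (normal_prob 0 s).

Let s_neq0 : s != 0. Proof. by rewrite gt_eqF. Qed.

(** With y = x^2 / (4 s^2) the density is a multiple of exp(-2y). One factor exp(-y) absorbs the
    polynomial and the other is, up to a constant, the density of variance 2 s^2. The value a = 1 +
    12 s^2 makes a (1 + y/3) >= 1 + x^2, hence (1 + x^2)^3 <= a^3 exp(y). The third power leaves
    room for x g(x) when g grows like (1 + x^2)^2. *)
Lemma normal_pdf_decay : exists2 C : R, 0 <= C &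
  forall x, (1 + x ^+ 2) ^+ 3 * phi x <= C * normal_pdf 0 (Num.sqrt 2 * s) x.
Proof.
pose s2 := Num.sqrt 2 * s; pose a := 1 + 12 * s ^+ 2.
have s20 : s2 != 0 by rewrite mulf_neq0// gt_eqF// sqrtr_gt0.
have s2E : s2 ^+ 2 = 2 * s ^+ 2 by rewrite exprMn sqr_sqrtr.
have ss : 0 < s ^+ 2 by rewrite exprn_gt0.
have a0 : 0 < a by rewrite ltr_pwDl// mulr_ge0// ltW.
have p0 : 0 < normal_peak s by rewrite normal_peak_gt0.
have p20 : 0 < normal_peak s2 by rewrite normal_peak_gt0.
exists (a ^+ 3 * normal_peak s / normal_peak s2).
  by rewrite ltW// divr_gt0// mulr_gt0// exprn_gt0.
move=> x; rewrite !normal_pdfE// /normal_fun subr0 -/s2 s2E.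
pose y := x ^+ 2 / (4 * s ^+ 2).
have y0 : 0 <= y by rewrite mulr_ge0 ?sqr_ge0// invr_ge0 mulr_ge0// ltW.
have -> : - x ^+ 2 / (s ^+ 2 *+ 2) = - y - y.
  by rewrite /y; field; rewrite gt_eqF.
have -> : - x ^+ 2 / (2 * s ^+ 2 *+ 2) = - y by rewrite /y; field; rewrite gt_eqF.
rewrite expRD.
have h : (1 + x ^+ 2) ^+ 3 * expR (- y) <= a ^+ 3.
  rewrite expRN ler_pdivrMr ?expR_gt0//.
  have -> : y = 3%:R * (y / 3) by field.
  rewrite expRM_natl -exprMn ler_pXn2r ?nnegrE//; last 2 first.
  - by rewrite addr_ge0// sqr_ge0.
  - by rewrite mulr_ge0 ?expR_ge0// ltW.
  apply: (@le_trans _ _ (a * (1 + y / 3))); last first.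
    by rewrite ler_pM2l// expR_ge1Dx.
  have -> : a * (1 + y / 3) = 1 + x ^+ 2 + (12 * s ^+ 2 + y / 3).
    by rewrite /a /y; field; rewrite gt_eqF.
  by move: ss y0; lra.
have -> : a ^+ 3 * normal_peak s / normal_peak s2 * (normal_peak s2 * expR (- y))
  = a ^+ 3 * (normal_peak s * expR (- y)) by field; rewrite gt_eqF.
have -> : (1 + x ^+ 2) ^+ 3 * (normal_peak s * (expR (- y) * expR (- y))) =
  ((1 + x ^+ 2) ^+ 3 * expR (- y)) * (normal_peak s * expR (- y)) by ring.
by rewrite ler_wpM2r// mulr_ge0 ?expR_ge0// ltW.
Qed.

Lemma integrable_growth (g : R -> R) (M : R) : measurable_fun setT g ->
  (forall x, `|g x| <= M * (1 + x ^+ 2) ^+ 3) ->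
  mu.-integrable setT (fun x => (g x * phi x)%:E).
Proof.
move=> mg gM; have [C C0 HC] := normal_pdf_decay.
apply: (@le_integrable _ _ _ mu setT measurableT _
  (fun x => (M * C)%:E * (normal_pdf 0 (Num.sqrt 2 * s) x)%:E)%E).
- apply/measurable_EFinP/measurable_funM => //; exact: measurable_normal_pdf.
- move=> x _; rewrite -EFinM !abse_EFin lee_fin.
  apply: (@le_trans _ _ (M * (1 + x ^+ 2) ^+ 3 * phi x)).
    rewrite normrM (ger0_norm (normal_pdf_ge0 _ _ _)).
    by rewrite ler_wpM2r// normal_pdf_ge0.
  have M0 : 0 <= M.
    have : 0 <= M * (1 + x ^+ 2) ^+ 3 by exact: le_trans (gM x).
    by rewrite pmulr_lge0// exprn_gt0// ltr_pwDl// sqr_ge0.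
  rewrite ger0_norm; last first.
    by rewrite !mulr_ge0// normal_pdf_ge0.
  by rewrite -(mulrA M C) -(mulrA M (_ ^+ 3)) ler_wpM2l.
- by apply: integrableZl => //; exact: integrable_normal_pdf.
Qed.

Lemma is_derive_normal_pdf (x : R) : is_derive x 1 phi (- (x / s ^+ 2) * phi x).
Proof.
rewrite normal_pdfE// /normal_fun.
have -> : (fun x0 => normal_peak s * expR (- (x0 - 0) ^+ 2 / (s ^+ 2 *+ 2))) =
  (fun x0 : R => normal_peak s * expR (- (x0 ^+ 2) / (s ^+ 2 *+ 2))).
  by apply/funext => z; rewrite subr0.
apply: is_derive_eq; rewrite !scaler0 /GRing.scale/= subr0; field.
by rewrite gt_eqF// exprn_gt0.
Qed.

Lemma integrable_normal_growth (g : R -> R) (M : R) : measurable_fun setT g ->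
  (forall x, `|g x| <= M * (1 + x ^+ 2) ^+ 3) -> nu.-integrable setT (EFin \o g).
Proof.
by move=> mg gM; apply: integrable_normal => //; exact: integrable_growth gM.
Qed.

(** The derivative of g phi is g' phi - x g phi / s^2, and its integral vanishes since g phi tends
    to 0 at both infinities. *)
Lemma normal_stein (g g' : R -> R) (M : R) :
  (forall x : R, is_derive x 1 g (g' x)) -> continuous g' ->
  (forall x, `|g x| <= M * (1 + x ^+ 2) ^+ 2) ->
  (forall x, `|g' x| <= M * (1 + x ^+ 2) ^+ 2) ->
  Ex nu (fun x => x * g x) = s ^+ 2 * Ex nu g'.
Proof.
move=> dg cg' gM g'M.
have w1 x : 1 <= 1 + x ^+ 2 :> R by rewrite lerDl sqr_ge0.
have w0 x : 0 < 1 + x ^+ 2 :> R by exact: lt_le_trans (w1 x).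
have M0 : 0 <= M.
  have : 0 <= M * (1 + 0 ^+ 2) ^+ 2 by exact: le_trans (gM 0).
  by rewrite pmulr_lge0// exprn_gt0.
have cg : continuous g.
  move=> x; apply: differentiable_continuous; apply/derivable1_diffP.
  exact: ex_derive.
have mg : measurable_fun setT g by exact: continuous_measurable_fun.
have mg' : measurable_fun setT g' by exact: continuous_measurable_fun.
have mxg : measurable_fun setT (fun x : R => x * g x) by exact: measurable_funM.
have xgM x : `|x * g x| <= M * (1 + x ^+ 2) ^+ 3.
  rewrite normrM exprS mulrCA ler_pM//.
  rewrite -(@ler_pXn2r _ 2)// ?nnegrE// ?ltW// real_normK ?num_real//.
  have -> : (1 + x ^+ 2) ^+ 2 = 1 + x ^+ 2 + (x ^+ 2 + (x ^+ 2) ^+ 2) by ring.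
  have := sqr_ge0 x; have := sqr_ge0 (x ^+ 2); lra.
have g'M3 x : `|g' x| <= M * (1 + x ^+ 2) ^+ 3.
  apply: le_trans (g'M x) _; rewrite ler_wpM2l//.
  by apply: ler_weXn2l.
have i1 := integrable_growth mxg xgM.
have i2 := integrable_growth mg' g'M3.
rewrite !Ex_normal//.
have [C C0 HC] := normal_pdf_decay.
pose h x := g' x * phi x - (s ^+ 2)^-1 * (x * g x * phi x).
suff h0 : \int[mu]_x h x = 0.
  have s20 : s ^+ 2 != 0 by rewrite expf_neq0.
  apply: (mulfI (invr_neq0 s20)); rewrite mulKf//; apply/esym/eqP.
  rewrite -subr_eq0 -RintegralZl// -RintegralB//; first by rewrite -[X in _ == X]h0.
  exact: integrable_mulrl i1.
have cphi : continuous phi by exact: continuous_normal_pdf.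
have gphi x : `|(g \* phi) x| * (1 + x ^+ 2) <=
    M * C * normal_peak (Num.sqrt 2 * s).
  rewrite normrM (ger0_norm (normal_pdf_ge0 _ _ _)).
  apply: (@le_trans _ _ (M * ((1 + x ^+ 2) ^+ 3 * phi x))).
    have -> : M * ((1 + x ^+ 2) ^+ 3 * phi x) =
      M * (1 + x ^+ 2) ^+ 2 * phi x * (1 + x ^+ 2) by ring.
    by rewrite ler_wpM2r ?(ltW (w0 x))// ler_wpM2r ?normal_pdf_ge0.
  rewrite -mulrA ler_wpM2l//; apply: le_trans (HC x) _; rewrite ler_wpM2l//.
  by apply: normal_pdf_ub; rewrite mulf_neq0// gt_eqF// sqrtr_gt0.
have [Hy HNy] := cvg_decay gphi.
apply: (@integral_derivative_setT _ (g \* phi) h).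
- move=> x; have := is_deriveM (dg x) (is_derive_normal_pdf x).
  move=> /is_derive_eq; apply; rewrite /h /GRing.scale/=; field.
  by rewrite gt_eqF.
- move=> x; apply: cvgB; first by apply: cvgM; [exact: cg'|exact: cphi].
  apply: cvgM; first exact: cvg_cst.
  apply: cvgM; last exact: cphi.
  by apply: cvgM; [exact: cvg_id|exact: cg].
- exact: (integrable_subr i2 (integrable_mulrl _ i1)).
- exact: Hy.
- exact: HNy.
Qed.

End gaussian_integration_by_parts.

Lemma measurable_cos {R : realType} : measurable_fun setT (@cos R).
Proof. by apply: continuous_measurable_fun; exact: continuous_cos. Qed.

Lemma measurable_sin {R : realType} : measurable_fun setT (@sin R).
Proof. by apply: continuous_measurable_fun; exact: continuous_sin. Qed.

Lemma normr_cos_le1 {R : realType} (x : R) : `|cos x| <= 1.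
Proof. by rewrite ler_norml cos_geN1 cos_le1. Qed.

Lemma normr_sin_le1 {R : realType} (x : R) : `|sin x| <= 1.
Proof. by rewrite ler_norml sin_geN1 sin_le1. Qed.

(** * Characteristic function and moments of the normal law on the line *)

Section gaussian_characteristic_function.
Context {R : realType} (s : R).
Hypothesis s_gt0 : 0 < s.
Local Notation nu := (normal_prob 0 s).

Let sqr1_ge1 (x : R) : 1 <= 1 + x ^+ 2. Proof. by rewrite lerDl sqr_ge0. Qed.

Let normr_le_sqr1 (x : R) : `|x| <= 1 + x ^+ 2.
Proof.
rewrite -(real_normK (num_real x)) -subr_ge0.
have -> : 1 + `|x| ^+ 2 - `|x| = (`|x| - 1 / 2) ^+ 2 + 3 / 4 by field.
by rewrite addr_ge0 ?sqr_ge0.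
Qed.

Let growth_id (x : R) : `|x| <= 1 * (1 + x ^+ 2) ^+ 2.
Proof. by rewrite mul1r (le_trans (normr_le_sqr1 x))// ler_eXnr. Qed.

Let growth2_3 (x : R) (M : R) : 0 <= M ->
  M * (1 + x ^+ 2) ^+ 2 <= M * (1 + x ^+ 2) ^+ 3.
Proof. by move=> M0; rewrite ler_wpM2l// ler_weXn2l// lerDl sqr_ge0. Qed.

Let integrable_id : nu.-integrable setT (EFin \o (fun x : R => `|x|)).
Proof.
apply: (@integrable_normal_growth _ _ s_gt0 _ 1) => [|x].
  exact: measurableT_comp.
by rewrite normr_id; apply: le_trans (growth_id x) (growth2_3 _ _).
Qed.

(** Differentiation under the integral, dominated by |x|, gives -E x sin(t x + theta); Stein's
    identity for sin(t x + theta) returns the original function, so it solves a linear differential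
    equation. *)
Lemma is_derive_normal_cos (theta t : R) :
  is_derive t 1 (fun t => Ex nu (fun x => cos (t * x + theta)))
    (- (s ^+ 2 * t * Ex nu (fun x => cos (t * x + theta)))).
Proof.
pose f t x := cos (t * x + theta) : R.
have df (u x : R) : is_derive u 1 (f ^~ x) (- x * sin (u * x + theta)).
  by rewrite /f; apply: is_derive_eq; rewrite /GRing.scale/=; ring.
have mcos (u : R) : measurable_fun setT (f u).
  apply: (measurableT_comp measurable_cos).
  by apply: measurable_funD => //; exact: measurable_funM.
have icos u : nu.-integrable setT (EFin \o f u).
  apply: (@integrable_normal_growth _ _ s_gt0 _ 1) => // x.
  by rewrite mul1r (le_trans (normr_cos_le1 _))// exprn_ege1.
have tI : (`]t - 1, t + 1[ : set R)%classic t.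
  by rewrite /= in_itv/= ltrBlDr ltrDl ltr01.
have G_ub x y : (`]t - 1, t + 1[ : set R)%classic x -> [set: R] y ->
    `|partial1of2 f x y| <= `|y|.
  move=> _ _; rewrite partial1of2E (@derive_val _ _ _ _ _ _ _ (df x y)).
  by rewrite normrM normrN ler_piMr// normr_sin_le1.
have dfI x y : (`]t - 1, t + 1[ : set R)%classic x -> [set: R] y ->
    derivable (f ^~ y) x 1 by move=> _ _; exact: ex_derive.
have G0 (y : R) : 0 <= `|y| by exact: normr_ge0.
have D := @derivable_under_integral _ _ _ nu f setT measurableT t _ _ tI
  (fun x _ => icos x) dfI _ G0 integrable_id G_ub.
have E := @differentiation_under_integral _ _ _ nu f setT measurableT t _ _ tI
  (fun x _ => icos x) dfI _ G0 integrable_id G_ub.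
apply: DeriveDef => //; rewrite -derive1E E.
have -> : \int[nu]_y partial1of2 f t y = - Ex nu (fun y => y * sin (t * y + theta)).
  rewrite -mulN1r -RintegralZl//.
    apply: eq_Ex => y; rewrite partial1of2E (@derive_val _ _ _ _ _ _ _ (df t y)).
    by rewrite mulNr mulN1r.
  apply: (@integrable_normal_growth _ _ s_gt0 _ 1) => [|y].
    apply: measurable_funM => //; apply: (measurableT_comp measurable_sin).
    by apply: measurable_funD => //; exact: measurable_funM.
  apply: le_trans (growth2_3 _ _) => //; apply: le_trans (growth_id y).
  by rewrite normrM ler_piMr// normr_sin_le1.
have dsin (x : R) : is_derive x 1 (fun y => sin (t * y + theta)) (t * cos (t * x + theta)).
  by apply: is_derive_eq; rewrite /GRing.scale/=; ring.
have w1 (x : R) : 1 <= (1 + x ^+ 2) ^+ 2.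
  by rewrite exprn_ege1// lerDl sqr_ge0.
rewrite (@normal_stein _ _ s_gt0 _ _ (1 + `|t|) dsin) /=.
- by rewrite -mulrA RintegralZl//; exact: icos.
- move=> x; apply: cvgM; first exact: cvg_cst.
  apply: continuous_comp; last exact: continuous_cos.
  by apply: cvgD; [apply: cvgM; [exact: cvg_cst|exact: cvg_id]|exact: cvg_cst].
- move=> x; apply: (@le_trans _ _ 1); first exact: normr_sin_le1.
  by rewrite mulr_ege1// lerDl.
- move=> x; rewrite normrM; apply: ler_pM => //; first by rewrite lerDr.
  by apply: le_trans (w1 x); exact: normr_cos_le1.
Qed.

(** Multiplied by the integrating factor exp(s^2 t^2 / 2), the solution of the differential equation
    is constant, with value cos theta at t = 0. *)
Lemma Ex_normal_cos (theta t : R) : Ex nu (fun x => cos (t * x + theta)) =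
  expR (- (s ^+ 2 * t ^+ 2 / 2)) * cos theta.
Proof.
pose H t := Ex nu (fun x => cos (t * x + theta)).
pose K u := H u * expR (s ^+ 2 * u ^+ 2 / 2).
have dK (u : R) : is_derive u 1 K 0.
  have dH := is_derive_normal_cos theta u.
  have dE : is_derive u 1 (fun u : R => expR (s ^+ 2 * u ^+ 2 / 2))
      (s ^+ 2 * u * expR (s ^+ 2 * u ^+ 2 / 2)).
    by apply: is_derive_eq; rewrite /GRing.scale/=; field.
  have := is_deriveM dH dE; move=> /is_derive_eq; apply.
  by rewrite /GRing.scale/= -/(H u); ring.
have := is_derive_0_is_cst t 0 dK; rewrite /K => E.
have -> : cos theta = H 0 * expR (s ^+ 2 * 0 ^+ 2 / 2).
  rewrite expr0n/= mulr0 mul0r expR0 mulr1 /H.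
  by under eq_Ex do rewrite mul0r add0r; rewrite Ex_cst.
by rewrite -E mulrCA -expRD addNr expR0 mulr1.
Qed.

Lemma Ex_normal_sqr : Ex nu (fun x => x ^+ 2) = s ^+ 2.
Proof.
have := @normal_stein _ _ s_gt0 id (fun=> 1) 1 _ _ growth_id.
under eq_Ex do rewrite -expr2.
rewrite Ex_cst mulr1; apply => [|x].
  by move=> x; exact: cvg_cst.
by rewrite normr1 mul1r exprn_ege1// lerDl sqr_ge0.
Qed.

Lemma Ex_normal_pow4 : Ex nu (fun x => x ^+ 4) = 3 * s ^+ 4.
Proof.
have dx3 (x : R) : is_derive x 1 (fun x => x ^+ 3) (3 * x ^+ 2).
  by apply: is_derive_eq; rewrite /GRing.scale/=; ring.
have := @normal_stein _ _ s_gt0 (fun x => x ^+ 3) _ 3 dx3.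
under eq_Ex do rewrite -exprS.
move=> ->.
- rewrite RintegralZl//; first by rewrite Ex_normal_sqr; ring.
  apply: (@integrable_normal_growth _ _ s_gt0 _ 1) => // x.
  rewrite mul1r ger0_norm ?sqr_ge0//.
  by apply: (@le_trans _ _ (1 + x ^+ 2)); [rewrite lerDr|rewrite ler_eXnr].
- move=> x; apply: cvgM; first exact: cvg_cst.
  exact: exprn_continuous.
- move=> x; rewrite normrX exprSr expr2 mulrC.
  apply: (@le_trans _ _ ((1 + x ^+ 2) ^+ 2)); last first.
    by rewrite ler_peMl ?exprn_ge0 ?addr_ge0 ?sqr_ge0// ler1n.
  rewrite [leRHS]expr2; apply: ler_pM => //.
  by rewrite -expr2 real_normK ?num_real// lerDr.
- move=> x; rewrite normrM normrX ger0_norm// ler_pM2l//.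
  rewrite real_normK ?num_real//.
  by apply: (@le_trans _ _ (1 + x ^+ 2)); [rewrite lerDr|rewrite ler_eXnr].
Qed.

End gaussian_characteristic_function.

(** * Standard Gaussian vectors *)

Section standard_gaussian.
Context {R : realType}.
Local Notation nu := (normal_prob (0 : R) 1).

Definition upd {p} (x : 'cV[R]_p) (j : 'I_p) (t : R) : 'cV[R]_p :=
  \col_i (if i == j then t else x i ord0).

Lemma upd_id {p} (x : 'cV[R]_p) j : upd x j (x j ord0) = x.
Proof. by apply/colP => i; rewrite mxE; case: eqP => [->|]. Qed.

Lemma upd_same {p} (x : 'cV[R]_p) j t : upd x j t j ord0 = t.
Proof. by rewrite mxE eqxx. Qed.

Lemma upd_other {p} (x : 'cV[R]_p) j t i : i != j -> upd x j t i ord0 = x i ord0.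
Proof. by move=> ij; rewrite mxE (negbTE ij). Qed.

Lemma mcoord_upd {d} {T : measurableType d} {p} (X : T -> 'cV[R]_p) j
  (f : T -> R) : mcoord X -> measurable_fun setT f ->
  mcoord (fun w => upd (X w) j (f w)).
Proof.
by move=> mX mf i; under eq_fun do rewrite mxE; case: eqP => // _; exact: mX.
Qed.

(* The law of [G] is invariant when one coordinate is resampled from N(0, 1);
   this is the only form in which joint normality is used. *)
Definition standard_gaussian {d} {T : measurableType d} (P : probability T R)
    {p} (G : T -> 'cV[R]_p) : Prop :=
  mcoord G /\ forall j (F : 'cV[R]_p -> R), cmeas F -> (forall x, 0 <= F x) ->
    (\int[P]_w (F (G w))%:E = \int[P]_w \int[nu]_t (F (upd (G w) j t))%:E)%E.

Lemma measurable_fun_upd {d} {T : measurableType d} {p} (X : T -> 'cV[R]_p) j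
  (F : 'cV[R]_p -> R) : mcoord X -> cmeas F ->
  measurable_fun setT (fun z : T * measurableTypeR R => F (upd (X z.1) j z.2)).
Proof.
move=> mX mF; apply: mF; apply: mcoord_upd.
  exact: (mcoord_comp measurable_fst mX).
exact: measurable_snd.
Qed.

(** Induction on [p], adjoining an independent coordinate at index 0 on a product space. For an old
    coordinate, the new one is integrated last and the induction hypothesis applies under that
    integral; resampling the new coordinate leaves an integrand that no longer depends on it. *)
Lemma standard_gaussian_exists p : exists d (T : measurableType d)
  (P : probability T R) (G : T -> 'cV[R]_p), standard_gaussian P G.
Proof.
elim: p => [|p [d [T [P [G [mG rG]]]]]].
  exists _, _, nu, (fun _ => 0); split; last by case.
  exact: mcoord_cst.
pose ext (x : 'cV[R]_p) (t : R) : 'cV[R]_p.+1 :=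
  \col_i (if unlift ord0 i is Some i' then x i' ord0 else t).
pose G' (z : T * measurableTypeR R) := ext (G z.1) z.2.
have mext d1 (T1 : measurableType d1) (X : T1 -> 'cV[R]_p) (f : T1 -> R) :
    mcoord X -> measurable_fun setT f -> mcoord (fun w => ext (X w) (f w)).
  move=> mX mf i; rewrite /ext; under eq_fun do rewrite mxE.
  by case: (unlift ord0 i) => [i'|//]; exact: mX.
have mG' : mcoord G'.
  by apply: mext; [exact: (mcoord_comp measurable_fst mG)|exact: measurable_snd].
exists _, _, (P \x nu)%E, G'; split => // j F mF F0.
have mFG' : measurable_fun setT (fun z => (F (G' z))%:E).
  by apply/measurable_EFinP; exact: mF.
have FG'0 z : (0 <= (F (G' z))%:E)%E by rewrite lee_fin.
have mPhi : measurable_fun setT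
    (fun z => \int[nu]_t (F (upd (G' z) j t))%:E)%E.
  apply: (@measurable_fun_fubini_tonelli_F _ _ _ _ _ nu
    (fun z => (F (upd (G' z.1) j z.2))%:E)).
  - by apply/measurable_EFinP; exact: measurable_fun_upd.
  - by move=> z; rewrite lee_fin.
have Phi0 z : (0 <= \int[nu]_t (F (upd (G' z) j t))%:E)%E.
  by apply: integral_ge0 => t _; rewrite lee_fin.
case: (unliftP ord0 j) => [j' jE|jE].
- rewrite fubini_tonelli2// [RHS]fubini_tonelli2//; apply: eq_integral => t _.
  have mFt : cmeas (fun x => F (ext x t)).
    by move=> d1 T1 X mX; apply: mF; apply: mext.
  rewrite /fubini_G /= (rG j' (fun x => F (ext x t)))//.
  apply: eq_integral => w _; apply: eq_integral => u _; congr (F _)%:E.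
  apply/colP => i; rewrite !mxE /= jE.
  case: (unliftP ord0 i) => [i' ->|->].
    by rewrite (inj_eq (@lift_inj _ ord0)) mxE.
  by rewrite -[_ == lift _ _]negbK neq_lift.
- rewrite fubini_tonelli1// [RHS]fubini_tonelli1//; apply: eq_integral => w _.
  rewrite /fubini_F /=.
  have E (t u : R) : upd (ext (G w) t) j u = ext (G w) u.
    apply/colP => i; rewrite !mxE jE.
    by case: (unliftP ord0 i) => [i' ->|->]; rewrite ?eqxx// eq_sym (negbTE (neq_lift _ _)).
  transitivity (\int[nu]_t (\int[nu]_u (F (ext (G w) u))%:E))%E; last first.
    by apply: eq_integral => t _; apply: eq_integral => u _; rewrite E.
  by rewrite integral_cst// [X in (_ * X)%E](probability_setT nu) mule1.
Qed.

End standard_gaussian.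

Section gaussian_vector.
Context {R : realType}.
Local Notation nu := (normal_prob (0 : R) 1).
Context {d} {T : measurableType d} (P : probability T R) {p : nat}.
Variable G : T -> 'cV[R]_p.
Hypothesis gG : standard_gaussian P G.

Let mG : mcoord G. Proof. by case: gG. Qed.

Lemma Ex_resample j (F : 'cV[R]_p -> R) : cmeas F ->
  (forall x, nu.-integrable setT (fun t => (F (upd x j t))%:E)) ->
  P.-integrable setT (EFin \o (fun w => F (G w))) ->
  Ex P (fun w => F (G w)) = Ex P (fun w => Ex nu (fun t => F (upd (G w) j t))).
Proof.
move=> mF iF iFG.
have key (H : 'cV[R]_p -> R) : cmeas H -> (forall x, 0 <= H x) ->
    (forall x, `|H x| <= `|F x|) ->
    [/\ P.-integrable setT (EFin \o (fun w => H (G w))),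
        P.-integrable setT (EFin \o (fun w => Ex nu (fun t => H (upd (G w) j t)))),
        (forall x, nu.-integrable setT (fun t => (H (upd x j t))%:E)) &
        Ex P (fun w => H (G w)) = Ex P (fun w => Ex nu (fun t => H (upd (G w) j t)))].
  move=> mH H0 HF.
  have iH x : nu.-integrable setT (fun t => (H (upd x j t))%:E).
    apply: le_integrable (iF x) => //.
      apply/measurable_EFinP; apply: mH; apply: mcoord_upd; first exact: mcoord_cst.
      exact: measurable_id.
    by move=> t _; rewrite /= lee_fin; exact: HF.
  have HE w : (Ex nu (fun t => H (upd (G w) j t)))%:E =
      (\int[nu]_t (H (upd (G w) j t))%:E)%E.
    by rewrite fineK// integrable_fin_num//; exact: iH.
  have iHG : P.-integrable setT (EFin \o (fun w => H (G w))).
    apply: le_integrable iFG => //; first by apply/measurable_EFinP; exact: mH.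
    by move=> w _; rewrite /= lee_fin; exact: HF.
  have E : (\int[P]_w (H (G w))%:E =
            \int[P]_w (Ex nu (fun t => H (upd (G w) j t)))%:E)%E.
    by rewrite (proj2 gG j)//; apply: eq_integral => w _; rewrite HE.
  split => //; last by rewrite /Rintegral E.
  apply/integrableP; split.
    rewrite /comp; under eq_fun do rewrite HE.
    apply: (@measurable_fun_fubini_tonelli_F _ _ _ _ _ nu
      (fun z => (H (upd (G z.1) j z.2))%:E)).
      by apply/measurable_EFinP; exact: (@measurable_fun_upd R d T p G j H mG mH).
    by move=> z; rewrite lee_fin.
  have /integrableP[_] := iHG; apply: le_lt_trans; rewrite /= le_eqVlt.
  apply/orP; left; apply/eqP; transitivity (\int[P]_w (H (G w))%:E)%E.
    rewrite E; apply: eq_integral => w _; rewrite ger0_norm//.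
    by apply: Rintegral_ge0.
  by apply: eq_integral => w _; rewrite ger0_norm.
pose Fp x := Num.max (F x) 0; pose Fn x := Num.max (- F x) 0.
have FE x : F x = Fp x - Fn x.
  rewrite /Fp /Fn; have [F0|F0] := leP 0 (F x).
    by rewrite max_r ?subr0// oppr_le0.
  by rewrite max_l ?opprK ?add0r// oppr_ge0 ltW.
have mFp : cmeas Fp.
  by move=> d' T' X mX; apply: measurable_maxr => //; exact: mF.
have mFn : cmeas Fn.
  move=> d' T' X mX; apply: measurable_maxr => //.
  by apply: measurableT_comp => //; exact: mF.
have [i1 i2 i3 E1] := key Fp mFp (fun x => ltac:(by rewrite le_max lexx orbT))
  (fun x => ltac:(rewrite /Fp; have [F0|F0] := leP 0 (F x); by rewrite ?normr0)).
have [j1 j2 j3 E2] := key Fn mFn (fun x => ltac:(by rewrite le_max lexx orbT))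
  (fun x => ltac:(rewrite /Fn; have [F0|F0] := leP 0 (- F x);
     by rewrite ?normr0 ?normrN)).
transitivity (Ex P (fun w => Fp (G w)) - Ex P (fun w => Fn (G w))).
  by rewrite -(RintegralB measurableT i1 j1); apply: eq_Ex => w; exact: FE.
rewrite E1 E2 -(RintegralB measurableT i2 j2); apply: eq_Ex => w.
by rewrite -(RintegralB measurableT (i3 _) (j3 _)); apply: eq_Ex => t; rewrite -FE.
Qed.

Lemma Ex_resample_bounded j (F : 'cV[R]_p -> R) (M : R) : cmeas F ->
  (forall x, `|F x| <= M) ->
  Ex P (fun w => F (G w)) = Ex P (fun w => Ex nu (fun t => F (upd (G w) j t))).
Proof.
move=> mF FM; apply: Ex_resample => // [x|].
  apply: (@bounded_integrable _ _ (measurableTypeR R) _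
    (fun t => F (upd x j t)) M) => //.
  by apply: mF; apply: mcoord_upd; [exact: mcoord_cst|exact: measurable_id].
by apply: (@bounded_integrable _ _ _ _ _ M) => //; exact: mF.
Qed.

Lemma cmeas_sum_comp (r : seq 'I_p) (h : 'I_p -> R -> R) (b : R) :
  (forall j, measurable_fun setT (h j)) ->
  cmeas (fun x : 'cV[R]_p => \sum_(j <- r) h j (x j ord0) + b).
Proof.
move=> mh d' T' X mX; apply: measurable_funD => //; apply: measurable_sum => j.
by apply: measurableT_comp => //; exact: mX.
Qed.

Lemma sum_upd_notin (r : seq 'I_p) (h : 'I_p -> R -> R) j x t : j \notin r ->
  \sum_(i <- r) h i (upd x j t i ord0) = \sum_(i <- r) h i (x i ord0).
Proof.
move=> jr; apply: eq_big_seq => i ir; rewrite upd_other//.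
by apply: contraNneq jr => <-.
Qed.

(** The coordinates are integrated out one at a time: the terms not yet treated are absorbed in the
    phase, and resampling coordinate j produces the factor exp(-a_j^2 / 2). *)
Lemma Ex_gaussian_cos (a : 'cV[R]_p) (theta : R) :
  Ex P (fun w => cos (dotp a (G w) + theta)) =
  expR (- (normsq a / 2)) * cos theta.
Proof.
have gen (r : seq 'I_p) : uniq r ->
    Ex P (fun w => cos (\sum_(j <- r) a j ord0 * G w j ord0 + theta)) =
    expR (- ((\sum_(j <- r) a j ord0 ^+ 2) / 2)) * cos theta.
  elim: r => [_|j r IH /= /andP[jr ur]].
    under eq_Ex do rewrite big_nil add0r.
    by rewrite Ex_cst big_nil mul0r oppr0 expR0 mul1r.
  pose h (i : 'I_p) (t : R) := a i ord0 * t.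
  have mh i : measurable_fun setT (h i) by exact: measurable_funM.
  have mF : cmeas (fun x : 'cV[R]_p => cos (\sum_(i <- j :: r) h i (x i ord0) + theta)).
    move=> d' T' X mX; apply: (measurableT_comp measurable_cos).
    exact: (@cmeas_sum_comp (j :: r) h theta mh).
  have := @Ex_resample_bounded j _ 1 mF (fun x => normr_cos_le1 _).
  rewrite /h => ->.
  under eq_Ex => w.
    under eq_Ex => t do rewrite big_cons upd_same (@sum_upd_notin _ h)// -addrA.
    rewrite (Ex_normal_cos ltr01); over.
  rewrite RintegralZl//; last first.
    apply: (@bounded_integrable _ _ _ _ _ 1) => [|w]; last exact: normr_cos_le1.
    apply: (measurableT_comp measurable_cos).
    exact: (@cmeas_sum_comp r h theta mh).
  rewrite /h IH// mulrA -expRD big_cons; congr (expR _ * _).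
  by rewrite expr1n mul1r; field.
by rewrite -gen ?index_enum_uniq.
Qed.

(** Resampling coordinate j turns (h_j + b)^2 into v_j + b^2, the cross term vanishing because h_j
    is centered. The identity is between extended reals, so that it also yields integrability. *)
Lemma integral_gaussian_sum_sqr (h : 'I_p -> R -> R) (v : 'I_p -> R) :
  (forall j, measurable_fun setT (h j)) ->
  (forall j, nu.-integrable setT (EFin \o h j)) ->
  (forall j, nu.-integrable setT (EFin \o (fun t => h j t ^+ 2))) ->
  (forall j, Ex nu (h j) = 0) -> (forall j, Ex nu (fun t => h j t ^+ 2) = v j) ->
  (\int[P]_w ((\sum_j h j (G w j ord0)) ^+ 2)%:E = (\sum_j v j)%:E)%E.
Proof.
move=> mh ih ih2 h0 hv.
have gen (r : seq 'I_p) : uniq r ->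
    (\int[P]_w ((\sum_(j <- r) h j (G w j ord0)) ^+ 2)%:E =
     (\sum_(j <- r) v j)%:E)%E.
  elim: r => [_|j r IH /= /andP[jr ur]].
    by under eq_integral do rewrite big_nil expr0n/=; rewrite integral0 big_nil.
  have mS (r' : seq 'I_p) :
      cmeas (fun x : 'cV[R]_p => (\sum_(i <- r') h i (x i ord0)) ^+ 2).
    move=> d' T' X mX; apply: measurable_funX; apply: measurable_sum => i.
    by apply: measurableT_comp => //; exact: mX.
  rewrite (proj2 gG j (fun x => (\sum_(i <- j :: r) h i (x i ord0)) ^+ 2))//;
    last by move=> x; exact: sqr_ge0.
  transitivity (\int[P]_w ((v j)%:E + ((\sum_(i <- r) h i (G w i ord0)) ^+ 2)%:E))%E.
    apply: eq_integral => w _.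
    set b := \sum_(i <- r) h i (G w i ord0).
    pose q t := h j t ^+ 2 + ((2 * b) * h j t + b ^+ 2).
    have ib : nu.-integrable setT (EFin \o (fun t => (2 * b) * h j t + b ^+ 2)).
      apply: integrable_addr; first exact: integrable_mulrl.
      by apply: (@bounded_integrable _ _ (measurableTypeR R) _ (cst (b ^+ 2)) `|b ^+ 2|).
    have iq : nu.-integrable setT (EFin \o q) by exact: integrable_addr.
    transitivity (Ex nu q)%:E.
      rewrite fineK ?integrable_fin_num//; apply: eq_integral => t _.
      by rewrite big_cons upd_same sum_upd_notin// -/b /q; congr (_%:E); ring.
    rewrite -EFinD; congr (_%:E); rewrite /q RintegralD// hv; congr (_ + _).
    rewrite RintegralD//; last 2 first.
    - exact: integrable_mulrl.
    - by apply: (@bounded_integrable _ _ (measurableTypeR R) _ (cst (b ^+ 2)) `|b ^+ 2|).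
    by rewrite RintegralZl// h0 mulr0 add0r Ex_cst.
  have v0 : 0 <= v j.
    by rewrite -hv; apply: Rintegral_ge0 => t _; exact: sqr_ge0.
  rewrite ge0_integralD//=.
  - rewrite integral_cst// [X in (_ * X)%E](probability_setT P) mule1 IH//.
    by rewrite big_cons EFinD.
  - by move=> w _; rewrite lee_fin sqr_ge0.
  - by apply/measurable_EFinP; exact: mS.
by rewrite gen ?index_enum_uniq.
Qed.

End gaussian_vector.

(** * Gaussian measure of a shell *)

Section radial_profile.
Context {R : realType} (eps m : R).
Hypothesis eps_gt0 : 0 < eps.

(** A smoothed norm: with s = |x|^2 it is smooth across the origin, and being at least eps it keeps
    [profile] bounded. *)
Definition regsqrt (s : R) : R := Num.sqrt (s + eps ^+ 2).

(** The arctangent varies by a bounded amount while its derivative is at least 1/2 up to distance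
    eps from [m]. Since it is less than 2 in absolute value, the shift by 3 keeps the ramp between
    eps and 5 eps; the lower bound is what serves near the origin. *)
Definition ramp (t : R) : R := eps * (3 + atan ((t - m) / eps)).

Definition ramp' (t : R) : R := (1 + ((t - m) / eps) ^+ 2)^-1.

(* With [x] of squared norm [s], [profile s *: x] is the smoothed radial vector
   field [ramp(|x|) x / |x|]. *)
Definition profile (s : R) : R := ramp (regsqrt s) / regsqrt s.

Definition profile' (s : R) : R :=
  ramp' (regsqrt s) / (2 * regsqrt s ^+ 2) - ramp (regsqrt s) / (2 * regsqrt s ^+ 3).

Lemma ramp_ge t : eps <= ramp t.
Proof.
rewrite /ramp ler_peMr ?ltW//.
have := atan_gtNpi2 ((t - m) / eps); have := @pihalf_lt2 R.
by set a := atan _; set b := pi / 2; lra.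
Qed.

Lemma ramp_le t : ramp t <= 5 * eps.
Proof.
rewrite mulrC /ramp ler_pM2l//.
have := atan_ltpi2 ((t - m) / eps); have := @pihalf_lt2 R.
by set a := atan _; set b := pi / 2; lra.
Qed.

Lemma ramp_ge0 t : 0 <= ramp t.
Proof. exact: le_trans (ltW eps_gt0) (ramp_ge t). Qed.

Lemma ramp'_den_gt0 t : 0 < 1 + ((t - m) / eps) ^+ 2.
Proof. by rewrite ltr_pwDl// sqr_ge0. Qed.

Lemma ramp'_ge0 t : 0 <= ramp' t.
Proof. by rewrite invr_ge0 ltW// ramp'_den_gt0. Qed.

Lemma ramp'_le1 t : ramp' t <= 1.
Proof. by rewrite invf_le1 ?ramp'_den_gt0// lerDl sqr_ge0. Qed.

Lemma ramp'_ge_half t : `|t - m| <= eps -> 1 / 2 <= ramp' t.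
Proof.
move=> h; rewrite /ramp' div1r lef_pV2 ?posrE ?ramp'_den_gt0//.
suff : ((t - m) / eps) ^+ 2 <= 1 by lra.
rewrite -(real_normK (num_real _)) expr_le1// normrM normfV (gtr0_norm eps_gt0).
by rewrite ler_pdivrMr// mul1r.
Qed.

Section at_nonneg.
Variable s : R.
Hypothesis s_ge0 : 0 <= s.

Lemma regsqrt_arg_gt0 : 0 < s + eps ^+ 2.
Proof. by rewrite ltr_wpDl// exprn_gt0. Qed.

Lemma regsqrt_gt0 : 0 < regsqrt s.
Proof. by rewrite sqrtr_gt0 regsqrt_arg_gt0. Qed.

Lemma sqr_regsqrt : regsqrt s ^+ 2 = s + eps ^+ 2.
Proof. by rewrite sqr_sqrtr// ltW// regsqrt_arg_gt0. Qed.

Lemma regsqrt_ge : eps <= regsqrt s.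
Proof.
rewrite -(@ler_pXn2r _ 2)// ?nnegrE ?(ltW eps_gt0) ?(ltW regsqrt_gt0)//.
by rewrite sqr_regsqrt lerDr.
Qed.

Lemma is_derive_regsqrt : is_derive s 1 regsqrt (2 * regsqrt s)^-1.
Proof.
have dD : is_derive s 1 (fun s : R => s + eps ^+ 2) 1.
  by apply: is_derive_eq; rewrite addr0.
have := @is_derive1_comp _ Num.sqrt (fun s => s + eps ^+ 2) s _ _
  (is_derive1_sqrt regsqrt_arg_gt0) dD.
by rewrite mulr1.
Qed.

Lemma is_derive_ramp (t : R) : is_derive t 1 ramp (ramp' t).
Proof.
rewrite /ramp /ramp'; apply: is_derive_eq; rewrite /GRing.scale/=.
by set c := (1 + _ ^+ 2)^-1; field; rewrite gt_eqF.
Qed.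

Lemma is_derive_profile : is_derive s 1 profile (profile' s).
Proof.
have q0 : regsqrt s != 0 by rewrite gt_eqF// regsqrt_gt0.
have dq := is_derive_regsqrt.
have dqV : is_derive s 1 (fun s => (regsqrt s)^-1)
  (- (regsqrt s) ^- 2 *: (2 * regsqrt s)^-1) by exact: is_deriveV.
have dr := is_derive1_comp (is_derive_ramp (regsqrt s)) dq.
have := is_deriveM dr dqV; move=> /is_derive_eq; apply.
by rewrite /profile' /GRing.scale/=; field.
Qed.

Lemma continuous_profile' : {for s, continuous profile'}.
Proof.
have q0 : regsqrt s != 0 by rewrite gt_eqF// regsqrt_gt0.
have cq : regsqrt x @[x --> s] --> regsqrt s.
  apply: differentiable_continuous; apply/derivable1_diffP.
  exact: (@ex_derive _ _ _ _ _ _ _ is_derive_regsqrt).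
have cramp : ramp (regsqrt x) @[x --> s] --> ramp (regsqrt s).
  apply: (cvg_comp _ _ cq); apply: differentiable_continuous.
  by apply/derivable1_diffP; exact: (@ex_derive _ _ _ _ _ _ _ (is_derive_ramp _)).
apply: cvgB; apply: cvgM.
- apply: cvgV; first by rewrite gt_eqF// ramp'_den_gt0.
  apply: cvgD; first exact: cvg_cst.
  rewrite expr2; under eq_fun do rewrite expr2.
  by apply: cvgM; apply: cvgM; try exact: cvg_cst; apply: cvgB => //; exact: cvg_cst.
- apply: cvgV; first by rewrite mulf_neq0// expf_neq0.
  apply: cvgM; first exact: cvg_cst.
  rewrite expr2; under eq_fun do rewrite expr2.
  exact: cvgM.
- exact: cramp.
- apply: cvgV; first by rewrite mulf_neq0// expf_neq0.
  apply: cvgM; first exact: cvg_cst.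
  rewrite exprS expr2; under eq_fun do rewrite exprS expr2.
  by do 2 apply: cvgM => //.
Qed.

Lemma profile_ge0 : 0 <= profile s.
Proof. by rewrite divr_ge0 ?ramp_ge0// ltW// regsqrt_gt0. Qed.

Lemma profile_le5 : profile s <= 5.
Proof.
rewrite ler_pdivrMr ?regsqrt_gt0//; apply: le_trans (ramp_le _) _.
by rewrite ler_pM2l// regsqrt_ge.
Qed.

(** For y a coordinate of x and s = |x|^2, this is the derivative of y [profile] s along that
    coordinate. The constant is 5 + 1 + 5; the bound justifies integrability and Stein's identity
    and does not enter the final estimate. *)
Lemma profile'_bound (y : R) : y ^+ 2 <= s -> `|profile s + 2 * y ^+ 2 * profile' s| <= 11.
Proof.
move=> ys; pose q := regsqrt s.
have q0 : 0 < q by exact: regsqrt_gt0.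
have yq : y ^+ 2 <= q ^+ 2 by rewrite sqr_regsqrt (le_trans ys)// lerDl sqr_ge0.
have -> : profile s + 2 * y ^+ 2 * profile' s =
    profile s + (y ^+ 2 / q ^+ 2) * ramp' q - (y ^+ 2 / q ^+ 2) * profile s.
  by rewrite /profile' /profile -/q; field; rewrite gt_eqF.
have z0 : 0 <= y ^+ 2 / q ^+ 2 by rewrite divr_ge0 ?sqr_ge0.
have z1 : y ^+ 2 / q ^+ 2 <= 1 by rewrite ler_pdivrMr ?exprn_gt0// mul1r.
have := profile_ge0; have := profile_le5; have := ramp'_ge0 q; have := ramp'_le1 q.
move: (y ^+ 2 / q ^+ 2) z0 z1 (ramp' q) (profile s) => z z0 z1 r k r1 r0 k5 k0.
have : 0 <= z * r <= 1 by rewrite mulr_ge0//= mulr_ile1.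
have : 0 <= z * k <= 5.
  by rewrite mulr_ge0//= (le_trans (ler_wpM2r k0 z1))// mul1r.
by rewrite ler_norml; lra.
Qed.

(* Up to the factor 4, the divergence of the field, once its part
   [(p - 1) profile] is removed, dominates the indicator of a shell. *)
Lemma profile_shell (r : R) : 0 <= r -> m = Num.sqrt (r ^+ 2 + eps ^+ 2) ->
  r ^+ 2 <= s <= (r + eps) ^+ 2 -> 1 <= 4 * (profile s + 2 * s * profile' s).
Proof.
move=> r0 mE /andP[rs sr]; pose q := regsqrt s.
have q0 : 0 < q by exact: regsqrt_gt0.
have q2 : q ^+ 2 = s + eps ^+ 2 by exact: sqr_regsqrt.
have m0 : 0 < m by rewrite mE sqrtr_gt0 ltr_wpDl ?sqr_ge0// exprn_gt0.
have m2 : m ^+ 2 = r ^+ 2 + eps ^+ 2.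
  by rewrite mE sqr_sqrtr// addr_ge0 ?sqr_ge0.
have rm : r <= m.
  by rewrite -(@ler_pXn2r _ 2)// ?nnegrE ?(ltW m0)// m2 lerDl sqr_ge0.
have mq : m <= q.
  by rewrite -(@ler_pXn2r _ 2)// ?nnegrE ?(ltW m0) ?(ltW q0)// m2 q2 lerD2r.
(* [m] is the smoothed norm on the inner sphere, and the smoothed norm grows no faster than the
   norm: the shell is sent into [m, m + eps], where [ramp'] is at least 1/2. *)
have qm : q <= m + eps.
  rewrite -(@ler_pXn2r _ 2)// ?nnegrE ?(ltW q0) ?addr_ge0 ?(ltW m0) ?(ltW eps_gt0)//.
  rewrite q2; apply: (@le_trans _ _ ((r + eps) ^+ 2 + eps ^+ 2)); first by rewrite lerD2r.
  rewrite !sqrrD m2 -subr_ge0.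
  have -> : r ^+ 2 + eps ^+ 2 + m * eps *+ 2 + eps ^+ 2 -
    (r ^+ 2 + r * eps *+ 2 + eps ^+ 2 + eps ^+ 2) = (m - r) * eps * 2 by ring.
  by rewrite !mulr_ge0 ?subr_ge0// ltW.
have hr : 1 / 2 <= ramp' q.
  by apply: ramp'_ge_half; rewrite ger0_norm ?subr_ge0// lerBlDl.
have he := ramp_ge q.
have qq : profile s + 2 * s * profile' s =
    (s * ramp' q) / q ^+ 2 + (ramp q * eps ^+ 2) / q ^+ 3.
  have -> : eps ^+ 2 = q ^+ 2 - s by rewrite q2; ring.
  by rewrite /profile' /profile -/q; field; rewrite gt_eqF.
have t1 : 0 <= (s * ramp' q) / q ^+ 2.
  by rewrite divr_ge0 ?sqr_ge0// mulr_ge0// ramp'_ge0.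
have t2 : 0 <= (ramp q * eps ^+ 2) / q ^+ 3.
  by rewrite divr_ge0 ?exprn_ge0// ?(ltW q0)// mulr_ge0 ?sqr_ge0// ramp_ge0.
(* Away from the origin, s >= eps^2 gives q^2 <= 2 s, and the first term is at least (s/2) / (2s).
   Near it, q <= 2 eps and q^2 <= 2 eps^2, and the second term is at least eps^3 / (4 eps^3). *)
rewrite qq; have [es|se] := leP (eps ^+ 2) s.
- suff : 1 / 4 <= (s * ramp' q) / q ^+ 2 by lra.
  rewrite ler_pdivlMr ?exprn_gt0// q2.
  have : s * (1 / 2) <= s * ramp' q by rewrite ler_wpM2l.
  by move: es; lra.
- suff : 1 / 4 <= (ramp q * eps ^+ 2) / q ^+ 3 by lra.
  rewrite ler_pdivlMr ?exprn_gt0//.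
  have e3 : eps * eps ^+ 2 <= ramp q * eps ^+ 2 by rewrite ler_wpM2r ?sqr_ge0.
  apply: le_trans e3.
  have q2e : q <= 2 * eps.
    rewrite -(@ler_pXn2r _ 2)// ?nnegrE ?(ltW q0) ?mulr_ge0 ?(ltW eps_gt0)//.
    rewrite q2 exprMn; have := sqr_ge0 eps; move: se; set e := eps ^+ 2; lra.
  have : q * q ^+ 2 <= 2 * eps * (2 * eps ^+ 2).
    apply: ler_pM; rewrite ?(ltW q0) ?sqr_ge0//.
    by rewrite q2; move: se; set e := eps ^+ 2; lra.
  rewrite exprS; lra.
Qed.

Lemma profile_shell_ge0 : 0 <= profile s + 2 * s * profile' s.
Proof.
pose q := regsqrt s.
have q0 : 0 < q by exact: regsqrt_gt0.
have -> : profile s + 2 * s * profile' s =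
    (s * ramp' q) / q ^+ 2 + (ramp q * eps ^+ 2) / q ^+ 3.
  have -> : eps ^+ 2 = q ^+ 2 - s by rewrite sqr_regsqrt; ring.
  by rewrite /profile' /profile -/q; field; rewrite gt_eqF.
rewrite addr_ge0// divr_ge0 ?exprn_ge0 ?(ltW q0)// mulr_ge0 ?sqr_ge0//.
  exact: ramp'_ge0.
exact: ramp_ge0.
Qed.

End at_nonneg.

End radial_profile.

Lemma integrable_nonneg {R : realType} {d} {T : measurableType d}
    (P : probability T R) (f : T -> R) (c : R) :
  measurable_fun setT f -> (forall x, 0 <= f x) ->
  (\int[P]_x (f x)%:E = c%:E)%E ->
  P.-integrable setT (EFin \o f) /\ Ex P f = c.
Proof.
move=> mf f0 fc; split; last by rewrite /Rintegral fc.
apply/integrableP; split; first exact/measurable_EFinP.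
under eq_integral do rewrite /= ger0_norm//.
by rewrite fc ltry.
Qed.

Section gaussian_moments.
Context {R : realType}.
Local Notation nu := (normal_prob (0 : R) 1).
Context {d} {T : measurableType d} (P : probability T R) {p : nat}.
Variable G : T -> 'cV[R]_p.
Hypothesis gG : standard_gaussian P G.

Let mG : mcoord G. Proof. by case: gG. Qed.

Let integrable_pow (k : nat) : (k <= 4)%N ->
  nu.-integrable setT (EFin \o (fun t : R => t ^+ k)).
Proof.
move=> k4; apply: (@integrable_normal_growth _ _ ltr01 _ 1) => [|x].
  exact: measurable_funX.
rewrite mul1r normrX.
have a0 : 0 <= `|x| by [].
have x2 : x ^+ 2 = `|x| ^+ 2 by rewrite real_normK ?num_real.
rewrite x2; move: (`|x|) a0 => a a0.
have a1 : 1 <= 1 + a ^+ 2 by rewrite lerDl sqr_ge0.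
have ae : a <= 1 + a ^+ 2.
  rewrite -subr_ge0; have -> : 1 + a ^+ 2 - a = (a - 1 / 2) ^+ 2 + 3 / 4 by field.
  by rewrite addr_ge0 ?sqr_ge0.
have a2 : a ^+ 2 <= 1 + a ^+ 2 by rewrite lerDr.
have b0 : 0 <= 1 + a ^+ 2 by exact: le_trans a1.
apply: (@le_trans _ _ ((1 + a ^+ 2) ^+ 2)); last by rewrite ler_weXn2l.
case: k k4 => [|[|[|[|[|//]]]]] _.
- by rewrite expr0 exprn_ege1.
- by rewrite expr1 (le_trans ae)// ler_eXnr.
- by rewrite (le_trans a2)// ler_eXnr.
- by rewrite exprS [leRHS]expr2 ler_pM// exprn_ge0.
- by rewrite (exprM a 2 2) [leLHS]expr2 [leRHS]expr2 ler_pM// exprn_ge0.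
Qed.

Let Ex_id : Ex nu (fun t => t) = 0.
Proof.
have := @normal_stein R _ ltr01 (fun=> 1) (fun=> 0) 1.
under eq_Ex do rewrite mulr1.
rewrite Ex_cst mulr0; apply.
- by move=> x; exact: cvg_cst.
- by move=> x; rewrite normr1 mul1r exprn_ege1// lerDl sqr_ge0.
- by move=> x; rewrite normr0 mul1r exprn_ge0// addr_ge0// sqr_ge0.
Qed.

Lemma gaussian_dotp_sqr (c : 'cV[R]_p) :
  P.-integrable setT (EFin \o (fun w => dotp c (G w) ^+ 2)) /\
  Ex P (fun w => dotp c (G w) ^+ 2) = normsq c.
Proof.
apply: integrable_nonneg => [|w|]; last 2 first.
- exact: sqr_ge0.
- apply: (integral_gaussian_sum_sqr gG (h := fun j t => c j ord0 * t)
    (v := fun j => c j ord0 ^+ 2)) => j.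
  + exact: measurable_funM.
  + by apply: integrable_mulrl; exact: (integrable_pow (k := 1)).
  + under eq_fun do rewrite exprMn.
    by apply: integrable_mulrl; exact: integrable_pow.
  + by rewrite RintegralZl ?Ex_id ?mulr0//; exact: (integrable_pow (k := 1)).
  + under eq_Ex do rewrite exprMn.
    rewrite RintegralZl ?(Ex_normal_sqr ltr01) ?expr1n ?mulr1//.
    exact: integrable_pow.
- by apply: measurable_funX; apply: measurable_dotp => //; exact: mcoord_cst.
Qed.

(** |G|^2 - p is the sum over the coordinates of the centered functions t^2 - 1, each with second
    moment 3 - 2 + 1 = 2. *)
Lemma gaussian_normsq_var :
  P.-integrable setT (EFin \o (fun w => (normsq (G w) - p%:R) ^+ 2)) /\
  Ex P (fun w => (normsq (G w) - p%:R) ^+ 2) = 2 * p%:R.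
Proof.
have i2 := @integrable_pow 2 isT.
have i4 := @integrable_pow 4 isT.
have i1 : nu.-integrable setT (EFin \o (fun _ : R => 1)).
  have := @integrable_pow 0 isT; rewrite /comp.
  by under eq_fun do rewrite expr0.
have E w : normsq (G w) - p%:R = \sum_j (G w j ord0 ^+ 2 - 1).
  rewrite big_split/= sumrN -[in p%:R](card_ord p) -sumr_const.
  by congr (_ - _); apply: eq_bigl => j; rewrite inE.
apply: integrable_nonneg => [|w|]; last 2 first.
- exact: sqr_ge0.
- under eq_integral do rewrite E.
  rewrite (integral_gaussian_sum_sqr gG (h := fun j t => t ^+ 2 - 1)
    (v := fun=> 2)).
  + by rewrite sumr_const card_ord mulr_natr.
  + by move=> j; apply: measurable_funB => //; exact: measurable_funX.
  + by move=> j; exact: integrable_subr.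
  + move=> j; rewrite (_ : (fun t : R => _) = (fun t => t ^+ 4 + (-2 * t ^+ 2 + 1))).
      exact: integrable_addr i4 (integrable_addr (integrable_mulrl (-2) i2) i1).
    by apply/funext => t; ring.
  + move=> j; rewrite RintegralB// (Ex_normal_sqr ltr01) Ex_cst expr1n subrr//.
  + move=> j; transitivity (Ex nu (fun t => t ^+ 4 + (-2 * t ^+ 2 + 1))).
      by apply: eq_Ex => t; ring.
    rewrite RintegralD//; last by apply: integrable_addr => //; exact: integrable_mulrl.
    rewrite RintegralD//; last exact: integrable_mulrl.
    rewrite RintegralZl// (Ex_normal_pow4 ltr01) (Ex_normal_sqr ltr01) Ex_cst.
    by rewrite !expr1n; ring.
- by apply: measurable_funX; apply: measurable_funB => //; exact: measurable_normsq.
Qed.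

Lemma gaussian_coord_sqr j :
  P.-integrable setT (EFin \o (fun w => G w j ord0 ^+ 2)) /\
  Ex P (fun w => G w j ord0 ^+ 2) = 1.
Proof.
have [] := gaussian_dotp_sqr (delta_mx j ord0).
have E x : dotp (delta_mx j ord0) x = x j ord0.
  rewrite /dotp (bigD1 j)//= big1 ?addr0 => [|i ij]; rewrite mxE ?eqxx ?mul1r//.
  by rewrite (negbTE ij) mul0r.
rewrite /comp; under eq_fun do rewrite E; under eq_Ex do rewrite E.
move=> i ->; split => //.
rewrite /normsq (bigD1 j)//= big1 ?addr0 => [|k kj]; rewrite mxE ?eqxx ?expr1n//.
by rewrite (negbTE kj) expr0n.
Qed.

Lemma gaussian_normsq :
  P.-integrable setT (EFin \o (fun w => normsq (G w))) /\
  Ex P (fun w => normsq (G w)) = p%:R.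
Proof.
apply: integrable_nonneg => [|w|].
- exact: measurable_normsq.
- exact: normsq_ge0.
under eq_integral do rewrite /normsq -sumEFin.
rewrite ge0_integral_sum//.
- transitivity (\sum_(j < p) (1 : R)%:E)%E; last by rewrite sumEFin sumr_const card_ord.
  apply: eq_bigr => j _; have [i e] := gaussian_coord_sqr j.
  by rewrite -e fineK// integrable_fin_num.
- by move=> j; apply/measurable_EFinP; apply: measurable_funX; exact: mG.
- by move=> j w _; rewrite lee_fin sqr_ge0.
Qed.

Lemma integrable_gaussian_coordM j (f : T -> R) (M : R) : measurable_fun setT f ->
  (forall w, `|f w| <= M) ->
  P.-integrable setT (EFin \o (fun w => G w j ord0 * f w)).
Proof.
move=> mf fM; have [i _] := gaussian_coord_sqr j.
have i1 : P.-integrable setT (EFin \o (fun _ : T => 1)).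
  by apply: (@bounded_integrable _ _ _ _ _ 1) => // w; rewrite normr1.
apply: le_integrable (integrable_mulrl M (integrable_addr i1 i)) => //.
  by apply/measurable_EFinP; apply: measurable_funM => //; exact: mG.
move=> w _; rewrite /= lee_fin normrM mulrC.
have M0 : 0 <= M by exact: le_trans (fM w).
rewrite [leRHS]ger0_norm; last by rewrite mulr_ge0// addr_ge0// sqr_ge0.
apply: ler_pM => //; rewrite -(real_normK (num_real (G w j ord0))) -subr_ge0.
set a := `|_|; have -> : 1 + a ^+ 2 - a = (a - 1 / 2) ^+ 2 + 3 / 4 by field.
by rewrite addr_ge0 ?sqr_ge0.
Qed.

(** Resampling coordinate j reduces the identity to the one on the line, the other coordinates being
    frozen. *)
Lemma gaussian_stein j (F F' : 'cV[R]_p -> R) (M : R) : cmeas F -> cmeas F' ->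
  (forall x, `|F x| <= M) -> (forall x, `|F' x| <= M) ->
  (forall x (t : R), is_derive t 1 (fun t => F (upd x j t)) (F' (upd x j t))) ->
  (forall x, continuous (fun t => F' (upd x j t))) ->
  Ex P (fun w => G w j ord0 * F (G w)) = Ex P (fun w => F' (G w)).
Proof.
move=> mF mF' FM F'M dF cF'.
have M0 : 0 <= M by exact: le_trans (FM 0).
have w1 (t : R) : M <= M * (1 + t ^+ 2) ^+ 2.
  by rewrite ler_peMr// exprn_ege1// lerDl sqr_ge0.
have mH : cmeas (fun x => x j ord0 * F x).
  by move=> d' T' X mX; apply: measurable_funM; [exact: mX|exact: mF].
have iu (x : 'cV[R]_p) : nu.-integrable setT
    (fun t => (upd x j t j ord0 * F (upd x j t))%:E).
  have mFu : measurable_fun setT (fun t : R => F (upd x j t)).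
    by apply: mF; apply: mcoord_upd; [exact: mcoord_cst|exact: measurable_id].
  under eq_fun do rewrite upd_same.
  apply: (@integrable_normal_growth _ _ ltr01 (fun t => t * F (upd x j t)) M).
    exact: measurable_funM.
  move=> t; rewrite normrM mulrC; apply: ler_pM => //.
  have h : `|t| <= 1 + t ^+ 2.
    rewrite -(real_normK (num_real t)) -subr_ge0.
    set a := `|_|; have -> : 1 + a ^+ 2 - a = (a - 1 / 2) ^+ 2 + 3 / 4 by field.
    by rewrite addr_ge0 ?sqr_ge0.
  by apply: le_trans h _; rewrite ler_eXnr// lerDl sqr_ge0.
rewrite (Ex_resample gG mH iu); last first.
  by apply: (@integrable_gaussian_coordM j _ M) => //; exact: mF.
rewrite (Ex_resample_bounded gG j mF' F'M); apply: eq_Ex => w.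
under eq_Ex do rewrite upd_same.
rewrite (@normal_stein _ _ ltr01 _ (fun t => F' (upd (G w) j t)) M).
- by rewrite expr1n mul1r.
- exact: cF'.
- by move=> t; exact: le_trans (w1 t).
- by move=> t; exact: le_trans (w1 t).
Qed.

End gaussian_moments.

Lemma Ex_sum {R : realType} {d} {T : measurableType d} (P : probability T R)
    (I : Type) (r : seq I) (f : I -> T -> R) :
  (forall i, P.-integrable setT (EFin \o f i)) ->
  P.-integrable setT (EFin \o (fun w => \sum_(i <- r) f i w)) /\
  Ex P (fun w => \sum_(i <- r) f i w) = \sum_(i <- r) Ex P (f i).
Proof.
move=> fi; elim: r => [|i r [IH1 IH2]].
  split; last by under eq_Ex do rewrite big_nil; rewrite big_nil Ex_cst.
  apply: (@bounded_integrable _ _ _ _ _ 0) => [|x]; last by rewrite big_nil normr0.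
  by under eq_fun do rewrite big_nil; exact: measurable_cst.
have E : (fun w => \sum_(i <- i :: r) f i w) = (fun w => f i w + \sum_(i <- r) f i w).
  by apply/funext => w; rewrite big_cons.
rewrite E; split; first exact: integrable_addr.
by rewrite RintegralD// IH2 big_cons.
Qed.

(** * A shell bound uniform in the dimension and in the center *)

Section gaussian_shell.
Context {R : realType}.
Context {d} {T : measurableType d} (P : probability T R) {p : nat}.
Variable G : T -> 'cV[R]_p.
Hypothesis gG : standard_gaussian P G.
Hypothesis p_gt0 : (0 < p)%N.
Variables (u : 'cV[R]_p) (r eps : R).
Hypotheses (r_ge0 : 0 <= r) (eps_gt0 : 0 < eps).

Let mG : mcoord G. Proof. by case: gG. Qed.
Let m : R := Num.sqrt (r ^+ 2 + eps ^+ 2).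
Let k := profile eps m.
Let k' := profile' eps m.
Let N (x : 'cV[R]_p) := normsq (x + u).

Let N_ge0 x : 0 <= N x. Proof. exact: normsq_ge0. Qed.

Let N_upd x j t : N (upd x j t) =
  (t + u j ord0) ^+ 2 + \sum_(i < p | i != j) (x i ord0 + u i ord0) ^+ 2.
Proof.
rewrite /N /normsq (bigD1 j)//= !mxE eqxx; congr (_ + _).
by apply: eq_bigr => i ij; rewrite !mxE (negbTE ij).
Qed.

Let rest_ge0 (x : 'cV[R]_p) j :
  0 <= \sum_(i < p | i != j) (x i ord0 + u i ord0) ^+ 2.
Proof. by apply: sumr_ge0 => i _; exact: sqr_ge0. Qed.

Let continuous_k s : 0 <= s -> {for s, continuous k}.
Proof.
move=> s0; apply: differentiable_continuous; apply/derivable1_diffP.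
exact: (@ex_derive _ _ _ _ _ _ _ (is_derive_profile m eps_gt0 s0)).
Qed.

Let continuous_k' s : 0 <= s -> {for s, continuous k'}.
Proof. exact: continuous_profile'. Qed.

Let cmeas_N (h : R -> R) : (forall s, 0 <= s -> {for s, continuous h}) ->
  cmeas (fun x => h (N x)).
Proof.
move=> ch d' T' X mX.
have ca : continuous (fun s : R => h `|s|).
  by move=> s; apply: continuous_comp; [exact: norm_continuous|exact: ch].
under eq_fun do rewrite -(ger0_norm (N_ge0 _)).
apply: (measurableT_comp (continuous_measurable_fun ca)).
by apply: measurable_normsq; apply: mcoordD => //; exact: mcoord_cst.
Qed.

(** The coordinates of the radial field taken at x + u; [F' j] is the derivative of [F j] along
    coordinate j, so that the sum of the [F' j] is the divergence. *)
Let F j (x : 'cV[R]_p) := (x j ord0 + u j ord0) * k (N x).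
Let F' j (x : 'cV[R]_p) := k (N x) + 2 * (x j ord0 + u j ord0) ^+ 2 * k' (N x).

Let coord_le_N (x : 'cV[R]_p) j : (x j ord0 + u j ord0) ^+ 2 <= N x.
Proof. by rewrite -{2}(upd_id x j) N_upd lerDl. Qed.

Let measurable_coordu j d' (T' : measurableType d') (X : T' -> 'cV[R]_p) :
  mcoord X -> measurable_fun setT (fun w => X w j ord0 + u j ord0).
Proof. by move=> mX; apply: measurable_funD => //; exact: mX. Qed.

Let cmeas_F j : cmeas (F j).
Proof.
move=> d' T' X mX; apply: measurable_funM; first exact: measurable_coordu.
exact: (cmeas_N continuous_k).
Qed.

Let cmeas_F' j : cmeas (F' j).
Proof.
move=> d' T' X mX; apply: measurable_funD; first exact: (cmeas_N continuous_k).
apply: measurable_funM; last exact: (cmeas_N continuous_k').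
by apply: measurable_funM => //; apply: measurable_funX; exact: measurable_coordu.
Qed.

Let F_le j x : `|F j x| <= 5 * eps + 11.
Proof.
have q0 := regsqrt_gt0 eps_gt0 (N_ge0 x).
suff : `|F j x| <= 5 * eps by lra.
rewrite normrM (ger0_norm (profile_ge0 _ eps_gt0 (N_ge0 x))) /k /profile.
rewrite mulrCA; apply: (@le_trans _ _ (ramp eps m (regsqrt eps (N x)))).
  rewrite ler_piMr ?ramp_ge0// ler_pdivrMr// mul1r.
  rewrite -(@ler_pXn2r _ 2)// ?nnegrE ?(ltW q0)// real_normK ?num_real//.
  rewrite sqr_regsqrt// (le_trans (coord_le_N x j))// lerDl sqr_ge0//.
exact: ramp_le.
Qed.

Let F'_le j x : `|F' j x| <= 5 * eps + 11.
Proof.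
apply: le_trans (profile'_bound m eps_gt0 (N_ge0 x) (coord_le_N x j)) _.
by rewrite lerDr mulr_ge0// ltW.
Qed.

Let dF j x (t : R) : is_derive t 1 (fun t => F j (upd x j t)) (F' j (upd x j t)).
Proof.
set b := \sum_(i < p | i != j) (x i ord0 + u i ord0) ^+ 2.
have b0 : 0 <= b by exact: rest_ge0.
have -> : (fun t => F j (upd x j t)) =
    (fun t => (t + u j ord0) * k ((t + u j ord0) ^+ 2 + b)).
  by apply/funext => s; rewrite /F N_upd upd_same.
have s0 : 0 <= (t + u j ord0) ^+ 2 + b by rewrite addr_ge0// sqr_ge0.
have dk := is_derive_profile m eps_gt0 s0.
have dq : is_derive t 1 (fun t : R => (t + u j ord0) ^+ 2 + b) (2 * (t + u j ord0)).
  by apply: is_derive_eq; rewrite /GRing.scale/=; ring.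
have dc := @is_derive1_comp _ k _ t _ _ dk dq.
have dl : is_derive t 1 (fun t : R => t + u j ord0) 1.
  by apply: is_derive_eq; rewrite addr0.
have := is_deriveM dl dc; move=> /is_derive_eq; apply.
rewrite /F' N_upd upd_same -/b /GRing.scale/= /k /k'.
by set c := profile _ _ _; set c' := profile' _ _ _; ring.
Qed.

Let cF' j x : continuous (fun t : R => F' j (upd x j t)).
Proof.
set b := \sum_(i < p | i != j) (x i ord0 + u i ord0) ^+ 2.
have b0 : 0 <= b by exact: rest_ge0.
have -> : (fun t => F' j (upd x j t)) = (fun t =>
    k ((t + u j ord0) ^+ 2 + b) + 2 * (t + u j ord0) ^+ 2 * k' ((t + u j ord0) ^+ 2 + b)).
  by apply/funext => s; rewrite /F' N_upd upd_same.
move=> t.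
have s0 : 0 <= (t + u j ord0) ^+ 2 + b by rewrite addr_ge0// sqr_ge0.
have cl : (x + u j ord0) ^+ 2 @[x --> t] --> (t + u j ord0) ^+ 2.
  rewrite expr2; under eq_fun do rewrite expr2.
  by apply: cvgM; apply: cvgD => //; exact: cvg_cst.
have cq : (x + u j ord0) ^+ 2 + b @[x --> t] --> (t + u j ord0) ^+ 2 + b.
  by apply: cvgD => //; exact: cvg_cst.
apply: cvgD; first exact: (cvg_comp _ _ cq (continuous_k s0)).
apply: cvgM; last exact: (cvg_comp _ _ cq (continuous_k' s0)).
by apply: cvgM => //; exact: cvg_cst.
Qed.

(** [A] is the mean of |G + u|^2 and a + 2b its fluctuation. The second moments 2p of [a] and |u|^2
    of [b] are at most of order [A]. *)
Let a w := normsq (G w) - p%:R.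
Let b w := dotp u (G w).
Let A : R := p%:R + normsq u.

Let A_ge1 : 1 <= A.
Proof. by rewrite (@le_trans _ _ p%:R)// ?ler1n// lerDl normsq_ge0. Qed.

Let A_gt0 : 0 < A. Proof. exact: lt_le_trans A_ge1. Qed.

Let NE w : N (G w) = A + a w + 2 * b w.
Proof.
rewrite /N normsqD /A /a /b (dotpC (G w) u); ring.
Qed.

(** The inner product of G with G + u is p + a + b, so subtracting (p - 1) [k] cancels the main term
    and leaves the fluctuations. *)
Let drift w : \sum_j G w j ord0 * F j (G w) - (p%:R - 1) * k (N (G w)) =
  (a w + b w + 1) * k (N (G w)).
Proof.
have -> : \sum_j G w j ord0 * F j (G w) =
    (normsq (G w) + dotp u (G w)) * k (N (G w)).
  rewrite /normsq /dotp -big_split/= mulr_suml; apply: eq_bigr => j _.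
  by rewrite /F; ring.
by rewrite /a /b; ring.
Qed.

(** The ramp is at most 5 eps, so it remains to bound (a + b + 1) / q, where q >= |G + u|. When |G +
    u|^2 is at least half its mean the denominator is large; otherwise the fluctuations are
    themselves of order [A]. The coefficients of the bound are those that cover both cases. *)
Let drift_le w : (a w + b w + 1) * k (N (G w)) <=
  5 * eps * (1 + A^-1 * (3 * a w ^+ 2 + 8 * b w ^+ 2 + 3 + normsq (G w))).
Proof.
set B := 3 * a w ^+ 2 + _ + _ + _.
have B0 : 0 <= B.
  by rewrite /B !addr_ge0 ?normsq_ge0// mulr_ge0// sqr_ge0.
have B1 : 0 <= 1 + A^-1 * B by rewrite addr_ge0// mulr_ge0// invr_ge0 ltW.
pose q := regsqrt eps (N (G w)).
have q0 : 0 < q := regsqrt_gt0 eps_gt0 (N_ge0 (G w)).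
have q2 : q ^+ 2 = N (G w) + eps ^+ 2 := sqr_regsqrt eps_gt0 (N_ge0 (G w)).
have qN : N (G w) <= q ^+ 2 by rewrite q2 lerDl sqr_ge0.
have [n0|n0] := leP (a w + b w + 1) 0.
  apply: (@le_trans _ _ 0); first by rewrite mulr_le0_ge0// profile_ge0.
  by rewrite !mulr_ge0// ltW.
suff h : (a w + b w + 1) / q <= 1 + A^-1 * B.
  rewrite /k /profile -/q.
  have -> : (a w + b w + 1) * (ramp eps m q / q) =
    ramp eps m q * ((a w + b w + 1) / q) by ring.
  by apply: ler_pM; rewrite ?ramp_ge0 ?ramp_le// divr_ge0// ltW.
have [NA|NA] := leP (A / 2) (N (G w)).
- have AG : (a w + b w + 1) / q <= ((a w + b w + 1) ^+ 2 / q ^+ 2 + 1) / 2.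
    rewrite -subr_ge0 -expr_div_n.
    have -> : (((a w + b w + 1) / q) ^+ 2 + 1) / 2 - (a w + b w + 1) / q =
      ((a w + b w + 1) / q - 1) ^+ 2 / 2 by field; rewrite gt_eqF.
    by rewrite divr_ge0// sqr_ge0.
  have : (a w + b w + 1) ^+ 2 / q ^+ 2 <= 2 * (A^-1 * B).
    rewrite ler_pdivrMr ?exprn_gt0//.
    apply: (@le_trans _ _ (2 * (A^-1 * B) * (A / 2))); last first.
      by rewrite ler_wpM2l ?(le_trans NA qN)// !mulr_ge0// invr_ge0 ltW.
    have -> : 2 * (A^-1 * B) * (A / 2) = B by field; rewrite gt_eqF.
    rewrite -subr_ge0 /B.
    have -> : 3 * a w ^+ 2 + 8 * b w ^+ 2 + 3 + normsq (G w) - (a w + b w + 1) ^+ 2 =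
      (a w - b w) ^+ 2 + (a w - 1) ^+ 2 + (b w - 1) ^+ 2 + 5 * b w ^+ 2 + normsq (G w) by ring.
    by rewrite !addr_ge0 ?sqr_ge0 ?normsq_ge0// mulr_ge0// sqr_ge0.
  move: ((a w + b w + 1) / q) ((a w + b w + 1) ^+ 2 / q ^+ 2) (A^-1 * B) AG.
  by move=> x1 x2 x3; lra.
(* Second case: by Cauchy-Schwarz the quotient is at most |G|, and A <= 2 |a + 2b|. So A |G| <=
   |G|^2 + (a + 2b)^2, and (a + 2b)^2 <= 2 a^2 + 8 b^2 accounts for the coefficient 8. *)
- have Nq : a w + b w + 1 <= enorm (G w) * q.
    have -> : a w + b w + 1 = dotp (G w) (G w + u) - (p%:R - 1).
      by rewrite dotpDr -normsqE /a /b (dotpC (G w) u); ring.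
    have p1 : 1 <= p%:R :> R by rewrite ler1n.
    have : dotp (G w) (G w + u) <= enorm (G w) * q.
      apply: le_trans (ler_norm _) _; apply: le_trans (normr_dotp_le _ _) _.
      rewrite ler_wpM2l ?enorm_ge0//.
      by rewrite -(@ler_pXn2r _ 2)// ?nnegrE ?enorm_ge0 ?(ltW q0)// sqr_enorm.
    by move: p1; lra.
  have h1 : (a w + b w + 1) / q <= enorm (G w) by rewrite ler_pdivrMr.
  apply: le_trans h1 _.
  have h2 : A / 2 <= `|a w + 2 * b w|.
    move: NA; rewrite NE => NA; rewrite ler_normr; apply/orP; right; lra.
  suff : enorm (G w) * A <= A + B.
    by rewrite -ler_pdivlMr// mulrDl divff ?gt_eqF// mulrC.
  apply: (@le_trans _ _ (enorm (G w) * (2 * `|a w + 2 * b w|))).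
    rewrite ler_wpM2l ?enorm_ge0//; lra.
  have : enorm (G w) * (2 * `|a w + 2 * b w|) <= normsq (G w) + (a w + 2 * b w) ^+ 2.
    rewrite -sqr_enorm -(real_normK (num_real (a w + 2 * b w))) -subr_ge0.
    set e := enorm _; set z := `|_|.
    have -> : e ^+ 2 + z ^+ 2 - e * (2 * z) = (e - z) ^+ 2 by ring.
    exact: sqr_ge0.
  move=> h; apply: le_trans h _; rewrite -subr_ge0 /B.
  have -> : A + (3 * a w ^+ 2 + 8 * b w ^+ 2 + 3 + normsq (G w)) -
    (normsq (G w) + (a w + 2 * b w) ^+ 2) = A + ((a w - 2 * b w) ^+ 2 + a w ^+ 2 + 3) by ring.
  by rewrite addr_ge0 ?(ltW A_gt0)// !addr_ge0 ?sqr_ge0.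
Qed.

Let intk : P.-integrable setT (EFin \o (fun w => k (N (G w)))).
Proof.
apply: (@bounded_integrable _ _ _ _ _ 5) => [|w].
  exact: (cmeas_N continuous_k).
by rewrite ger0_norm ?profile_ge0// profile_le5.
Qed.

Let intGF j : P.-integrable setT (EFin \o (fun w => G w j ord0 * F j (G w))).
Proof.
apply: (@integrable_gaussian_coordM _ _ _ _ _ _ gG j (fun w => F j (G w))
  (5 * eps + 11)) => //; exact: cmeas_F.
Qed.

Let intF' j : P.-integrable setT (EFin \o (fun w => F' j (G w))).
Proof.
by apply: (@bounded_integrable _ _ _ _ _ (5 * eps + 11)) => //; exact: cmeas_F'.
Qed.

(** Stein's identity turns the mean of the divergence less (p - 1) [k] into the mean of the drift.
    The constant is 4 * 5 * 11: 4 from the comparison with the indicator, 5 from the height of the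
    ramp, and 11 = 1 + 10 from the mean of the bound on the drift. *)
Lemma gaussian_shell :
  fine (P [set w | r <= enorm (G w + u) <= r + eps]) <= 220 * eps.
Proof.
set B := [set w | _].
have mB : measurable B.
  have mn : measurable_fun setT (fun w => enorm (G w + u)).
    by apply: measurable_enorm; apply: mcoordD => //; exact: mcoord_cst.
  rewrite (_ : B = setT `&` (fun w => enorm (G w + u)) @^-1` `[r, r + eps]).
    by apply: mn.
  by rewrite setTI; apply/seteqP; split => w /=; rewrite in_itv.
rewrite -Ex_indic//.
pose D w := \sum_j F' j (G w) - (p%:R - 1) * k (N (G w)).
have DE w : D w = k (N (G w)) + 2 * N (G w) * k' (N (G w)).
  rewrite /D /F' big_split/= sumr_const card_ord -mulr_suml -mulr_sumr.
  have -> : \sum_(j < p) (G w j ord0 + u j ord0) ^+ 2 = N (G w).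
    by apply: eq_bigr => j _; rewrite mxE.
  rewrite -[k (N (G w)) *+ p]mulr_natl; ring.
have [iF' EF'] := Ex_sum (index_enum 'I_p) intF'.
have [iGF EGF] := Ex_sum (index_enum 'I_p) intGF.
have ik := integrable_mulrl (p%:R - 1) intk.
have iD : P.-integrable setT (EFin \o D) by exact: integrable_subr iF' ik.
have i1B : P.-integrable setT (EFin \o (\1_B : T -> R)).
  apply: (@bounded_integrable _ _ _ _ _ 1) => [|w]; first exact: measurable_indic.
  by rewrite indicE; case: (w \in B); rewrite ?normr1 ?normr0.
apply: (@le_trans _ _ (Ex P (fun w => 4 * D w))).
  apply: le_Ex => //; first exact: integrable_mulrl.
  move=> w; rewrite indicE DE; case: (boolP (w \in B)) => [|_].
    rewrite inE => /andP[r1 r2]; apply: (profile_shell eps_gt0 (N_ge0 (G w)) r_ge0 erefl).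
    by rewrite /N -sqr_enorm !lerXn2r ?nnegrE ?enorm_ge0// ?addr_ge0// ltW.
  by rewrite mulr_ge0// profile_shell_ge0.
rewrite RintegralZl//.
have -> : Ex P D = Ex P (fun w => (a w + b w + 1) * k (N (G w))).
  rewrite /D (RintegralB measurableT iF' ik) EF'.
  rewrite (eq_bigr (fun j => Ex P (fun w => G w j ord0 * F j (G w)))); last first.
    move=> j _; apply/esym/(@gaussian_stein _ _ _ _ _ _ gG j (F j) (F' j) (5 * eps + 11)).
    - exact: cmeas_F.
    - exact: cmeas_F'.
    - exact: F_le.
    - exact: F'_le.
    - exact: dF.
    - exact: cF'.
  rewrite -EGF -(RintegralB measurableT iGF ik); apply: eq_Ex => w.
  exact: drift.
have [ia Ea] := gaussian_normsq_var gG.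
have [ib Eb] := gaussian_dotp_sqr gG u.
have [iG EG] := gaussian_normsq gG.
have i1 (c : R) : P.-integrable setT (EFin \o (fun _ : T => c)).
  by apply: (@bounded_integrable _ _ _ _ _ `|c|).
have j1 := integrable_addr (integrable_mulrl 3 ia) (integrable_mulrl 8 ib).
have j2 := integrable_addr j1 (i1 3).
have j3 := integrable_addr j2 iG.
have j4 := integrable_mulrl A^-1 j3.
have j5 := integrable_addr (i1 1) j4.
have le1 : Ex P (fun w => (a w + b w + 1) * k (N (G w))) <=
    5 * eps * (1 + A^-1 * (6 * p%:R + 8 * normsq u + 3 + p%:R)).
  apply: (@le_trans _ _ (Ex P (fun w => 5 * eps *
    (1 + A^-1 * (3 * a w ^+ 2 + 8 * b w ^+ 2 + 3 + normsq (G w)))))).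
    apply: le_Ex; last exact: drift_le.
    - under eq_fun do rewrite /= -drift.
      exact: integrable_subr iGF ik.
    - exact: integrable_mulrl j5.
  rewrite RintegralZl// RintegralD// Ex_cst RintegralZl// RintegralD//.
  rewrite RintegralD// RintegralD//; try exact: integrable_mulrl.
  rewrite !RintegralZl// Ex_cst Ea Eb EG mulrA.
  have -> : 3 * 2 = 6 :> R by ring.
  by [].
(* The sum is 7p + 8 |u|^2 + 3, at most 10 (p + |u|^2) because p >= 1. *)
have le2 : A^-1 * (6 * p%:R + 8 * normsq u + 3 + p%:R) <= 10.
  rewrite mulrC ler_pdivrMr// /A.
  have p1 : 1 <= p%:R :> R by rewrite ler1n.
  by have := normsq_ge0 u; move: p1; lra.
have : 5 * eps * (1 + A^-1 * (6 * p%:R + 8 * normsq u + 3 + p%:R)) <= 5 * eps * 11.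
  rewrite ler_wpM2l ?mulr_ge0 ?(ltW eps_gt0)//; lra.
by move: le1; lra.
Qed.

End gaussian_shell.

(** * Characteristic functions and shells *)

Lemma fine_prob_le1 {R : realType} {d} {T : measurableType d}
  (P : probability T R) (A : set T) : measurable A -> fine (P A) <= 1.
Proof.
by move=> mA; rewrite -lee_fin fineK ?fin_num_measure//; exact: probability_le1.
Qed.

Lemma fine_prob_le {R : realType} {d} {T : measurableType d}
  (P : probability T R) (A B : set T) : measurable A -> measurable B ->
  A `<=` B -> fine (P A) <= fine (P B).
Proof.
move=> mA mB AB; rewrite fine_le ?fin_num_measure//.
by apply: le_measure; rewrite ?inE.
Qed.

(** * Polynomial approximation of steps and comparison of tails *)

Section step_polynomials.
Context {R : realType}.

Lemma bernoulli_ineq (y : R) n : -1 <= y -> 1 + n%:R * y <= (1 + y) ^+ n.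
Proof.
move=> y1; elim: n => [|n IH]; first by rewrite mul0r addr0 expr0.
have y0 : 0 <= 1 + y by lra.
rewrite exprS; apply: le_trans (ler_wpM2l y0 IH); rewrite -subr_ge0.
have -> : (1 + y) * (1 + n%:R * y) - (1 + n.+1%:R * y) = n%:R * y ^+ 2.
  by rewrite -natr1; ring.
by rewrite mulr_ge0// sqr_ge0.
Qed.

(** On [0, 1] the value is close to 1 where m x^n is small and close to 0 where it is large; a large
    n makes the passage from one regime to the other as sharp as desired. *)
Definition step_poly n m : {poly R} := (1 - 'X^n) ^+ m.

Lemma horner_step n m (x : R) : (step_poly n m).[x] = (1 - x ^+ n) ^+ m.
Proof. by rewrite /step_poly !hornerE. Qed.

(** With y = x^n, Bernoulli's inequality gives (1 - y)^m >= 1 - m y, and together with (1 - y)(1 +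
    y) <= 1 it gives (1 - y)^m <= 1 / (1 + m y). So m has to satisfy m t1^n <= eta and m t2^n >= 1 /
    eta. *)
Lemma step_poly_exists (t1 t2 eta : R) : 0 < t1 -> t1 < t2 -> t2 <= 1 -> 0 < eta ->
  exists n m, (forall x, 0 <= x < t1 -> 1 - eta <= (step_poly n m).[x]) /\
              (forall x, t2 <= x <= 1 -> (step_poly n m).[x] <= eta).
Proof.
move=> t10 t12 t21 eta0.
have t20 : 0 < t2 by exact: lt_trans t12.
(* The left side bounds m t1^n for every m up to 1 / (eta t2^n) + 1; it tends to 0 since both t1 /
   t2 and t1 are less than 1. *)
have [n nP] : exists n, (t1 / t2) ^+ n / eta + t1 ^+ n <= eta.
  have z1 : `|t1 / t2| < 1.
    by rewrite ger0_norm ?divr_ge0 ?ltW// ltr_pdivrMr// mul1r.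
  have z2 : `|t1| < 1 by rewrite ger0_norm ?ltW// (lt_le_trans t12).
  have c : (t1 / t2) ^+ n / eta + t1 ^+ n @[n --> \oo] --> 0.
    rewrite -[X in _ --> X](addr0 0) -[X in _ --> X + _](mul0r eta^-1).
    apply: cvgD; last exact: cvg_expr.
    by apply: cvgM; [exact: cvg_expr|exact: cvg_cst].
  have /cvgrPdist_le/(_ _ eta0) := c.
  move=> [n _ /(_ n (leqnn n))]; rewrite sub0r normrN => h.
  by exists n; exact: le_trans (ler_norm _) h.
have [m mP] : exists m : nat, (eta * t2 ^+ n)^-1 <= m%:R <= (eta * t2 ^+ n)^-1 + 1.
  have y0 : 0 <= (eta * t2 ^+ n)^-1 by rewrite invr_ge0 mulr_ge0 ?exprn_ge0 ?ltW.
  exists (Num.truncn (eta * t2 ^+ n)^-1).+1.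
  have /andP[h1 h2] := truncn_itv y0.
  by rewrite ltW//= -natr1 lerD2r.
have {mP}/andP[m1 m2] := mP.
exists n, m; split => x /andP[x1 x2]; rewrite horner_step.
- have xn1 : x ^+ n <= t1 ^+ n by apply: lerXn2r; rewrite ?nnegrE// ltW.
  have xn0 : 0 <= x ^+ n by rewrite exprn_ge0.
  have x11 : x ^+ n <= 1 by rewrite exprn_ile1// ltW// (lt_le_trans (lt_trans x2 t12)).
  have := @bernoulli_ineq (- x ^+ n) m; rewrite lerN2 => /(_ x11).
  apply: le_trans; rewrite mulrN lerD2l lerN2.
  apply: le_trans (ler_wpM2l _ xn1) _ => //.
  apply: (@le_trans _ _ (((eta * t2 ^+ n)^-1 + 1) * t1 ^+ n)).
    by rewrite ler_wpM2r// exprn_ge0// ltW.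
  apply: le_trans nP; rewrite mulrDl mul1r lerD2r expr_div_n le_eqVlt.
  by apply/orP; left; apply/eqP; field; rewrite gt_eqF//= gt_eqF// exprn_gt0.
- have x0 : 0 <= x by exact: le_trans (ltW t20) x1.
  set y := x ^+ n.
  have y1 : y <= 1 by rewrite exprn_ile1.
  have ty : t2 ^+ n <= y by apply: lerXn2r; rewrite ?nnegrE// ltW.
  have y0 : 0 <= y by rewrite exprn_ge0.
  have my : eta^-1 <= m%:R * y.
    apply: (@le_trans _ _ ((eta * t2 ^+ n)^-1 * t2 ^+ n)); last first.
      by apply: ler_pM => //; rewrite ?invr_ge0 ?mulr_ge0 ?exprn_ge0// ltW.
    rewrite le_eqVlt; apply/orP; left; apply/eqP; field.
    by rewrite !gt_eqF// exprn_gt0.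
  have b : (1 - y) ^+ m * (1 + m%:R * y) <= 1.
    apply: (@le_trans _ _ ((1 - y) ^+ m * (1 + y) ^+ m)).
      rewrite ler_wpM2l ?exprn_ge0 ?subr_ge0//; apply: bernoulli_ineq; lra.
    rewrite -exprMn exprn_ile1//.
      by rewrite mulr_ge0 ?subr_ge0// addr_ge0.
    have -> : (1 - y) * (1 + y) = 1 - y ^+ 2 by ring.
    by rewrite lerBlDr lerDl sqr_ge0.
  have q0 : 0 <= (1 - y) ^+ m by rewrite exprn_ge0// subr_ge0.
  have : (1 - y) ^+ m * eta^-1 <= 1.
    apply: le_trans b; rewrite ler_wpM2l//; apply: le_trans my _; lra.
  by rewrite ler_pdivrMr// mul1r.
Qed.

End step_polynomials.

Section moments_determine.
Context {R : realType}.
Context {d1 d2} {T1 : measurableType d1} {T2 : measurableType d2}.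
Context (P : probability T1 R) (Q : probability T2 R).
Variables (X : T1 -> R) (Y : T2 -> R).
Hypotheses (mX : measurable_fun setT X) (mY : measurable_fun setT Y).
Hypotheses (X01 : forall w, 0 <= X w <= 1) (Y01 : forall w, 0 <= Y w <= 1).
Hypothesis momE : forall k : nat, Ex P (fun w => X w ^+ k) = Ex Q (fun w => Y w ^+ k).

Let Ex_poly d (T : measurableType d) (P' : probability T R) (Z : T -> R)
    (q : {poly R}) : measurable_fun setT Z -> (forall w, 0 <= Z w <= 1) ->
  P'.-integrable setT (EFin \o (fun w => q.[Z w])) /\
  Ex P' (fun w => q.[Z w]) = \sum_(i < size q) q`_i * Ex P' (fun w => Z w ^+ i).
Proof.
move=> mZ Z01.
have iZ (i : nat) : P'.-integrable setT (EFin \o (fun w => Z w ^+ i)).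
  apply: (@bounded_integrable _ _ _ _ _ 1) => [|w]; first exact: measurable_funX.
  have /andP[z0 z1] := Z01 w.
  by rewrite ger0_norm ?exprn_ge0// exprn_ile1.
have E : (fun w => q.[Z w]) = (fun w => \sum_(i < size q) q`_i * Z w ^+ i).
  by apply/funext => w; rewrite horner_coef.
have [i1 i2] := @Ex_sum _ _ _ P' _ (index_enum 'I_(size q))
  (fun i w => q`_i * Z w ^+ i) (fun i => integrable_mulrl q`_i (iZ i)).
rewrite E; split => //; rewrite i2; apply: eq_bigr => i _.
by rewrite RintegralZl.
Qed.

(** A step polynomial q lies above (1 - eta) times the indicator of x < t1 and below eta plus the
    indicator of x < t2 on [0, 1], and the moments give E q(X) = E q(Y). The gap between t1 and t2
    leaves room for the transition of q. *)
Lemma moments_tail_le (t1 t2 : R) : 0 < t1 -> t1 < t2 -> t2 <= 1 ->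
  fine (P [set w | X w < t1]) <= fine (Q [set w | Y w < t2]).
Proof.
move=> t10 t12 t21.
have mlt d (T : measurableType d) (Z : T -> R) (t : R) : measurable_fun setT Z ->
    measurable [set w | Z w < t].
  move=> mZ; rewrite (_ : [set _ | _] = setT `&` Z @^-1` `]-oo, t[).
    by apply: mZ.
  by rewrite setTI; apply/seteqP; split => w /=; rewrite in_itv.
have i1 d (T : measurableType d) (P' : probability T R) (B : set T) : measurable B ->
    P'.-integrable setT (EFin \o (\1_B : T -> R)).
  move=> mB; apply: (@bounded_integrable _ _ _ _ _ 1) => [|w].
    exact: measurable_indic.
  by rewrite indicE; case: (w \in B); rewrite ?normr1 ?normr0.
have key eta : 0 < eta ->
    (1 - eta) * fine (P [set w | X w < t1]) <= fine (Q [set w | Y w < t2]) + eta.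
  move=> eta0; have [n [m [q1 q2]]] := step_poly_exists t10 t12 t21 eta0.
  pose q : {poly R} := step_poly n m.
  have q01 (x : R) : 0 <= x <= 1 -> 0 <= q.[x] <= 1.
    move=> /andP[x0 x1]; rewrite horner_step.
    have h : 0 <= 1 - x ^+ n <= 1 by rewrite subr_ge0 exprn_ile1//= lerBlDr lerDl exprn_ge0.
    by have /andP[h0 h1] := h; rewrite exprn_ge0//= exprn_ile1.
  have [iX EX] := Ex_poly P q mX X01.
  have [iY EY] := Ex_poly Q q mY Y01.
  have E : Ex P (fun w => q.[X w]) = Ex Q (fun w => q.[Y w]).
    by rewrite EX EY; apply: eq_bigr => i _; rewrite momE.
  rewrite -!Ex_indic; [|exact: mlt|exact: mlt].
  rewrite -RintegralZl//; last by apply: i1; exact: mlt.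
  apply: (@le_trans _ _ (Ex P (fun w => q.[X w]))).
    apply: le_Ex => //; first by apply: integrable_mulrl; apply: i1; exact: mlt.
    move=> w; rewrite /= ?indicE; case: (boolP (w \in _)) => [|_].
      rewrite inE /= mulr1 => Xt; apply: q1.
      by have /andP[-> _] := X01 w.
    by rewrite mulr0; have /andP[] := q01 _ (X01 w).
  rewrite E; have j1 := i1 _ _ Q _ (mlt _ _ Y t2 mY).
  have j2 : Q.-integrable setT (EFin \o (fun _ : T2 => eta)).
    by apply: (@bounded_integrable _ _ _ _ _ `|eta|).
  rewrite -[X in _ <= _ + X](Ex_cst Q) -RintegralD//.
  apply: le_Ex => //; first exact: integrable_addr.
  move=> w; rewrite /= ?indicE; case: (boolP (w \in _)) => [_|].
    have /andP[_ h] := q01 _ (Y01 w); apply: le_trans h _.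
    by rewrite lerDl ltW.
  rewrite notin_setE /= => /negP; rewrite -leNgt add0r => tY; apply: q2.
  by rewrite tY; have /andP[] := Y01 w.
(* The error eta is incurred twice, once in the factor 1 - eta and once additively, whence e / 2. *)
apply/ler_addgt0Pr => e e0.
have := key (e / 2) (divr_gt0 e0 (ltr0n _ 2)).
have PX1 : fine (P [set w | X w < t1]) <= 1.
  by apply: fine_prob_le1; exact: mlt.
have : (e / 2) * fine (P [set w | X w < t1]) <= e / 2.
  by rewrite ler_piMr// divr_ge0// ltW.
set a := fine _; set b := fine _; lra.
Qed.

End moments_determine.

Section same_characteristic_function.
Context {R : realType} {p : nat}.
Context {d1 d2} {T1 : measurableType d1} {T2 : measurableType d2}.
Context (P : probability T1 R) (Q : probability T2 R).
Variables (S : T1 -> 'cV[R]_p) (V : T2 -> 'cV[R]_p).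
Hypotheses (mS : mcoord S) (mV : mcoord V).
Hypothesis cfE : forall a theta,
  Ex P (fun w => cos (dotp a (S w) + theta)) =
  Ex Q (fun w => cos (dotp a (V w) + theta)).

(* [exp (- k |x|^2)] is the mean of [cos (<N, x>)] over a Gaussian vector [N] of
   covariance [2 k], so its expectation is determined by the characteristic
   function. *)
Lemma Ex_gaussian_kernel (c : 'cV[R]_p) (k : nat) :
  Ex P (fun w => expR (- normsq (S w - c)) ^+ k) =
  Ex Q (fun w => expR (- normsq (V w - c)) ^+ k).
Proof.
have [d [T [PN [N gN]]]] := @standard_gaussian_exists R p.
have mN : mcoord N by case: gN.
pose b : R := Num.sqrt (2 * k%:R).
have b2 : b ^+ 2 = 2 * k%:R by rewrite sqr_sqrtr// mulr_ge0.
have E (x : 'cV[R]_p) : expR (- normsq (x - c)) ^+ k =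
    Ex PN (fun w => cos (dotp (b *: N w) x + - dotp (b *: N w) c)).
  rewrite -expRM_natl.
  transitivity (expR (- (normsq (b *: (x - c)) / 2)) * cos 0).
    by rewrite cos0 mulr1 normsqZ b2; congr expR; field.
  rewrite -(Ex_gaussian_cos gN); apply: eq_Ex => w.
  by rewrite addr0 -dotpBr dotpC !dotpZl !dotpZr dotpC.
have key d' (T' : measurableType d') (P' : probability T' R) (X : T' -> 'cV[R]_p) :
    mcoord X -> Ex P' (fun w => expR (- normsq (X w - c)) ^+ k) =
    Ex PN (fun w' => Ex P' (fun w =>
      cos (dotp (b *: N w') (X w) + - dotp (b *: N w') c))).
  move=> mX; under eq_Ex do rewrite E.
  apply: (@Ex_swap _ _ _ _ _ P' PN
    (fun z => cos (dotp (b *: N z.2) (X z.1) + - dotp (b *: N z.2) c)) 1) => [|z].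
    apply: (measurableT_comp measurable_cos).
    have mN2 : mcoord (fun z : T' * T => b *: N z.2).
      by apply: mcoordZ; exact: (mcoord_comp measurable_snd mN).
    apply: measurable_funD.
      by apply: measurable_dotp => //; exact: (mcoord_comp measurable_fst mX).
    apply: measurableT_comp => //.
    by apply: measurable_dotp => //; exact: mcoord_cst.
  exact: normr_cos_le1.
by rewrite key// [RHS]key//; apply: eq_Ex => w; exact: cfE.
Qed.

(** The variable exp(-|x - c|^2) has values in [0, 1] and the Gaussian kernels as its moments. It is
    small exactly when x is far from c, so that its lower tails are the upper tails of the
    distance. *)
Lemma tail_le_of_cf (c : 'cV[R]_p) (r r' : R) : 0 <= r' -> r' < r ->
  fine (P [set w | r < enorm (S w - c)]) <= fine (Q [set w | r' < enorm (V w - c)]).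
Proof.
move=> r'0 rr'.
have mk d (T : measurableType d) (X : T -> 'cV[R]_p) : mcoord X ->
    measurable_fun setT (fun w => expR (- normsq (X w - c))).
  move=> mX; apply: (measurableT_comp (@measurable_expR R)).
  apply: measurableT_comp => //; apply: measurable_normsq.
  by apply: mcoordB => //; exact: mcoord_cst.
have k01 d (T : measurableType d) (X : T -> 'cV[R]_p) w :
    0 <= expR (- normsq (X w - c)) <= 1.
  by rewrite expR_ge0/= -expR0 ler_expR oppr_le0 normsq_ge0.
have lvl (x : 'cV[R]_p) (s : R) : 0 <= s ->
    (s < enorm (x - c)) = (expR (- normsq (x - c)) < expR (- s ^+ 2)).
  move=> s0; rewrite ltr_expR ltrN2 -sqr_enorm.
  by rewrite ltr_pXn2r ?nnegrE ?enorm_ge0.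
have := @moments_tail_le _ _ _ _ _ P Q _ _ (mk _ _ S mS) (mk _ _ V mV)
  (k01 _ _ S) (k01 _ _ V) (Ex_gaussian_kernel c) (expR (- r ^+ 2)) (expR (- r' ^+ 2)).
have -> : [set w | r < enorm (S w - c)] =
    [set w | expR (- normsq (S w - c)) < expR (- r ^+ 2)].
  by apply/seteqP; split => w /=; rewrite lvl// ltW// (le_lt_trans r'0).
have -> : [set w | r' < enorm (V w - c)] =
    [set w | expR (- normsq (V w - c)) < expR (- r' ^+ 2)].
  by apply/seteqP; split => w /=; rewrite lvl.
apply; first exact: expR_gt0.
- by rewrite ltr_expR ltrN2 ltrXn2r// (le_lt_trans r'0).
- by rewrite -[leRHS]expR0 ler_expR oppr_le0 sqr_ge0.
Qed.

End same_characteristic_function.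

Section shell_bound.
Context {R : realType} {p : nat}.
Context {d} {T : measurableType d} (P : probability T R).
Variables (S : T -> 'cV[R]_p) (sigma : R).
Hypothesis mS : mcoord S.
Hypothesis sigma_gt0 : 0 < sigma.
Variable C0 : R.
Hypothesis C0_ge0 : 0 <= C0.
Hypothesis shellC : forall d' (T' : measurableType d') (P' : probability T' R)
  (G : T' -> 'cV[R]_p), standard_gaussian P' G -> forall u r eps, 0 <= r -> 0 < eps ->
  fine (P' [set w | r <= enorm (G w + u) <= r + eps]) <= C0 * eps.

Let measurable_shell d' (T' : measurableType d') (X : T' -> 'cV[R]_p) c :
  mcoord X -> measurable_fun setT (fun w => enorm (X w - c)).
Proof.
by move=> mX; apply: measurable_enorm; apply: mcoordB => //; exact: mcoord_cst.
Qed.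

(** The vector [V] = sigma G + W, built on a product space, has the characteristic function of [S],
    so its distance to c has comparable tails. For a fixed value of W, a shell for [V] is a shell
    for G + (W - c) / sigma of width divided by sigma, to which the Gaussian bound applies. *)
Lemma shell_bound d' (T' : measurableType d') (Q : probability T' R)
    (W : T' -> 'cV[R]_p) : mcoord W ->
  (forall a theta, Ex P (fun w => cos (dotp a (S w) + theta)) =
    expR (- (sigma ^+ 2 * normsq a / 2)) *
    Ex Q (fun w => cos (dotp a (W w) + theta))) ->
  forall (c : 'cV[R]_p) (r eps : R), 0 < eps ->
  fine (P [set w | r < enorm (S w - c) <= r + eps]) <= C0 * (3 * eps / sigma).
Proof.
move=> mW cfS c r eps eps0.
have [d1 [T1 [PG [G gG]]]] := @standard_gaussian_exists R p.
have mG : mcoord G by case: gG.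
pose V (z : T1 * T') := sigma *: G z.1 + W z.2.
have mV : mcoord V.
  apply: mcoordD; first by apply: mcoordZ; exact: (mcoord_comp measurable_fst mG).
  exact: (mcoord_comp measurable_snd mW).
have cfV a theta : Ex P (fun w => cos (dotp a (S w) + theta)) =
    Ex (PG \x Q)%E (fun z => cos (dotp a (V z) + theta)).
  have mc : measurable_fun setT (fun z => cos (dotp a (V z) + theta)).
    apply: (measurableT_comp measurable_cos); apply: measurable_funD => //.
    by apply: measurable_dotp => //; exact: mcoord_cst.
  rewrite cfS (Ex_prod2 _ _ mc (fun z => normr_cos_le1 _)).
  rewrite -RintegralZl//; last first.
    apply: (@bounded_integrable _ _ _ _ _ 1) => [|w]; last exact: normr_cos_le1.
    apply: (measurableT_comp measurable_cos); apply: measurable_funD => //.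
    by apply: measurable_dotp => //; exact: mcoord_cst.
  apply: eq_Ex => w.
  transitivity (Ex PG (fun g => cos (dotp (sigma *: a) (G g) + (dotp a (W w) + theta)))).
    by rewrite (Ex_gaussian_cos gG) normsqZ.
  by apply: eq_Ex => g; rewrite /V dotpDr dotpZr dotpZl addrA.
have cfV' a theta : Ex (PG \x Q)%E (fun z => cos (dotp a (V z) + theta)) =
  Ex P (fun w => cos (dotp a (S w) + theta)) by rewrite cfV.
have mgt d2 (T2 : measurableType d2) (X : T2 -> 'cV[R]_p) t : mcoord X ->
    measurable [set w | t < enorm (X w - c)].
  by move=> mX; exact: measurable_preimage_gt (measurable_shell c mX).
have mle d2 (T2 : measurableType d2) (X : T2 -> 'cV[R]_p) t : mcoord X ->
    measurable [set w | enorm (X w - c) <= t].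
  by move=> mX; exact: measurable_preimage_le (measurable_shell c mX).
have mge d2 (T2 : measurableType d2) (X : T2 -> 'cV[R]_p) t : mcoord X ->
    measurable [set w | t <= enorm (X w - c)].
  move=> mX; rewrite (_ : [set _ | _] =
    setT `&` (fun w => enorm (X w - c)) @^-1` `[t, +oo[).
    by apply: measurable_shell.
  by rewrite setTI; apply/seteqP; split => w /=; rewrite in_itv/= andbT.
have finPQ (A : set (T1 * T')) : measurable A -> (PG \x Q)%E A \is a fin_num.
  by move=> mA; exact: (fin_num_measure ((PG \x Q)%E : probability _ R) A mA).
(* Tails are only compared at distinct radii, so the shell is enlarged to width
   [3 * eps]. *)
have [re0|re0] := ltP (r + eps) 0.
  rewrite (_ : [set _ | _] = set0) ?measure0/=; last first.
    apply/seteqP; split => // w /= /andP[_].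
    by rewrite leNgt (lt_le_trans re0)// enorm_ge0.
  by rewrite mulr_ge0// divr_ge0 ?mulr_ge0// ltW.
have PE : fine (P [set w | r < enorm (S w - c) <= r + eps]) =
    fine (P [set w | r < enorm (S w - c)]) - fine (P [set w | r + eps < enorm (S w - c)]).
  have -> : [set w | r < enorm (S w - c) <= r + eps] =
      [set w | r < enorm (S w - c)] `\` [set w | r + eps < enorm (S w - c)].
    apply/seteqP; split => [w /= /andP[h1 h2]|w /= [h1 /negP]].
      by split => //; apply/negP; rewrite -leNgt.
    by rewrite -leNgt => h2; rewrite h1.
  rewrite measureD; [|exact: mgt|exact: mgt|]; last first.
    by rewrite -ge0_fin_numE// fin_num_measure//; exact: mgt.
  rewrite fineB ?fin_num_measure//; [|exact: mgt|by apply: measurableI; exact: mgt].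
  congr (_ - fine (P _)); apply/seteqP; split => [w [_ //]|w /= h]; split => //.
  by apply: lt_trans h; rewrite ltrDl.
(* The inner radius is lowered by eps and the outer one raised by eps. The maximum is taken because
   r may be less than eps, or even negative when the shell comes from a small ball. *)
pose r0 := Num.max 0 (r - eps).
have r00 : 0 <= r0 by rewrite le_max lexx.
have up : fine (P [set w | r < enorm (S w - c)]) <=
    fine ((PG \x Q)%E [set z | r0 <= enorm (V z - c)]).
  have [rr0|rr0] := ltP 0 r.
  - have r0r : r0 < r by rewrite gt_max rr0/= ltrBlDr ltrDl.
    apply: le_trans (tail_le_of_cf mS mV cfV c r00 r0r) _.
    by apply: fine_prob_le; [exact: mgt|exact: mge|move=> z /= /ltW].
  - have -> : r0 = 0 by apply/max_idPl; rewrite lerBlDr (le_trans rr0)// add0r ltW.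
    rewrite (_ : [set z | 0 <= _] = setT); last first.
      by apply/seteqP; split => // z _ /=; exact: enorm_ge0.
    rewrite [X in _ <= fine X](probability_setT (PG \x Q)%E).
    by apply: fine_prob_le1; exact: mgt.
have dn : fine ((PG \x Q)%E [set z | r + 2 * eps < enorm (V z - c)]) <=
    fine (P [set w | r + eps < enorm (S w - c)]).
  by apply: (tail_le_of_cf mV mS cfV' c re0); rewrite ltrD2l; lra.
rewrite PE.
apply: (@le_trans _ _ (fine ((PG \x Q)%E [set z | r0 <= enorm (V z - c) <= r0 + 3 * eps]))).
  apply: le_trans (lerB up dn) _; rewrite lerBlDr.
  have mM : measurable [set z | r0 <= enorm (V z - c) <= r0 + 3 * eps].
    rewrite (_ : [set _ | _] = [set z | r0 <= enorm (V z - c)] `&`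
      [set z | enorm (V z - c) <= r0 + 3 * eps]).
      by apply: measurableI; [exact: mge|exact: mle].
    by apply/seteqP; split => z /= => [/andP[]|[-> ->]].
  rewrite -fineD; [|by apply: finPQ|by apply: finPQ; exact: mgt].
  apply: fine_le.
  - by apply: finPQ; exact: mge.
  - by rewrite fin_numD !finPQ//; exact: mgt.
  apply: le_trans (measureU2 _ mM _); last exact: mgt.
  apply: le_measure; rewrite ?inE; [exact: mge|by apply: measurableU => //; exact: mgt|].
  move=> z /= h; have [h2|h2] := leP (enorm (V z - c)) (r0 + 3 * eps).
    by left; apply/andP; split.
  right; apply: le_lt_trans h2.
  have : r - eps <= r0 by rewrite le_max lexx orbT.
  by lra.
have mM : measurable [set z | r0 <= enorm (V z - c) <= r0 + 3 * eps].
  rewrite (_ : [set _ | _] = [set z | r0 <= enorm (V z - c)] `&`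
    [set z | enorm (V z - c) <= r0 + 3 * eps]).
    by apply: measurableI; [exact: mge|exact: mle].
  by apply/seteqP; split => z /= => [/andP[]|[-> ->]].
rewrite -Ex_indic//.
set M := [set z | _] in mM *; pose f : T1 * T' -> R := \1_M.
have m1 : measurable_fun setT f by exact: measurable_indic.
have i1 z : `|f z| <= 1.
  by rewrite /f indicE; case: (z \in _); rewrite ?normr1 ?normr0.
rewrite -/f (@Ex_prod2 _ _ _ _ _ PG Q f 1 m1 i1) -[leRHS](Ex_cst Q).
apply: le_Ex => //.
- apply: (@bounded_integrable _ _ _ _ _ 1) => [|w].
    exact: (@measurable_Ex2 _ _ _ _ _ PG Q f 1 m1 i1).
  apply: le_normr_Ex => [|x]; last exact: i1.
  by apply: (measurableT_comp m1); exact: measurable_fun_pair.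
- by apply: (@bounded_integrable _ _ _ _ _ `|C0 * (3 * eps / sigma)|).
move=> w; pose u := sigma^-1 *: (W w - c).
have Vu g : V (g, w) - c = sigma *: (G g + u).
  by rewrite /V /u scalerDr scalerA divff ?gt_eqF// scale1r addrA.
have e0 : 0 < 3 * eps / sigma by rewrite divr_gt0// mulr_gt0.
have s0 : 0 <= r0 / sigma by rewrite divr_ge0// ltW.
have := shellC gG u s0 e0.
apply: le_trans; rewrite -Ex_indic; last first.
  rewrite (_ : [set _ | _] = (fun g => (g, w)) @^-1` M).
    by rewrite -[_ @^-1` _]setTI; apply: measurable_fun_pair.
  apply/seteqP; split => g; rewrite /M /= Vu enormZ (gtr0_norm sigma_gt0) -mulrDl;
    by rewrite ler_pdivrMr// ler_pdivlMr// (mulrC sigma).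
rewrite le_eqVlt; apply/orP; left; apply/eqP; apply: eq_Ex => g.
rewrite /f !indicE; congr (nat_of_bool _)%:R; apply/idP/idP; rewrite !inE /M /= Vu enormZ
  (gtr0_norm sigma_gt0) -mulrDl ler_pdivrMr// ler_pdivlMr// (mulrC sigma) => //.
Qed.

End shell_bound.

(** * Lindeberg replacement *)

Section clamped_polynomials.
Context {R : realType}.
Implicit Types (P : {poly R}) (u v h : R).

Definition clamp01 u : R := Num.max 0 (Num.min u 1).

Lemma clamp01_itv u : 0 <= clamp01 u <= 1.
Proof. by rewrite /clamp01 le_max lexx/= ge_max ler01/= ge_min lexx orbT. Qed.

Lemma clamp01_le0 u : u <= 0 -> clamp01 u = 0.
Proof. by move=> u0; rewrite /clamp01 max_l// ge_min u0. Qed.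

Lemma clamp01_ge1 u : 1 <= u -> clamp01 u = 1.
Proof. by move=> u1; rewrite /clamp01 min_r// max_r. Qed.

Lemma clamp01_id u : 0 <= u <= 1 -> clamp01 u = u.
Proof. by move=> /andP[u0 u1]; rewrite /clamp01 min_l// max_r. Qed.

Lemma clamp01_lip u v : `|clamp01 u - clamp01 v| <= `|u - v|.
Proof.
wlog uv : u v / v <= u.
  by move=> H; have [/H//|/ltW/H] := leP v u; rewrite distrC (distrC v).
rewrite [leRHS]ger0_norm ?subr_ge0//.
have [u0|u0] := leP u 0.
  by rewrite !clamp01_le0 ?(le_trans uv)// subrr normr0 subr_ge0.
have [v1|v1] := leP 1 v.
  by rewrite !clamp01_ge1 ?(le_trans v1)// subrr normr0 subr_ge0.
have [v0|v0] := leP v 0; have [u1|u1] := leP 1 u.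
- by rewrite (clamp01_le0 v0) (clamp01_ge1 u1) subr0 normr1; lra.
- by rewrite (clamp01_le0 v0) clamp01_id ?subr0 ?ger0_norm ?(ltW u0) ?(ltW u1)//; lra.
- by rewrite (clamp01_ge1 u1) clamp01_id ?(ltW v0) ?(ltW v1)// ger0_norm; lra.
- by rewrite !clamp01_id ?(ltW u0) ?(ltW v0) ?(ltW u1) ?(ltW v1)// ger0_norm// subr_ge0.
Qed.

Lemma poly_bounded01 P : exists2 C : R, 0 <= C &
  forall v, 0 <= v <= 1 -> `|P.[v]| <= C.
Proof.
exists (\sum_(i < size P) `|P`_i|); first by apply: sumr_ge0.
move=> v /andP[v0 v1]; rewrite horner_coef; apply: le_trans (ler_norm_sum _ _ _) _.
apply: ler_sum => i _; rewrite normrM ler_piMr// normrX ger0_norm//.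
exact: exprn_ile1.
Qed.

Lemma poly_taylor2 P : exists2 C : R, 0 <= C & forall v w : R,
  0 <= v <= 1 -> 0 <= w <= 1 ->
  `|P.[w] - P.[v] - P^`().[v] * (w - v)| <= C * (w - v) ^+ 2.
Proof.
elim/poly_ind: P => [|p c [C C0 HC]].
  by exists 0 => // v w _ _; rewrite deriv0 !horner0 mul0r !subrr normr0 mul0r.
have [D D0 HD] := poly_bounded01 p^`().
exists (C + D); first exact: addr_ge0.
move=> v w v01 w01.
set B := (X in _ <= X); rewrite derivD derivC addr0 derivM derivX mulr1 !hornerE {}/B.
have -> : p.[w] * w + c - (p.[v] * v + c) - (p^`().[v] * v + p.[v]) * (w - v) =
  (p.[w] - p.[v] - p^`().[v] * (w - v)) * w + p^`().[v] * (w - v) ^+ 2 by ring.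
apply: le_trans (ler_normD _ _) _; rewrite (mulrDl C D); apply: lerD.
  rewrite normrM -[leRHS]mulr1; apply: ler_pM => //; first exact: HC.
  by have /andP[w0 w1] := w01; rewrite ger0_norm.
by rewrite normrM (ger0_norm (sqr_ge0 _)) ler_wpM2r ?sqr_ge0//; exact: HD.
Qed.

Lemma poly_lip01 P : exists2 C : R, 0 <= C & forall v w : R,
  0 <= v <= 1 -> 0 <= w <= 1 -> `|P.[w] - P.[v]| <= C * `|w - v|.
Proof.
have [C C0 HC] := poly_taylor2 P; have [D D0 HD] := poly_bounded01 P^`().
exists (C + D); first exact: addr_ge0.
move=> v w v01 w01.
have -> : P.[w] - P.[v] = (P.[w] - P.[v] - P^`().[v] * (w - v)) + P^`().[v] * (w - v) by ring.
apply: le_trans (ler_normD _ _) _; rewrite (mulrDl C D); apply: lerD.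
  apply: le_trans (HC _ _ v01 w01) _; rewrite ler_wpM2l//.
  rewrite -(real_normK (num_real _)) expr2 ler_piMr//.
  have /andP[v0 v1] := v01; have /andP[w0 w1] := w01.
  by rewrite ler_norml; lra.
by rewrite normrM ler_wpM2r//; exact: HD.
Qed.

(** A quadratic error bound valid for all increments avoids separate one-sided limits at the corners
    of the clamp. *)
Lemma is_derive_quadratic (f : R -> R) (x l C : R) :
  (forall h, `|f (x + h) - f x - h * l| <= C * h ^+ 2) -> is_derive x 1 f l.
Proof.
move=> H.
have C0 : 0 <= C.
  by have := le_trans (normr_ge0 _) (H 1); rewrite expr1n mulr1.
have C1 : 0 < C + 1 by lra.
have c : h^-1 *: (f (h *: (1 : R) + x) - f x) @[h --> 0^'] --> l.
  apply/cvgrPdist_le => e e0; near=> h.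
  have h0 : h != 0 by near: h; exact: nbhs_dnbhs_neq.
  rewrite /GRing.scale/= mulr1 (addrC h) distrC.
  have -> : h^-1 * (f (x + h) - f x) - l = h^-1 * (f (x + h) - f x - h * l).
    by field.
  rewrite normrM normfV mulrC ler_pdivrMr ?normr_gt0//.
  apply: le_trans (H h) _; rewrite -(real_normK (num_real h)) expr2 mulrA ler_wpM2r//.
  apply: (@le_trans _ _ ((C + 1) * `|h|)); first by rewrite ler_wpM2r// lerDl.
  rewrite mulrC -ler_pdivlMr//.
  near: h; apply: dnbhs0_le; exact: divr_gt0.
have d : derivable f x 1 by apply/cvg_ex; exists l.
apply: DeriveDef => //; rewrite /derive; exact: (cvg_lim _ c).
Unshelve. all: by end_near. Qed.

(** The zeros of P' at 0 and 1 remove the corners: when the increment h crosses an endpoint z,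
    |P'(x)| is at most a constant times |x - z| <= |h|, and clamping changes the increment by at
    most |h|; the product is quadratic. *)
Lemma is_derive_clamp P (x : R) : P^`().[0] = 0 -> P^`().[1] = 0 ->
  is_derive x 1 (fun u => P.[clamp01 u]) (P^`().[clamp01 x]).
Proof.
move=> P0 P1; have [C C0 HC] := poly_taylor2 P; have [D D0 HD] := poly_lip01 P^`().
apply: (@is_derive_quadratic _ _ _ (C + D)) => h.
set v := clamp01 x; set w := clamp01 (x + h).
have v01 : 0 <= v <= 1 by exact: clamp01_itv.
have w01 : 0 <= w <= 1 by exact: clamp01_itv.
have wv : `|w - v| <= `|h|.
  by apply: le_trans (clamp01_lip _ _) _; rewrite addrC addKr.
have -> : P.[w] - P.[v] - h * P^`().[v] =
  (P.[w] - P.[v] - P^`().[v] * (w - v)) + P^`().[v] * ((w - v) - h) by ring.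
apply: le_trans (ler_normD _ _) _; rewrite (mulrDl C D); apply: lerD.
  apply: le_trans (HC _ _ v01 w01) _; rewrite ler_wpM2l//.
  by rewrite -(real_normK (num_real (w - v))) -(real_normK (num_real h)) lerXn2r ?nnegrE.
rewrite normrM -[h ^+ 2](real_normK (num_real h)) expr2 mulrA.
have dv (z : R) : z = 0 \/ z = 1 -> `|P^`().[v]| <= D * `|v - z|.
  move=> zz; have z01 : 0 <= z <= 1 by case: zz => ->; rewrite ?lexx ler01.
  have := HD z v z01 v01.
  by case: zz => ->; rewrite ?P0 ?P1 subr0.
have [x0|x0] := ltP x 0.
  by rewrite /v clamp01_le0 ?(ltW x0)// P0 normr0 mul0r !mulr_ge0.
have [x1|x1] := ltP 1 x.
  by rewrite /v clamp01_ge1 ?(ltW x1)// P1 normr0 mul0r !mulr_ge0.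
have vx : v = x by rewrite /v clamp01_id// x0 x1.
have [h0|h0] := ltP (x + h) 0.
  have wE : w = 0 by rewrite /w clamp01_le0// ltW.
  apply: ler_pM => //.
    apply: le_trans (dv 0 (or_introl erefl)) _; rewrite ler_wpM2l// subr0 vx.
    by have hN := ler_norm (- h); rewrite normrN in hN; rewrite (ger0_norm x0); lra.
  rewrite wE vx ler_norml; clear -h0 x0 x1.
  have hh : h <= 0 by lra.
  by rewrite (ler0_norm hh); apply/andP; split; lra.
have [h1|h1] := ltP 1 (x + h).
  have wE : w = 1 by rewrite /w clamp01_ge1// ltW.
  apply: ler_pM => //.
    apply: le_trans (dv 1 (or_intror erefl)) _; rewrite ler_wpM2l// vx.
    have hN := ler_norm h; have hx : x - 1 <= 0 by lra.
    by rewrite (ler0_norm hx); clear -hN h1; lra.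
  rewrite wE vx ler_norml; clear -h1 x0 x1.
  have hh : 0 <= h by lra.
  by rewrite (ger0_norm hh); apply/andP; split; lra.
have wE : w = x + h by rewrite /w clamp01_id// h0 h1.
have -> : w - v - h = 0 by rewrite wE vx; ring.
by rewrite normr0 mulr0 !mulr_ge0.
Qed.

Lemma continuous_clamp01 : continuous clamp01.
Proof.
move=> x; apply/cvgrPdist_le => e e0.
have : \forall y \near x, `|x - y| <= e.
  by apply/nbhs_ballP; exists e => //= y; rewrite /ball/= => /ltW.
by apply: filterS => y; exact/le_trans/clamp01_lip.
Qed.

Lemma continuous_clamp_poly P : continuous (fun u => P.[clamp01 u]).
Proof.
move=> x; apply: continuous_comp; first exact: continuous_clamp01.
exact: continuous_horner.
Qed.

End clamped_polynomials.

Section smooth_step.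
Context {R : realType} (K : nat).
Implicit Types (u : R).

Definition step_up : {poly R} := (1 - (1 - 'X) ^+ K.+1) ^+ K.+1.

(* The [m]-th derivative of a C^K function equal to 1 on ]-oo, 0] and to 0 on
   [1, +oo[: [step_up] vanishes to order K at 0, and so does [1 - step_up] at 1. *)
Definition smooth_step (m : nat) u : R := ((1 - step_up)^`(m)).[clamp01 u].

Lemma derivn_dvdp_root (c : R) (k m : nat) (p : {poly R}) : (m < k)%N ->
  ('X - c%:P) ^+ k %| p -> (p^`(m)).[c] = 0.
Proof.
move=> mk /(dvdp_trans (dvdp_exp2l _ mk)) d.
suff /(_ m (leqnSn m)) : forall j, (j <= m.+1)%N -> ('X - c%:P) ^+ (m.+1 - j) %| p^`(j).
  by rewrite subSn// subnn expr1 dvdp_XsubCl => /eqP.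
elim=> [|j IH] jm; first by rewrite subn0 derivn0.
have /IH/dvdpP[r E] := ltnW jm.
rewrite derivnS E (_ : (m.+1 - j)%N = (m.+1 - j.+1).+1); last by rewrite subnS prednK ?subn_gt0.
rewrite exprS mulrA derivM derivM derivXsubC mulr1.
set k' := (m.+1 - j.+1)%N.
rewrite mulrDl -addrA dvdp_addr; last by rewrite dvdp_mull.
rewrite dvdp_addr; last by rewrite dvdp_mull.
case: k' => [|k']; first by rewrite expr0 dvd1p.
rewrite deriv_exp derivXsubC mul1r /= -mulrA mulrnAr -exprS mulrnAr -mulrnAl.
exact: dvdp_mull.
Qed.

(** At 0, X divides 1 - (1 - X)^(K+1), so X^(K+1) divides [step_up]. At 1, 1 - y divides 1 - y^(K+1)
    for y = 1 - (1 - X)^(K+1), so (1 - X)^(K+1) divides 1 - [step_up]. The condition m > 0 disposes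
    of the constant 1 at 0. *)
Lemma smooth_step_edge (m : nat) (c : R) : (0 < m <= K)%N -> c = 0 \/ c = 1 ->
  ((1 - step_up)^`(m)).[c] = 0.
Proof.
move=> /andP[m0 mK] [|] ->.
- rewrite derivnB -[1 in X in X - _]/(1%:P) derivnC (gtn_eqF m0) sub0r hornerN.
  apply/eqP; rewrite oppr_eq0; apply/eqP; apply: (@derivn_dvdp_root 0 K.+1) => //.
  have : 'X - (0 : R)%:P %| 1 - (1 - 'X) ^+ K.+1.
    by rewrite dvdp_XsubCl /root !hornerE subr0 expr1n subrr.
  by move=> /(dvdp_exp2r K.+1).
- apply: (@derivn_dvdp_root 1 K.+1) => //.
  rewrite -dvdpNr opprB /step_up subrX1 addrAC subrr add0r.
  by rewrite dvdp_mulr// dvdpNr -[1 - 'X]opprB exprNn dvdp_mull.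
Qed.

Lemma is_derive_smooth_step m (u : R) : (m < K)%N ->
  is_derive u 1 (smooth_step m) (smooth_step m.+1 u).
Proof.
move=> mK; rewrite /smooth_step derivnS.
by apply: is_derive_clamp; rewrite -derivnS; apply: smooth_step_edge => //; [left|right].
Qed.

Lemma continuous_smooth_step m : continuous (smooth_step m).
Proof. exact: continuous_clamp_poly. Qed.

Lemma smooth_step_out m u : (0 < m <= K)%N -> ~~ (0 < u < 1) ->
  smooth_step m u = 0.
Proof.
move=> mK; rewrite negb_and -!leNgt => /orP[u0|u1]; rewrite /smooth_step.
- by rewrite clamp01_le0//; apply: smooth_step_edge => //; left.
- by rewrite clamp01_ge1//; apply: smooth_step_edge => //; right.
Qed.

Lemma smooth_step0E u :
  smooth_step 0 u = 1 - (1 - (1 - clamp01 u) ^+ K.+1) ^+ K.+1.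
Proof. by rewrite /smooth_step derivn0 /step_up !hornerE. Qed.

Lemma smooth_step_itv u : 0 <= smooth_step 0 u <= 1.
Proof.
rewrite smooth_step0E; have /andP[c0 c1] := clamp01_itv u.
have a1 : 0 <= (1 - clamp01 u) ^+ K.+1 <= 1.
  by rewrite exprn_ge0 ?subr_ge0//= exprn_ile1 ?subr_ge0// lerBlDr lerDl.
have /andP[a0 {}a1] := a1.
by rewrite subr_ge0 exprn_ile1 ?subr_ge0 ?lerBlDr ?lerDl//= exprn_ge0// subr_ge0.
Qed.

Lemma smooth_step_le0 u : u <= 0 -> smooth_step 0 u = 1.
Proof.
by move=> u0; rewrite smooth_step0E clamp01_le0// subr0 expr1n subrr expr0n subr0.
Qed.

Lemma smooth_step_ge1 u : 1 <= u -> smooth_step 0 u = 0.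
Proof.
by move=> u1; rewrite smooth_step0E clamp01_ge1// subrr expr0n subr0 expr1n subrr.
Qed.

Lemma smooth_step_bounded : exists2 M : R, 0 <= M &
  forall m u, (m <= K)%N -> `|smooth_step m u| <= M.
Proof.
have /choice[M MP] : forall m, exists Mm : R, 0 <= Mm /\
    forall u, `|smooth_step m u| <= Mm.
  move=> m; have [C C0 HC] := poly_bounded01 ((1 - step_up)^`(m)).
  by exists C; split => // u; exact/HC/clamp01_itv.
exists (\sum_(i < K.+1) M i); first by apply: sumr_ge0 => i _; case: (MP i).
move=> m u mK; apply: le_trans (proj2 (MP m) u) _.
rewrite (bigD1 (Ordinal (mK : m < K.+1)%N))//= lerDl.
by apply: sumr_ge0 => i _; case: (MP i).
Qed.

End smooth_step.

(** * Derivatives of the cutoff composed with a quadratic function *)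

Section composition_derivatives.
Context {R : realType} (K : nat).
Implicit Types (s t : R).

(* The [k]-th derivative in t of [smooth_step K m s * s1 ^+ a * s2 ^+ b] when
   [s' = s1], [s1' = s2] and [s2' = 0]. *)
Fixpoint comp_deriv k m a b (s s1 s2 : R) : R :=
  if k is k'.+1 then
    comp_deriv k' m.+1 a.+1 b s s1 s2 + a%:R * comp_deriv k' m a.-1 b.+1 s s1 s2
  else smooth_step K m s * s1 ^+ a * s2 ^+ b.

Lemma is_derive_comp_deriv k m a b (s s1 : R -> R) (s2 : R) t : (m + k < K)%N ->
  is_derive t 1 s (s1 t) -> is_derive t 1 s1 s2 ->
  is_derive t 1 (fun t => comp_deriv k m a b (s t) (s1 t) s2)
    (comp_deriv k.+1 m a b (s t) (s1 t) s2).
Proof.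
move=> + ds ds1; elim: k m a b => [|k IH] m a b mk.
  rewrite addn0 in mk.
  have d1 : is_derive t 1 (fun t => smooth_step K m (s t)) (smooth_step K m.+1 (s t) * s1 t).
    have d0 := @is_derive_smooth_step R K m (s t) mk.
    exact: (@is_derive1_comp R (smooth_step K m) s t _ _ d0 ds).
  have d2 : is_derive t 1 (fun t => s1 t ^+ a) (a%:R * s1 t ^+ a.-1 * s2).
    by have := @is_deriveX R R^o s1 a t 1 _ ds1; rewrite exprfctE.
  have := @is_deriveM R R^o _ _ t 1 _ _ (is_deriveM d1 d2) (is_derive_cst (s2 ^+ b) t 1).
  move=> H; refine (is_derive_eq H _) => /=.
  by rewrite /GRing.scale/= !exprS; ring.
have d1 := IH m.+1 a.+1 b; have d2 := IH m a.-1 b.+1.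
rewrite addSnnS in d1; have {d1} d1 := d1 mk.
have {d2} d2 := d2 (ltn_trans (eq_leq (esym (addnS m k))) mk).
have := is_deriveD d1 (is_deriveM (is_derive_cst (a%:R : R) t 1) d2).
by move=> H; refine (is_derive_eq H _); rewrite /GRing.scale/= mulr0 addr0.
Qed.

(** The sum of the coefficients in the expansion of [comp_deriv], a number that depends on [k] and
    [a] alone. *)
Fixpoint comp_const k a : R :=
  if k is k'.+1 then comp_const k' a.+1 + a%:R * comp_const k' a.-1 else 1.

Lemma comp_const_ge0 k a : 0 <= comp_const k a.
Proof. by elim: k a => [|k IH] a //=; rewrite addr_ge0// mulr_ge0. Qed.

Lemma comp_deriv_out k m a b (s s1 s2 : R) : (0 < m)%N -> (m + k <= K)%N ->
  ~~ (0 < s < 1) -> comp_deriv k m a b s s1 s2 = 0.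
Proof.
move=> + + sout; elim: k m a b => [|k IH] m a b m0 mk /=.
  by rewrite smooth_step_out ?m0 ?mul0r//; rewrite addn0 in mk.
rewrite !IH ?mulr0 ?addr0// ?addSnnS//.
by rewrite (leq_trans _ mk)// leq_add2l.
Qed.

(** Every derivation costs one power of rho: it either brings out a factor s1, of order rho, or
    replaces a factor s1 by s2, of order rho^2. *)
Lemma comp_deriv_le (M rho : R) k m a b (s s1 s2 : R) : 0 <= rho -> (m + k <= K)%N ->
  (forall j u, (j <= K)%N -> `|smooth_step K j u| <= M) ->
  `|s1| <= rho -> `|s2| <= rho ^+ 2 ->
  `|comp_deriv k m a b s s1 s2| <= M * comp_const k a * rho ^+ (k + a + b.*2).
Proof.
move=> rho0 + HM hs1 hs2.
have M0 : 0 <= M by apply: le_trans (HM 0%N 0 _).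
elim: k m a b => [|k IH] m a b mk /=.
  rewrite addn0 in mk.
  rewrite mulr1 add0n exprD mulrA !normrM !normrX -muln2 mulnC exprM.
  by rewrite ler_pM ?mulr_ge0 ?exprn_ge0// ?ler_pM ?exprn_ge0 ?HM// lerXn2r ?nnegrE ?exprn_ge0.
apply: le_trans (ler_normD _ _) _; rewrite mulrDr mulrDl; apply: lerD.
  by rewrite addSnnS; apply: IH; rewrite addSnnS.
(* The exponent [a.-1] is truncated at a = 0, where the coefficient vanishes. *)
case: a => [|a]; first by rewrite !mul0r normr0 mulr0 mul0r.
rewrite normrM ger0_norm// [M * _]mulrCA -mulrA ler_wpM2l//=.
rewrite (_ : (k.+1 + a.+1 + b.*2)%N = (k + a + b.+1.*2)%N); last first.
  by rewrite doubleS !addnS !addSn.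
by apply: IH; rewrite (leq_trans _ mk)// leq_add2l.
Qed.

(** The derivative of the remainder is the remainder of one order less for the shifted sequence; the
    mean value theorem then costs a factor t <= 1, so the same [B] is kept throughout. *)
Lemma taylor_bound (phi : nat -> R -> R) (n : nat) (B t : R) :
  (forall k t, (k < n)%N -> is_derive t 1 (phi k) (phi k.+1 t)) ->
  (forall t, 0 <= t <= 1 -> `|phi n t| <= B) -> 0 <= t <= 1 ->
  `|phi 0%N t - \sum_(i < n) phi i 0 * (i`!%:R^-1 * t ^+ i)| <= B.
Proof.
elim: n phi t => [|n IH] phi t dphi Hn t01.
  by rewrite big_ord0 subr0; exact: Hn.
have {}IH := IH (fun k => phi k.+1) _ (fun k t kn => dphi k.+1 t kn) Hn.
pose q (t : R) := \sum_(i < n.+1) phi i 0 * (i`!%:R^-1 * t ^+ i).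
pose g t := phi 0%N t - q t.
have dq (x : R) : is_derive x 1 q (\sum_(i < n) phi i.+1 0 * (i`!%:R^-1 * x ^+ i)).
  rewrite /q.
  have := @is_derive_sum R R^o R^o n.+1
    (fun i t => phi i 0 * (i`!%:R^-1 * t ^+ i)) x 1
    (fun i => phi i 0 * (i`!%:R^-1 * (i%:R * x ^+ i.-1))).
  rewrite -fct_sumE => H; apply: is_derive_eq.
    apply: H => i; have dX : is_derive x 1 (fun t : R => t ^+ i) (i%:R * x ^+ i.-1).
      have := @is_deriveX R R^o id i x 1 _ (is_derive_id x 1).
      by rewrite exprfctE /GRing.scale/= mulr1.
    have := is_deriveM (is_derive_cst (phi i 0 : R^o) x 1)
      (is_deriveM (is_derive_cst (i`!%:R^-1 : R^o) x 1) dX).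
    by move=> H; refine (is_derive_eq H _); rewrite /GRing.scale/= !mulr0 !addr0.
  rewrite big_ord_recl /= mul0r !mulr0 add0r; apply: eq_bigr => i _.
  rewrite /= /bump/= add1n; congr (_ * _); rewrite mulrA; congr (_ * _).
  by rewrite factS natrM invfM mulrAC mulVf ?mul1r.
have dg (x : R) : is_derive x 1 g (phi 1%N x - \sum_(i < n) phi i.+1 0 * (i`!%:R^-1 * x ^+ i)).
  by apply: is_deriveB => //; exact: dphi.
have g0 : g 0 = 0.
  rewrite /g /q big_ord_recl/= fact0 invr1 mul1r expr0 mulr1 big1 ?addr0 ?subrr//.
  by move=> i _; rewrite expr0n/= !mulr0.
have B0 : 0 <= B by apply: le_trans (normr_ge0 _) (Hn t t01).
rewrite -/(q t) -/(g t).
have /andP[t0 t1] := t01.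
have [te|tn] := eqVneq t 0; first by rewrite te g0 normr0.
have tp : 0 < t by rewrite lt_neqAle eq_sym tn.
have [c /andP[c0 c1] E] : exists2 c, 0 < c < t & g t - g 0 =
    (phi 1%N c - \sum_(i < n) phi i.+1 0 * (i`!%:R^-1 * c ^+ i)) * (t - 0).
  have [c cI E] := @MVT R g _ 0 t tp (fun x _ => dg x)
    (derivable_within_continuous (fun x _ => @ex_derive _ _ _ _ _ _ _ (dg x))).
  by exists c.
move: E; rewrite g0 !subr0 => ->.
rewrite normrM (ger0_norm t0) -[leRHS]mulr1; apply: ler_pM => //.
by apply: IH; rewrite (ltW c0) (le_trans (ltW c1)).
Qed.

End composition_derivatives.

(** * Homogeneous polynomials and matching moments *)

Section homogeneous_polynomials.
Context {R : realType} {p : nat}.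
Implicit Types (f g : 'cV[R]_p -> R) (x : 'cV[R]_p).

Definition monomial (s : seq 'I_p) x : R := \prod_(j <- s) x j ord0.

(** Monomials are words of indices and not exponent vectors, so that their expectations are
    literally the entries of the tensor moments. *)
Definition hompoly k f : Prop := exists l : seq (R * seq 'I_p),
  (forall i, i \in l -> size i.2 = k) /\
  forall x, f x = \sum_(i <- l) i.1 * monomial i.2 x.

Lemma hompoly_cst c : hompoly 0 (fun=> c).
Proof.
exists [:: (c, [::])]; split => [i|x]; first by rewrite inE => /eqP ->.
by rewrite big_seq1 /monomial big_nil mulr1.
Qed.

Lemma hompoly_coord j : hompoly 1 (fun x => x j ord0).
Proof.
exists [:: (1, [:: j])]; split => [i|x]; first by rewrite inE => /eqP ->.
by rewrite big_seq1 /monomial big_seq1 mul1r.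
Qed.

Lemma hompolyD k f g : hompoly k f -> hompoly k g -> hompoly k (fun x => f x + g x).
Proof.
move=> [l [kl fE]] [l' [kl' gE]]; exists (l ++ l'); split => [i|x].
  by rewrite mem_cat => /orP[/kl|/kl'].
by rewrite big_cat fE gE.
Qed.

Lemma hompolyM k k' f g : hompoly k f -> hompoly k' g ->
  hompoly (k + k') (fun x => f x * g x).
Proof.
move=> [l [kl fE]] [l' [kl' gE]].
exists [seq (a.1 * b.1, a.2 ++ b.2) | a <- l, b <- l']; split => [i|x].
  by move=> /allpairsP[[a b] [/= al bl ->]]/=; rewrite size_cat (kl _ al) (kl' _ bl).
rewrite big_allpairs_dep fE gE big_distrl/=; apply: eq_bigr => a _.
rewrite big_distrr/=; apply: eq_bigr => b _.
by rewrite /monomial big_cat/= mulrACA.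
Qed.

Lemma hompolyZ k c f : hompoly k f -> hompoly k (fun x => c * f x).
Proof. by move=> hf; exact: (hompolyM (hompoly_cst c) hf). Qed.

Lemma hompolyX k a f : hompoly k f -> hompoly (a * k) (fun x => f x ^+ a).
Proof.
move=> hf; elim: a => [|a IH]; first exact: hompoly_cst.
by rewrite mulSn; have := hompolyM hf IH; under eq_fun do rewrite -exprS.
Qed.

Lemma hompoly_sum k (I : Type) (r : seq I) (f : I -> 'cV[R]_p -> R) :
  (forall i, hompoly k (f i)) -> hompoly k (fun x => \sum_(i <- r) f i x).
Proof.
move=> hf; elim: r => [|i r IH].
  by exists [::]; split => // x; rewrite !big_nil.
by under eq_fun do rewrite big_cons; exact: hompolyD.
Qed.

Lemma hompoly_dotp y : hompoly 1 (dotp y).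
Proof. by apply: hompoly_sum => j; exact/hompolyZ/hompoly_coord. Qed.

Lemma hompoly_normsq : hompoly 2 normsq.
Proof. by apply: hompoly_sum => j; exact: (hompolyX 2 (hompoly_coord j)). Qed.

Lemma hompolyscale k f c x : hompoly k f -> f (c *: x) = c ^+ k * f x.
Proof.
move=> [l [kl fE]]; rewrite !fE big_distrr/= big_seq [RHS]big_seq.
apply: eq_bigr => i /kl <-; rewrite mulrCA; congr (_ * _).
rewrite /monomial; elim: i.2 => [|j s IH] /=; first by rewrite !big_nil mulr1.
by rewrite !big_cons mxE IH exprS mulrACA.
Qed.

Lemma hompoly_comp_deriv K k m a b (s : R) (s1 s2 : 'cV[R]_p -> R) :
  hompoly 1 s1 -> hompoly 2 s2 ->
  hompoly (k + a + b.*2) (fun x => comp_deriv K k m a b s (s1 x) (s2 x)).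
Proof.
move=> h1 h2; elim: k m a b => [|k IH] m a b /=.
  rewrite add0n -muln2 -[a in (a + _)%N]muln1.
  by apply: hompolyM; [apply: hompolyZ|]; exact: hompolyX.
apply: hompolyD; first by have := IH m.+1 a.+1 b; rewrite addnS.
(* For a = 0 the second summand is 0 times a polynomial of a different degree; it is presented as a
   zero polynomial of the right degree, with the words of another one. *)
case: a => [|a].
  have [l [kl _]] := IH m 1%N b.
  exists [seq (0, i.2) | i <- l]; split => [i /mapP[j jl ->]|x] /=.
    by rewrite (kl _ jl) addn1 addn0.
  by rewrite mul0r big_map big1// => i _; rewrite mul0r.
apply: hompolyZ; have := IH m a b.+1; rewrite doubleS.
by rewrite !addnS !addSn.
Qed.

Section integration.
Context {d} {T : measurableType d} (P : probability T R).
Variables (X : T -> 'cV[R]_p) (K : nat).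
Hypothesis mX : mcoord X.
Hypothesis XK : P.-integrable setT (EFin \o (fun w => enorm (X w) ^+ K)).

Lemma normr_coord_le x j : `|x j ord0| <= enorm x.
Proof.
rewrite -(@ler_pXn2r _ 2)// ?nnegrE ?enorm_ge0// real_normK ?num_real// sqr_enorm.
by rewrite /normsq (bigD1 j)//= lerDl; apply: sumr_ge0 => i _; exact: sqr_ge0.
Qed.

Lemma normr_monomial_le s x : `|monomial s x| <= enorm x ^+ size s.
Proof.
rewrite /monomial; elim: s => [|j s IH]; first by rewrite big_nil normr1.
by rewrite big_cons normrM /= exprS; apply: ler_pM => //; exact: normr_coord_le.
Qed.

Lemma integrable_monomial s : (size s <= K)%N ->
  P.-integrable setT (EFin \o (fun w => monomial s (X w))).
Proof.
move=> sK.
have i1 : P.-integrable setT (EFin \o (fun w => 1 + enorm (X w) ^+ K)).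
  by apply: integrable_addr => //; apply: (@bounded_integrable _ _ _ _ _ 1) => // x; rewrite normr1.
apply: le_integrable i1 => //.
  by apply/measurable_EFinP; apply: measurable_prod => j _; exact: mX.
move=> w _; rewrite !abse_EFin lee_fin.
apply: le_trans (normr_monomial_le _ _) _.
have E0 := enorm_ge0 (X w).
rewrite [leRHS]ger0_norm ?addr_ge0 ?exprn_ge0//.
have [e1|e1] := leP (enorm (X w)) 1.
  by apply: (@le_trans _ _ 1); [exact: exprn_ile1|rewrite lerDl exprn_ge0].
by rewrite -[leLHS]add0r lerD// ler_eXn2l.
Qed.

Lemma integrable_hompoly k f : (k <= K)%N -> hompoly k f ->
  P.-integrable setT (EFin \o (fun w => f (X w))).
Proof.
move=> kK [l [kl fE]].
have -> : (fun w => f (X w)) = (fun w => \sum_(i <- l) i.1 * monomial i.2 (X w)).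
  by apply/funext => w; rewrite fE.
elim: l kl {fE} => [|i l IH] kl.
  apply: (@bounded_integrable _ _ _ _ _ 0) => [|x]; last by rewrite big_nil normr0.
  by under eq_fun do rewrite big_nil; exact: measurable_cst.
under eq_fun do rewrite big_cons.
apply: integrable_addr.
  by apply/integrable_mulrl/integrable_monomial; rewrite kl ?mem_head.
by apply: IH => j jl; apply: kl; rewrite inE jl orbT.
Qed.

End integration.

Section moment_matching.
Context {d} {T : measurableType d} (P : probability T R).
Variables (X Y : T -> 'cV[R]_p) (K : nat).
Hypotheses (mX : mcoord X) (mY : mcoord Y).
Hypothesis XK : P.-integrable setT (EFin \o (fun w => enorm (X w) ^+ K)).
Hypothesis YK : P.-integrable setT (EFin \o (fun w => enorm (Y w) ^+ K)).
Hypothesis XY : forall k, (1 <= k <= K - 1)%N -> same_tensor_moment P k X Y.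

Lemma Ex_hompoly_eq k f : (k < K)%N -> hompoly k f ->
  Ex P (fun w => f (X w)) = Ex P (fun w => f (Y w)).
Proof.
move=> kK hf; have [l [kl fE]] := hf.
have -> : (fun w => f (X w)) = (fun w => \sum_(i <- l) i.1 * monomial i.2 (X w)).
  by apply/funext => w; rewrite fE.
have -> : (fun w => f (Y w)) = (fun w => \sum_(i <- l) i.1 * monomial i.2 (Y w)).
  by apply/funext => w; rewrite fE.
have H Z s : mcoord Z -> P.-integrable setT (EFin \o (fun w => enorm (Z w) ^+ K)) ->
    size s = k -> P.-integrable setT (EFin \o (fun w => monomial s (Z w))).
  by move=> mZ ZK sk; apply: (integrable_monomial mZ ZK); rewrite sk ltnW.
elim: l kl {fE hf} => [|i l IH] kl; first by congr (Ex P _); apply/funext => w; rewrite !big_nil.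
have il := kl _ (mem_head _ _).
have kl' j : j \in l -> size j.2 = k by move=> jl; apply: kl; rewrite inE jl orbT.
have hl : hompoly k (fun x => \sum_(i <- l) i.1 * monomial i.2 x) by exists l.
have iX := integrable_hompoly mX XK (ltnW kK) hl.
have iY := integrable_hompoly mY YK (ltnW kK) hl.
under eq_fun do rewrite big_cons; under [in RHS]eq_fun do rewrite big_cons.
have hX := H X _ mX XK il; have hY := H Y _ mY YK il.
rewrite !RintegralD ?IH//; [|exact: integrable_mulrl..].
congr (_ + _); rewrite !RintegralZl//; congr (_ * _).
(* The moment hypothesis starts at order 1; at order 0 the word is empty and both sides are the same
   constant. *)
have [k0|k0] := posnP k.
  by rewrite k0 in il; congr (Ex P _); apply/funext => w; rewrite (size0nil il) /monomial !big_nil.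
have : same_tensor_moment P (size i.2) X Y.
  by apply: XY; rewrite il k0 subn1 -ltnS (ltn_predK kK).
move=> /(_ (tnth (in_tuple i.2))); rewrite unlock => E.
rewrite /Rintegral; congr fine; move: E.
congr (_ = _); apply: eq_integral => w _; rewrite /monomial big_tnth; congr EFin;
  by apply: eq_bigr => j _; rewrite (ord1 (0:'I_1)).
Qed.

End moment_matching.

End homogeneous_polynomials.

(** * Smoothed indicators of balls *)

Section smooth_ball.
Context {R : realType} {p : nat} (K : nat).
Variables (c : 'cV[R]_p) (r eps : R).
Hypotheses (r_ge0 : 0 <= r) (eps_gt0 : 0 < eps).
Implicit Types (x y h : 'cV[R]_p).

(** This is (r + eps)^2 - r^2, the scale at which |x - c|^2 - r^2 runs through [0, 1] across the
    shell. *)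
Let L : R := eps * (2 * r + eps).

Let L_gt0 : 0 < L.
Proof. by rewrite mulr_gt0// ltr_wpDl// mulr_ge0. Qed.

Let L_sqr : L + r ^+ 2 = (r + eps) ^+ 2.
Proof. by rewrite /L; ring. Qed.

Definition smooth_ball x : R :=
  smooth_step K 0 ((normsq (x - c) - r ^+ 2) / (eps * (2 * r + eps))).

Lemma smooth_ball_itv x : 0 <= smooth_ball x <= 1.
Proof. exact: smooth_step_itv. Qed.

Lemma smooth_ball_in x : enorm (x - c) <= r -> smooth_ball x = 1.
Proof.
move=> xr; rewrite /smooth_ball smooth_step_le0// pmulr_lle0 ?invr_gt0//.
by rewrite subr_le0 -sqr_enorm lerXn2r ?nnegrE ?enorm_ge0.
Qed.

Lemma smooth_ball_out x : r + eps <= enorm (x - c) -> smooth_ball x = 0.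
Proof.
move=> xr; rewrite /smooth_ball smooth_step_ge1// ler_pdivlMr// mul1r lerBrDr.
rewrite -sqr_enorm -/L L_sqr.
by rewrite lerXn2r ?nnegrE ?enorm_ge0 ?addr_ge0// ltW.
Qed.

Lemma cmeas_smooth_ball : cmeas smooth_ball.
Proof.
move=> d T X mX.
have ms : measurable_fun setT (smooth_step K 0 : R -> R).
  by apply: continuous_measurable_fun; exact: continuous_smooth_step.
apply: (measurableT_comp ms); apply: measurable_funM => //.
apply: measurable_funB => //; apply: measurable_normsq.
by apply: mcoordB => //; exact: mcoord_cst.
Qed.

(** The k-th derivative at t = 0 of [smooth_ball] (y + t h): the last two arguments are the first
    and second derivatives in t of the rescaled quadratic function. *)
Definition taylor_term k y h : R := comp_deriv K k 0 0 0
  ((normsq (y - c) - r ^+ 2) / L) (2 / L * dotp (y - c) h) (2 / L * normsq h).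

Lemma hompoly_taylor_term k y : hompoly k (taylor_term k y).
Proof.
have := @hompoly_comp_deriv R p K k 0 0 0 ((normsq (y - c) - r ^+ 2) / L) _ _
  (hompolyZ (2 / L) (hompoly_dotp (y - c))) (hompolyZ (2 / L) hompoly_normsq).
by rewrite !addn0.
Qed.

(** Taylor's formula at t = 1 along the segment from y to y + h, the derivatives in t being bounded
    with rho = (2 / eps) |h|. *)
Lemma smooth_ball_taylor (M : R) y h : (0 < K)%N ->
  (forall j u, (j <= K)%N -> `|smooth_step K j u| <= M) ->
  `|smooth_ball (y + h) - \sum_(k < K) taylor_term k y h * k`!%:R^-1| <=
  M * comp_const K 0 * (2 / eps) ^+ K * enorm h ^+ K.
Proof.
move=> K0 HM.
pose q (t : R) := (normsq (y + t *: h - c) - r ^+ 2) / L.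
pose q1 (t : R) := 2 / L * dotp (y + t *: h - c) h.
pose q2 := 2 / L * normsq h.
have M0 : 0 <= M by apply: le_trans (HM 0%N 0 _).
have qE (t : R) : q t = (normsq (y - c) - r ^+ 2) / L +
    (2 / L * dotp (y - c) h) * t + (normsq h / L) * t ^+ 2.
  by rewrite /q (addrAC y) (normsqD (y - c)) dotpZr normsqZ; field; exact: lt0r_neq0.
have q1E (t : R) : q1 t = 2 / L * dotp (y - c) h + q2 * t.
  by rewrite /q1 (addrAC y) (dotpDl h (y - c)) dotpZl /q2 normsqE; ring.
have dq (x : R) : is_derive x 1 q (q1 x).
  apply: (@is_derive_quadratic _ _ _ _ (normsq h / L)) => t.
  rewrite le_eqVlt; apply/orP; left; apply/eqP.
  rewrite (_ : _ - _ - _ = normsq h / L * t ^+ 2); last by rewrite !qE q1E /q2; ring.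
  by rewrite ger0_norm// mulr_ge0 ?sqr_ge0// divr_ge0 ?normsq_ge0 ?(ltW L_gt0).
have dq1 (x : R) : is_derive x 1 q1 q2.
  apply: (@is_derive_quadratic _ _ _ _ 0) => t; rewrite !q1E mul0r.
  by rewrite (_ : _ - _ = 0) ?normr0//; ring.
pose phi k (t : R) := comp_deriv K k 0 0 0 (q t) (q1 t) q2.
have E k : phi k 0 = taylor_term k y h.
  by rewrite /phi /taylor_term /q /q1 !scale0r !addr0.
have E1 : phi 0%N 1 = smooth_ball (y + h).
  by rewrite /phi /= /q scale1r !expr0 !mulr1.
rewrite -E1; under eq_bigr do rewrite -E.
have := @taylor_bound R phi K (M * comp_const K 0 * (2 / eps) ^+ K * enorm h ^+ K) 1.
under [X in _ -> _ -> _ -> `|_ - X| <= _]eq_bigr do rewrite expr1n mulr1.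
apply.
- by move=> k t kK; exact: is_derive_comp_deriv.
- move=> t _; rewrite -mulrA -exprMn.
  have rho0 : 0 <= 2 / eps * enorm h by rewrite !mulr_ge0 ?enorm_ge0// invr_ge0 ltW.
  (* Off the shell the derivatives of positive order vanish. On it, |y + t h - c| <= r + eps <= 2r +
     eps = L / eps, whence a first derivative of at most (2 / eps) |h|; the second one is 2 |h|^2 /
     L with L >= eps^2. *)
  have [qin|qout] := boolP (0 < q t < 1); last first.
    have phi0 k : (k < K)%N -> phi k.+1 t = 0.
      by move=> kK; rewrite /phi /= comp_deriv_out// mul0r addr0.
    have -> : phi K t = 0 by rewrite -(prednK K0) phi0 ?prednK.
    by rewrite normr0 mulr_ge0 ?exprn_ge0// mulr_ge0// comp_const_ge0.
  rewrite -[X in _ ^+ X]addn0 -[(K + 0)%N]addn0.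
  apply: (@comp_deriv_le R K M _ K 0 0 0) => //.
    have /andP[_] := qin; rewrite ltr_pdivrMr// mul1r ltrBlDr.
    rewrite L_sqr.
    have re0 : 0 <= r + eps by rewrite addr_ge0// ltW.
    rewrite -sqr_enorm ltr_pXn2r ?nnegrE ?enorm_ge0// => /ltW yr.
    rewrite /q1 normrM ger0_norm ?divr_ge0 ?(ltW L_gt0)//.
    apply: le_trans (ler_wpM2l _ (normr_dotp_le _ _)) _.
      by rewrite divr_ge0 ?(ltW L_gt0).
    rewrite mulrA ler_wpM2r ?enorm_ge0//.
    apply: le_trans (ler_wpM2l _ yr) _; first by rewrite divr_ge0 ?(ltW L_gt0).
    rewrite -!mulrA ler_wpM2l// mulrC ler_pdivrMr// /L mulrA mulVf ?gt_eqF//.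
    by rewrite mul1r lerD// ler_peMl// ler1n.
  rewrite /q2 normrM ger0_norm ?divr_ge0 ?(ltW L_gt0)// ger0_norm ?normsq_ge0//.
  rewrite exprMn sqr_enorm ler_wpM2r ?normsq_ge0//.
  rewrite ler_pdivrMr// exprMn /L exprVn -mulrA expr2 invfM.
  have -> : 2 ^+ 2 * (eps^-1 * eps^-1 * (eps * (2 * r + eps))) =
     2 * (2 + 4 * (r / eps)).
    by field; exact: lt0r_neq0.
  have : 0 <= r / eps by rewrite divr_ge0// ltW.
  by lra.
- by rewrite ler01 lexx.
Qed.

Section swap.
Context {d} {T : measurableType d} (P : probability T R).
Variables (X Y : T -> 'cV[R]_p).
Hypotheses (mX : mcoord X) (mY : mcoord Y).
Hypothesis XK : P.-integrable setT (EFin \o (fun w => enorm (X w) ^+ K)).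
Hypothesis YK : P.-integrable setT (EFin \o (fun w => enorm (Y w) ^+ K)).
Hypothesis XY : forall k, (1 <= k <= K - 1)%N -> same_tensor_moment P k X Y.

Let poly_eq y (lam : R) :
  let S Z := fun w : T => \sum_(k < K) taylor_term k y (lam *: Z w) * k`!%:R^-1 in
  [/\ P.-integrable setT (EFin \o S X), P.-integrable setT (EFin \o S Y) &
      Ex P (S X) = Ex P (S Y)].
Proof.
move=> S.
have hk (k : 'I_K) : hompoly k (fun h => taylor_term k y (lam *: h) * k`!%:R^-1).
  have := hompolyZ (k`!%:R^-1 * lam ^+ k) (hompoly_taylor_term k y).
  move=> [l [kl fE]]; exists l; split => // h; rewrite -fE.
  by rewrite (hompolyscale _ _ (hompoly_taylor_term k y)); ring.
have [i1 E1] := Ex_sum (index_enum 'I_K) (fun k : 'I_K => integrable_hompoly mX XK (ltnW (ltn_ord k)) (hk k)).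
have [i2 E2] := Ex_sum (index_enum 'I_K) (fun k : 'I_K => integrable_hompoly mY YK (ltnW (ltn_ord k)) (hk k)).
split => //; rewrite /S E1 E2; apply: eq_bigr => k _.
exact: (Ex_hompoly_eq mX mY XK YK XY (ltn_ord k) (hk k)).
Qed.

(** Both expectations are compared with that of the Taylor polynomial at y, of degree less than [K],
    which has the same mean under X and Y. *)
Lemma smooth_ball_swap (M lam : R) y : (0 < K)%N -> 0 <= lam ->
  (forall j u, (j <= K)%N -> `|smooth_step K j u| <= M) ->
  `|Ex P (fun w => smooth_ball (y + lam *: X w)) -
    Ex P (fun w => smooth_ball (y + lam *: Y w))| <=
  M * comp_const K 0 * (2 / eps) ^+ K * lam ^+ K *
    (Ex P (fun w => enorm (X w) ^+ K) + Ex P (fun w => enorm (Y w) ^+ K)).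
Proof.
move=> K0 lam0 HM; have [iX iY E] := poly_eq y lam.
set B := M * _ * _ * _.
have bnd Z : mcoord Z -> P.-integrable setT (EFin \o (fun w => enorm (Z w) ^+ K)) ->
    P.-integrable setT (EFin \o (fun w => \sum_(k < K) taylor_term k y (lam *: Z w) * k`!%:R^-1)) ->
    `|Ex P (fun w => smooth_ball (y + lam *: Z w)) -
      Ex P (fun w => \sum_(k < K) taylor_term k y (lam *: Z w) * k`!%:R^-1)| <=
    B * Ex P (fun w => enorm (Z w) ^+ K).
  move=> mZ ZK iZ.
  have ib : P.-integrable setT (EFin \o (fun w => smooth_ball (y + lam *: Z w))).
    apply: (@bounded_integrable _ _ _ _ _ 1).
      by apply: cmeas_smooth_ball; apply: mcoordD; [exact: mcoord_cst|exact: mcoordZ].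
    by move=> w; have /andP[? ?] := smooth_ball_itv (y + lam *: Z w); rewrite ger0_norm.
  rewrite -RintegralB//; apply: le_trans (le_normr_Rintegral _ _) _ => //.
    exact: integrable_subr.
  rewrite -RintegralZl//; apply: le_Ex.
  - exact: (integrable_norm (integrable_subr ib iZ)).
  - exact: integrable_mulrl.
  - move=> w; apply: le_trans (smooth_ball_taylor y (lam *: Z w) K0 HM) _.
    by rewrite enormZ (ger0_norm lam0) (exprMn _ lam) /B !mulrA.
rewrite [X in _ <= X]mulrDr.
set a := Ex P _; set b := Ex P _; pose e := Ex P (fun w => \sum_(k < K) taylor_term k y (lam *: X w) * k`!%:R^-1).
have -> : a - b = (a - e) - (b - e) by ring.
apply: le_trans (ler_normB _ _) _; apply: lerD; first exact: bnd.
by rewrite /e E; exact: bnd.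
Qed.

End swap.

End smooth_ball.

(** * Replacing the summands one by one *)

Section lindeberg.
Context {R : realType} {p n : nat} (K : nat).
Context {d} {T : measurableType d} (P : probability T R).
Variables (X Y : 'I_n -> {RV P >-> 'cV[R]_p}).
Hypotheses (indX : mutually_independent_RV X) (indY : mutually_independent_RV Y).
Hypothesis indXY : independent_families X Y.
Hypothesis XK : forall i, P.-integrable setT (EFin \o (fun w => enorm (X i w) ^+ K)).
Hypothesis YK : forall i, P.-integrable setT (EFin \o (fun w => enorm (Y i w) ^+ K)).
Hypothesis XY : forall i k, (1 <= k <= K - 1)%N -> same_tensor_moment P k (X i) (Y i).
Variables (c : 'cV[R]_p) (r eps lam M : R).
Hypotheses (r_ge0 : 0 <= r) (eps_gt0 : 0 < eps) (lam_ge0 : 0 <= lam) (K_gt0 : (0 < K)%N).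
Hypothesis MP : forall j u, (j <= K)%N -> `|smooth_step K j u| <= M.

Let f := smooth_ball K c r eps.
Let B := M * comp_const K 0 * (2 / eps) ^+ K * lam ^+ K.

(** In hybrid k the summands of index less than k are already replaced. [V i] is the part common to
    hybrids i and i + 1, and [blk i] collects the sources it uses, which include neither [X i] nor
    [Y i]. *)
Let hyb (k : nat) (j : 'I_n) (w : T) := if (j < k)%N then Y j w else X j w.
Let V (i : 'I_n) (w : T) := \sum_(j < n | j != i) lam *: hyb i j w.
Let blk (i : 'I_n) : {set 'I_n + 'I_n} :=
  [set k : 'I_n + 'I_n | match k with inl j => (i < j)%N | inr j => (j < i)%N end].

Let mV i : mcoord (V i : g_sigma_algebraType (block (joint_systems X Y) (blk i)) -> _).
Proof.
apply: (@mcoord_sum _ _ (g_sigma_algebraType _)) => j ji.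
apply: (@mcoordZ _ _ (g_sigma_algebraType _)) => k.
rewrite /hyb; case: (ltnP j i) => ij; apply: (measurableT_comp (measurable_borel_coord k)).
  by apply: measurable_blockr; rewrite inE.
by apply: measurable_blockl; rewrite inE ltn_neqAle ij eq_sym ji.
Qed.

Let f1 z : `|f z| <= 1.
Proof. by have /andP[? ?] := smooth_ball_itv K c r eps z; rewrite ger0_norm. Qed.

Let Ex_split (i : 'I_n) (k : 'I_n + 'I_n) (Z : T -> 'cV[R]_p) : k \notin blk i ->
  mcoord (Z : g_sigma_algebraType (block (joint_systems X Y) [set k]%SET) -> _) ->
  Ex P (fun w => f (V i w + lam *: Z w)) =
  Ex P (fun w => Ex P (fun w' => f (V i w + lam *: Z w'))).
Proof.
move=> ki mZ.
have bm J : block (joint_systems X Y) J `<=` measurable.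
  by apply: block_measurable; exact: joint_systems_measurable.
have J12 j : j \in blk i -> j \notin [set k]%SET.
  by move=> ji; rewrite finset.in_set1; apply: contraTneq ji => ->.
have mlZ := @mcoordZ _ _ (g_sigma_algebraType _) _ lam _ mZ.
exact: (Ex_independent_vectors (V := V i) (X := fun w => lam *: Z w) (bm _) (bm _)
  (joint_blocks_independent indX indY indXY J12) (@mV i) mlZ
  (@cmeas_smooth_ball R p K c r eps) f1).
Qed.

Let swap_one (i : 'I_n) :
  `|Ex P (fun w => f (V i w + lam *: X i w)) - Ex P (fun w => f (V i w + lam *: Y i w))| <=
  B * (Ex P (fun w => enorm (X i w) ^+ K) + Ex P (fun w => enorm (Y i w) ^+ K)).
Proof.
rewrite (@Ex_split i (inl i)) ?inE ?ltnn//; last first.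
  by move=> k; apply: (measurableT_comp (measurable_borel_coord k)); apply: measurable_blockl; rewrite inE.
rewrite (@Ex_split i (inr i)) ?inE ?ltnn//; last first.
  by move=> k; apply: (measurableT_comp (measurable_borel_coord k)); apply: measurable_blockr; rewrite inE.
have mVT : mcoord (V i).
  apply: mcoord_sum => j _; apply: mcoordZ; rewrite /hyb.
  by case: (j < i)%N; exact: mcoord_RV.
have mE Z : mcoord Z -> measurable_fun setT (fun w => Ex P (fun w' => f (V i w + lam *: Z w'))).
  move=> mZ.
  apply: (@measurable_Ex1 R d d T T P P (fun z => f (V i z.1 + lam *: Z z.2)) 1) => //.
  apply: cmeas_smooth_ball; apply: mcoordD.
    exact: (mcoord_comp (X := V i) measurable_fst).
  apply: mcoordZ; exact: (mcoord_comp (X := Z) measurable_snd).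
have bE Z : mcoord Z -> P.-integrable setT (EFin \o (fun w => Ex P (fun w' => f (V i w + lam *: Z w')))).
  move=> mZ; apply: (@bounded_integrable _ _ _ _ _ 1); first exact: mE.
  move=> w; apply: le_normr_Ex => //.
  by apply: cmeas_smooth_ball; apply: mcoordD; [exact: mcoord_cst|exact: mcoordZ].
have mX := @mcoord_RV R _ _ _ P (X i); have mY := @mcoord_RV R _ _ _ P (Y i).
rewrite -RintegralB//; [|exact: bE..].
apply: le_normr_Ex; first by apply: measurable_funB; exact: mE.
by move=> w; apply: smooth_ball_swap => //; exact: XY.
Qed.

Lemma lindeberg_smooth_ball :
  `|Ex P (fun w => f (lam *: \sum_(i < n) X i w)) -
    Ex P (fun w => f (lam *: \sum_(i < n) Y i w))| <=
  B * \sum_(i < n) (Ex P (fun w => enorm (X i w) ^+ K) + Ex P (fun w => enorm (Y i w) ^+ K)).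
Proof.
pose a k := Ex P (fun w => f (\sum_(j < n) lam *: hyb k j w)).
have a0 : Ex P (fun w => f (lam *: \sum_(i < n) X i w)) = a 0%N.
  by congr (Ex P _); apply/funext => w; rewrite scaler_sumr.
have an : Ex P (fun w => f (lam *: \sum_(i < n) Y i w)) = a n.
  congr (Ex P _); apply/funext => w; rewrite scaler_sumr; congr f.
  by apply: eq_bigr => j _; rewrite /hyb ltn_ord.
rewrite a0 an -normrN opprB -(@telescope_sumr _ 0 n a)// big_mkord mulr_sumr.
apply: le_trans (ler_norm_sum _ _ _) _; apply: ler_sum => i _.
rewrite -normrN opprB; apply: le_trans (swap_one i).
rewrite le_eqVlt; apply/orP; left; apply/eqP; congr `|_ - _|;
  congr (Ex P _); apply/funext => w; congr f; rewrite (bigD1 i)//= addrC.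
  by rewrite /hyb ltnn.
rewrite /hyb ltnSn; congr (_ + _); apply: eq_bigr => j ji.
by rewrite ltnS leq_eqVlt (_ : (j == i :> nat) = false) //; exact/negbTE.
Qed.

End lindeberg.

(** * Positive square roots *)

Lemma poly_interpolation {F : fieldType} (s : seq F) (g : F -> F) :
  exists q : {poly F}, {in s, forall x, q.[x] = g x}.
Proof.
elim: s => [|x s [q qg]]; first by exists 0.
have [xs|xs] := boolP (x \in s).
  by exists q => y; rewrite inE => /predU1P[->|]; exact: qg.
pose m := \prod_(y <- s) ('X - y%:P).
have mx : m.[x] != 0 by have := root_prod_XsubC s x; rewrite /root => ->.
exists (q + ((g x - q.[x]) / m.[x])%:P * m) => y; rewrite inE hornerD hornerM hornerC.
move=> /predU1P[->|ys]; first by rewrite divfK// addrC subrK.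
have /eqP -> : root m y by rewrite root_prod_XsubC.
by rewrite mulr0 addr0 qg.
Qed.

(** Over the larger field [A] is diagonalized and q acts on the eigenvalues, all of which it fixes;
    injectivity of the scalar extension brings the equality back. *)
Lemma horner_mx_diagonalizable {F L : fieldType} (f : {rmorphism F -> L}) n
    (A : 'M[F]_n.+1) (P : 'M[L]_n.+1) (D : 'rV[L]_n.+1) (l : 'I_n.+1 -> F) q :
  P \in unitmx -> map_mx f A = invmx P *m diag_mx D *m P ->
  (forall j, D ord0 j = f (l j)) -> (forall j, q.[l j] = l j) -> horner_mx A q = A.
Proof.
move=> Pu AE Dl ql; apply: (@map_mx_inj _ _ f); rewrite map_horner_mx AE.
rewrite horner_mx_uconjC// horner_mx_diag; congr (_ *m diag_mx _ *m _).
by apply/rowP => j; rewrite mxE Dl horner_map ql.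
Qed.

Section positive_square_root.
Context {R : realType}.

Lemma posdef_eigenvalue_gt0 {n} (A : 'M[R]_n) (l : R) : posdefmx A ->
  eigenvalue A l -> 0 < l.
Proof.
move=> [_ Apos] /eigenvalueP[v vA v0].
have := Apos v^T; rewrite trmxK vA -scalemxAl mxE -{1}(trmx0 _ _ _) (inj_eq trmx_inj).
move=> /(_ v0); have -> : (v *m v^T) ord0 ord0 = normsq v^T.
  by rewrite mxE; apply: eq_bigr => j _; rewrite !mxE expr2.
move=> lv; rewrite -(@pmulr_lgt0 _ (normsq v^T))//.
by rewrite lt_neqAle normsq_ge0 andbT; apply: contraTneq lv => <-; rewrite mulr0 ltxx.
Qed.

(* Diagonalizing [A] over the complex numbers and interpolating the fourth root
   at its (real, positive) eigenvalues. *)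
Lemma posdef_poly_fourth_root {n} (A : 'M[R]_n.+1) : posdefmx A ->
  exists q : {poly R}, horner_mx A q ^+ 4 = A.
Proof.
move=> Apd; have [Asym _] := Apd.
pose f := complex.real_complex R; pose A' := map_mx f A.
have fI : injective f by exact: complex.complexI.
have conjf (x : R) : (f x)^* = f x by exact: complex.conjc_real.
have A'herm : A' \is hermsymmx.
  apply/is_hermitianmxP; rewrite expr0 scale1r /A'.
  by apply/matrixP => i j; rewrite !mxE conjf -[in RHS]Asym mxE.
have /orthomx_spectralP A'E := hermitian_normalmx A'herm.
set P := spectralmx A' in A'E; set D := spectral_diag A' in A'E.
have Pu : P \in unitmx by exact: spectral_unit.
have [l Dl] : exists l : 'I_n.+1 -> R, forall j, D ord0 j = f (l j).
  exists (fun j => complex.Re (D ord0 j)) => j; rewrite /f complex.RRe_real//.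
  by have /mxOverP -> := hermitian_spectral_diag_real A'herm.
have l_gt0 j : 0 < l j.
  apply: (posdef_eigenvalue_gt0 Apd).
  rewrite eigenvalue_root_char -(fmorph_root f) map_char_poly -/A' -eigenvalue_root_char.
  apply/eigenvalueP; exists (row j P); last first.
    apply: contraTneq Pu => Pj; apply/negP => Pu.
    have : row j P *m invmx P = 0 by rewrite Pj mul0mx.
    rewrite -row_mul mulmxV// => /rowP/(_ j); rewrite !mxE eqxx.
    by move/eqP; rewrite oner_eq0.
  rewrite -row_mul {1}A'E !mulmxA mulmxV// mul1mx row_mul row_diag_mx.
  by rewrite -scalemxAl -rowE Dl.
have [q qP] := poly_interpolation (codom l) (fun x => Num.sqrt (Num.sqrt x)).
exists q; rewrite -rmorphXn /=.
apply: (horner_mx_diagonalizable Pu A'E Dl) => j; rewrite horner_exp qP ?codom_f//.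
by rewrite (exprM _ 2 2) !sqr_sqrtr ?sqrtr_ge0// ltW.
Qed.

Lemma dotp_mulmx {p} (A : 'M[R]_p) x y : A^T = A -> dotp x (A *m y) = dotp (A *m x) y.
Proof. by move=> Asym; rewrite !dotpE trmx_mul Asym mulmxA. Qed.

(** A fourth root V of A that is a polynomial in A is symmetric, so V^2 is a square root with x^T
    V^2 x = |V x|^2. This is positive without any discussion of the signs of eigenvalues of V, since
    V x = 0 would give A x = 0. *)
Lemma posdef_sqrt {p} (A : 'M[R]_p) : posdefmx A ->
  exists W : 'M[R]_p, posdefmx W /\ W *m W = A.
Proof.
case: p A => [|n] A Apd.
  exists A; split => //; apply/matrixP; by case.
have [q qA] := posdef_poly_fourth_root Apd.
pose V := horner_mx A q.
have [Asym Apos] := Apd.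
have Vsym : V^T = V.
  rewrite /V; elim/poly_ind: q {qA V} => [|q c IH]; first by rewrite rmorph0 trmx0.
  rewrite rmorphD rmorphM /= horner_mx_X horner_mx_C linearD /= tr_scalar_mx.
  congr (_ + _); rewrite -[in LHS]mulmxE trmx_mul IH Asym.
  exact: (comm_mx_horner q (comm_mx_refl A)).
exists (V *m V); split; last by rewrite -qA -/V !mulmxE -!expr2 -exprM.
split; first by rewrite trmx_mul Vsym.
move=> x x0; rewrite !mulmxA -mulmxA -[x^T *m V]trmxK trmx_mul trmxK Vsym -dotpE -normsqE.
rewrite lt_neqAle normsq_ge0 andbT eq_sym normsq_eq0.
apply: contraTneq (Apos x x0) => Vx.
rewrite -qA -/V (exprS _ 3) (exprS _ 2) exprSr -!mulmxE -!mulmxA.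
by rewrite (_ : V ^+ 1 *m (V *m x) = 0) ?mulmx0 ?mxE ?ltxx// Vx mulmx0.
Qed.

Lemma sqrtmxP {p} (A : 'M[R]_p) : posdefmx A ->
  posdefmx (sqrtmx A) /\ sqrtmx A *m sqrtmx A = A.
Proof.
by move=> /posdef_sqrt[W HW]; rewrite /sqrtmx; case: xgetP => [V _ //|/(_ W)].
Qed.

Lemma posdef_unit {p} (A : 'M[R]_p) : posdefmx A -> A \in unitmx.
Proof.
move=> [Asym Apos]; rewrite -row_free_unit -kermx_eq0; apply/eqP/row_matrixP => i.
apply/eqP; rewrite row0; apply: contraT => k0.
have := Apos (row i (kermx A))^T; rewrite trmxK.
rewrite -{1}(trmx0 _ _ _) (inj_eq trmx_inj) => /(_ k0).
have -> : row i (kermx A) *m A = 0 by apply/sub_kermxP; exact: row_sub.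
by rewrite mul0mx mxE ltxx.
Qed.

Lemma enorm0 {p} : enorm (0 : 'cV[R]_p) = 0.
Proof. by rewrite -(scale0r 0) enormZ normr0 mul0r. Qed.

Lemma enorm_eq0 {p} (x : 'cV[R]_p) : (enorm x == 0) = (x == 0).
Proof. by rewrite -normsq_eq0 -sqr_enorm sqrf_eq0. Qed.

(** The supremum defining [opnorm] bounds its set only once that set is known to be bounded; the
    Frobenius norm does this, by Cauchy-Schwarz on each row. *)
Lemma enorm_mulmx_le {p} (A : 'M[R]_p) x : enorm (A *m x) <= opnorm A * enorm x.
Proof.
have [C C0 HC] : exists2 C : R, 0 <= C & forall x, enorm (A *m x) <= C * enorm x.
  have N0 : 0 <= \sum_i normsq (row i A)^T by apply: sumr_ge0 => i _; exact: normsq_ge0.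
  exists (Num.sqrt (\sum_i normsq (row i A)^T)) => [|y]; first exact: sqrtr_ge0.
  rewrite -(@ler_pXn2r _ 2)// ?nnegrE ?mulr_ge0 ?enorm_ge0 ?sqrtr_ge0//.
  rewrite exprMn !sqr_enorm sqr_sqrtr//.
  rewrite mulr_suml; apply: ler_sum => i _.
  apply: le_trans (dotp_sqr_le _ _); rewrite mxE.
  rewrite le_eqVlt; apply/orP; left; apply/eqP.
  by congr (_ ^+ 2); apply: eq_bigr => j _; rewrite !mxE.
have sA : has_sup [set enorm (A *m x) | x in [set x | enorm x <= 1]].
  split; first by exists (enorm (A *m 0)); exists 0 => //=; rewrite enorm0.
  by exists C => _ [y /= y1 <-]; apply: le_trans (HC y) _; rewrite ler_piMr.
have [x0|x0] := eqVneq x 0; first by rewrite x0 mulmx0 enorm0 mulr0.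
have ex0 : 0 < enorm x by rewrite lt_neqAle enorm_ge0 eq_sym enorm_eq0 x0.
rewrite -ler_pdivrMr//; apply: ub_le_sup; first exact: (proj2 sA).
exists ((enorm x)^-1 *: x) => /=.
  by rewrite enormZ ger0_norm ?invr_ge0 ?enorm_ge0// mulVf ?gt_eqF.
by rewrite -scalemxAr enormZ ger0_norm ?invr_ge0 ?enorm_ge0// mulrC.
Qed.

Section inverse_root.
Variables (p : nat) (S : 'M[R]_p).
Hypotheses (Spd : posdefmx S) (p_gt0 : (0 < p)%N).

Let W := sqrtmx S.
Let Cz := opnorm (invmx W).

Lemma opnorm_invsqrt_gt0 : 0 < opnorm (invmx (sqrtmx S)).
Proof.
have Wu : W \in unitmx by apply: posdef_unit; exact: (proj1 (sqrtmxP Spd)).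
have xx0 : const_mx 1 != 0 :> 'cV[R]_p.
  by apply/eqP => /matrixP/(_ (Ordinal p_gt0) ord0); rewrite !mxE => /eqP; rewrite oner_eq0.
have := enorm_mulmx_le (invmx W) (W *m const_mx 1); rewrite mulKmx// => H.
have x0 : 0 < enorm (const_mx 1 : 'cV[R]_p) by rewrite lt_neqAle enorm_ge0 eq_sym enorm_eq0 xx0.
rewrite -/W -/Cz ltNge; apply: contraTN x0 => C0; rewrite -leNgt.
by apply: le_trans H _; rewrite mulr_le0_ge0 ?enorm_ge0.
Qed.

(** With W the square root of S, a is the image of W a under the inverse of W, and |W a|^2 = <a, S
    a>. *)
Lemma quad_form_ge a : normsq a <= Cz ^+ 2 * dotp a (S *m a).
Proof.
have [Wpd WW] := sqrtmxP Spd; have Wu := posdef_unit Wpd.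
have := enorm_mulmx_le (invmx W) (W *m a); rewrite mulKmx// => H.
rewrite -WW -mulmxA dotp_mulmx; last by case: Wpd.
rewrite -normsqE -!sqr_enorm -exprMn lerXn2r ?nnegrE ?enorm_ge0//.
by rewrite mulr_ge0 ?enorm_ge0// ltW// opnorm_invsqrt_gt0.
Qed.

(** S - sigma^2 I is positive definite because sigma^2 Cz^2 = 1/4 < 1, and [A] is its square root.
    The factor 2 in sigma makes the inequality strict, so that the square root of a positive
    definite matrix suffices. *)
Lemma covariance_split (sigma : R) : sigma = (2 * Cz)^-1 ->
  exists A : 'M[R]_p, A^T = A /\
    forall a, dotp a (S *m a) = sigma ^+ 2 * normsq a + normsq (A *m a).
Proof.
move=> sE; have C0 : 0 < Cz := opnorm_invsqrt_gt0.
have E a : dotp a ((S - (sigma ^+ 2)%:M) *m a) = dotp a (S *m a) - sigma ^+ 2 * normsq a.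
  by rewrite mulmxBl dotpBr mul_scalar_mx dotpZr normsqE.
have Bpd : posdefmx (S - (sigma ^+ 2)%:M).
  have [Ssym _] := Spd; split; first by rewrite linearB /= Ssym tr_scalar_mx.
  move=> x x0; rewrite -mulmxA -dotpE E subr_gt0.
  have nx : 0 < normsq x by rewrite lt_neqAle normsq_ge0 eq_sym normsq_eq0 x0.
  rewrite -(@ltr_pM2l _ (Cz ^+ 2)) ?exprn_gt0//.
  apply: lt_le_trans (quad_form_ge x).
  rewrite mulrA sE -exprMn invfM mulrCA mulfV ?gt_eqF// mulr1.
  rewrite gtr_pMl// expr2; have : (2 : R)^-1 < 1 by rewrite invf_lt1//; lra.
  have : (0 : R) < 2^-1 by rewrite invr_gt0.
  by move=> ? ?; rewrite mulr_ilt1// ltW.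
have [A [[Asym _] AA]] := posdef_sqrt Bpd; exists A; split => // a.
have := E a; rewrite -AA -mulmxA dotp_mulmx// -normsqE => ->.
by rewrite addrC subrK.
Qed.

End inverse_root.

End positive_square_root.

(** * Characteristic function of the sum *)

Lemma measurable_dotp_borel {R : realType} {p} (a : 'cV[R]_p) :
  measurable_fun setT (dotp a : 'cV[R]_p -> R).
Proof.
by apply: (@measurable_dotp R _ 'cV[R]_p p (fun=> a) id);
  [exact: mcoord_cst|move=> j; exact: measurable_borel_coord].
Qed.

Lemma cmeas_cos_dotp {R : realType} {p} (a : 'cV[R]_p) (theta : R) :
  cmeas (fun x => cos (dotp a x + theta)).
Proof.
move=> d T X mX; apply: (measurableT_comp measurable_cos).
by apply: measurable_funD => //; apply: measurable_dotp => //; exact: mcoord_cst.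
Qed.

Section cf_gaussian_component.
Context {R : realType} {p : nat}.
Context {d} {T : measurableType d} (P : probability T R).
Context {d'} {T' : measurableType d'} (Q : probability T' R).
Variables (Y : {RV P >-> 'cV[R]_p}) (Z U : {RV Q >-> 'cV[R]_p}) (S : 'M[R]_p).
Hypotheses (Spd : posdefmx S) (indZU : independent_RV Z U).
Hypothesis normalZ : centered_normal Q S Z.
Hypothesis lawY : eq_in_law P Q Y (fun w => Z w + U w).

(** After passing to Z + U by equality of laws, U is frozen: <a, U> + theta becomes the phase in the
    formula on the line for <a, Z>, whose law is N(0, <a, S a>). *)
Lemma cf_gaussian_component a theta :
  Ex P (fun w => cos (dotp a (Y w) + theta)) =
  expR (- (dotp a (S *m a) / 2)) * Ex Q (fun w => cos (dotp a (U w) + theta)).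
Proof.
have mY := @mcoord_RV R _ _ _ P Y; have mZ := @mcoord_RV R _ _ _ Q Z.
have mU := @mcoord_RV R _ _ _ Q U.
(* The law of a^T Z is prescribed for a nonzero only; at a = 0 both sides are cos theta. *)
have [->|a0] := eqVneq a 0.
  rewrite dotp0l mul0r oppr0 expR0 mul1r.
  by under eq_Ex do rewrite dotp0l; under [RHS]eq_Ex do rewrite dotp0l; rewrite !Ex_cst.
have cos1 (c : R) : `|cos c| <= 1 by exact: normr_cos_le1.
have mcos (c : R) : measurable_fun setT (fun x : R => cos (x + c)).
  by apply: (measurableT_comp measurable_cos); exact: measurable_funD.
have mdot d0 (T0 : measurableType d0) (X : T0 -> 'cV[R]_p) : mcoord X ->
    measurable_fun setT (fun w => dotp a (X w)).
  by move=> mX; apply: measurable_dotp => //; exact: mcoord_cst.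
have mZU : mcoord (fun w => Z w + U w) by exact: mcoordD.
transitivity (Ex Q (fun w => cos (dotp a (Z w + U w) + theta))).
  apply: (Ex_law (mdot _ _ _ mY) (mdot _ _ _ mZU) _ (mcos theta) (fun _ => cos1 _)).
  move=> A mA; apply: (lawY (A := dotp a @^-1` A)).
  by rewrite -[X in measurable X]setTI; exact: measurable_dotp_borel.
pose F := g_sigma_algebra_preimage Z; pose G := g_sigma_algebra_preimage U.
have mF : F `<=` measurable by move=> _ [A mA <-]; exact: measurable_funPT.
have mG : G `<=` measurable by move=> _ [A mA <-]; exact: measurable_funPT.
have sysT (X : {RV Q >-> 'cV[R]_p}) : g_sigma_algebra_preimage X setT.
  by exists setT => //; rewrite preimage_setT setTI.
have sysI (X : {RV Q >-> 'cV[R]_p}) : setI_closed (g_sigma_algebra_preimage X).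
  move=> _ _ [A mA <-] [B mB <-]; exists (A `&` B); first exact: measurableI.
  by rewrite !setTI preimage_setI.
have GF : independent_systems Q <<s G >> <<s F >>.
  apply: independent_generated => //; [exact: sysT|exact: sysT|exact: sysI|exact: sysI|].
  by move=> A B GA FB; rewrite setIC muleC; exact: indZU.
have mUG : mcoord (U : g_sigma_algebraType G -> _).
  move=> j; apply: (measurableT_comp (measurable_borel_coord j)) => _ A mA.
  by apply: sub_sigma_algebra; exists A.
have mZF : mcoord (Z : g_sigma_algebraType F -> _).
  move=> j; apply: (measurableT_comp (measurable_borel_coord j)) => _ A mA.
  by apply: sub_sigma_algebra; exists A.
transitivity (Ex Q (fun w => cos (dotp a (U w + Z w) + theta))).
  by apply: eq_Ex => w; rewrite (addrC (U w)).
have := Ex_independent_vectors (V := U) (X := Z) mG mF GF mUG mZF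
  (@cmeas_cos_dotp R p a theta) (fun z => cos1 _).
move=> ->.
pose s := Num.sqrt ((a^T *m S *m a) ord0 ord0).
have s2 : s ^+ 2 = dotp a (S *m a).
  rewrite sqr_sqrtr; first by rewrite dotpE mulmxA.
  by apply: ltW; case: Spd => _; apply.
have s_gt0 : 0 < s by rewrite sqrtr_gt0; case: Spd => _; apply.
transitivity (Ex Q (fun w => expR (- (dotp a (S *m a) / 2)) * cos (dotp a (U w) + theta))).
  apply: eq_Ex => w.
  transitivity (Ex Q (fun w' => cos (dotp a (Z w') + (dotp a (U w) + theta)))).
    by apply: eq_Ex => w'; rewrite dotpDr addrAC addrC.
  have := Ex_normal_cos s_gt0 (dotp a (U w) + theta) 1.
  rewrite expr1n mulr1 s2 => <-.
  under [RHS]eq_Ex do rewrite mul1r.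
  apply: (@Ex_law _ _ _ _ _ _ (measurableTypeR R) Q (normal_prob 0 s)
     (fun w => dotp a (Z w)) id (mdot _ _ _ mZ) _ _ (fun x => cos (x + _)) 1) => //.
  move=> A mA; apply: (etrans _ (normalZ a0 mA)).
    by congr (Q _); apply/seteqP; split => z /=; rewrite dotpE.
  exact: mcos.
rewrite RintegralZl//; apply: (@bounded_integrable _ _ _ _ _ 1) => [|x]; last exact: cos1.
exact: cmeas_cos_dotp.
Qed.

End cf_gaussian_component.

Section cf_sum.
Context {R : realType} {p n : nat}.
Context {d} {T : measurableType d} (P : probability T R).
Variables (X Y : 'I_n -> {RV P >-> 'cV[R]_p}) (S : 'I_n -> 'M[R]_p) (lam : R).
Hypotheses (indX : mutually_independent_RV X) (indY : mutually_independent_RV Y).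
Hypothesis indXY : independent_families X Y.
Hypothesis cfY : forall i, exists d' (T' : measurableType d') (Q : probability T' R)
  (U : T' -> 'cV[R]_p), mcoord U /\ forall a theta,
  Ex P (fun w => cos (dotp a (Y i w) + theta)) =
  expR (- (dotp a (S i *m a) / 2)) * Ex Q (fun w => cos (dotp a (U w) + theta)).

Let Sum k (w : T) : 'cV[R]_p := \sum_(j < n | (j < k)%N) lam *: Y j w.

Let cos1 (c : R) : `|cos c| <= 1. Proof. exact: normr_cos_le1. Qed.

(** Induction on the number of summands. The U_i live on unrelated spaces, so the non-Gaussian
    remainder of the sum is assembled on the product of the spaces obtained so far. *)
Let cf_partial_sum k : (k <= n)%N -> exists d' (T' : measurableType d') (Q : probability T' R)
  (U : T' -> 'cV[R]_p), mcoord U /\ forall a theta,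
  Ex P (fun w => cos (dotp a (Sum k w) + theta)) =
  expR (- (lam ^+ 2 * (\sum_(j < n | (j < k)%N) dotp a (S j *m a)) / 2)) *
  Ex Q (fun w => cos (dotp a (U w) + theta)).
Proof.
elim: k => [|k IH] kn.
  exists d, T, P, (fun _ => 0); split => [|a theta]; first exact: mcoord_cst.
  rewrite big_pred0// mulr0 mul0r oppr0 expR0 mul1r.
  by apply: eq_Ex => w; rewrite /Sum big_pred0.
have [d1 [T1 [Q1 [U1 [mU1 E1]]]]] := IH (ltnW kn).
pose i := Ordinal kn.
have [d2 [T2 [Q2 [U2 [mU2 E2]]]]] := cfY i.
pose U (z : T1 * T2) := U1 z.1 + lam *: U2 z.2.
have mU : mcoord U.
  apply: mcoordD; first exact: (mcoord_comp (X := U1) measurable_fst).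
  by apply: mcoordZ; exact: (mcoord_comp (X := U2) measurable_snd).
exists _, _, (Q1 \x Q2)%E, U; split => // a theta.
have lt_split (j : 'I_n) : (j < k.+1)%N = (j == i) || (j < k)%N.
  by rewrite ltnS leq_eqVlt -val_eqE.
have SumS w : Sum k.+1 w = Sum k w + lam *: Y i w.
  rewrite /Sum (bigD1 i)/= ?ltnSn// addrC; congr (_ + _); apply: eq_bigl => j.
  by rewrite lt_split; case: eqVneq => [->|]; rewrite ?ltnn ?andbF ?andbT.
have QS : \sum_(j < n | (j < k.+1)%N) dotp a (S j *m a) =
    \sum_(j < n | (j < k)%N) dotp a (S j *m a) + dotp a (S i *m a).
  rewrite (bigD1 i)/= ?ltnSn// addrC; congr (_ + _); apply: eq_bigl => j.
  by rewrite lt_split; case: eqVneq => [->|]; rewrite ?ltnn ?andbF ?andbT.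
pose J : {set 'I_n + 'I_n} :=
  [set j : 'I_n + 'I_n | if j is inr j then (j < k)%N else false]%SET.
pose J' : {set 'I_n + 'I_n} := [set inr i]%SET.
have JJ' j : j \in J -> j \notin J'.
  by move=> jJ; rewrite finset.in_set1; apply: contraTneq jJ => ->; rewrite inE ltnn.
have bm J0 : block (joint_systems X Y) J0 `<=` measurable.
  by apply: block_measurable; exact: joint_systems_measurable.
have mS : mcoord (Sum k : g_sigma_algebraType (block (joint_systems X Y) J) -> _).
  apply: (@mcoord_sum _ _ (g_sigma_algebraType _)) => j jk.
  apply: (@mcoordZ _ _ (g_sigma_algebraType _)) => l.
  apply: (measurableT_comp (measurable_borel_coord l)).
  by apply: measurable_blockr; rewrite inE.
have mYi : mcoord ((fun w => lam *: Y i w) : g_sigma_algebraType (block (joint_systems X Y) J') -> _).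
  apply: (@mcoordZ _ _ (g_sigma_algebraType _)) => l.
  apply: (measurableT_comp (measurable_borel_coord l)).
  by apply: measurable_blockr; rewrite finset.in_set1.
under eq_Ex do rewrite SumS.
have := Ex_independent_vectors (V := Sum k) (X := fun w => lam *: Y i w) (bm _) (bm _)
  (joint_blocks_independent indX indY indXY JJ') (@mS) (@mYi)
  (@cmeas_cos_dotp R p a theta) (fun z => cos1 _).
move=> ->.
have mST : mcoord (Sum k).
  by apply: mcoord_sum => j _; apply: mcoordZ; exact: mcoord_RV.
have mYT : mcoord (fun w => lam *: Y i w) by apply: mcoordZ; exact: mcoord_RV.
have mU2l : mcoord (fun w => lam *: U2 w) by exact: mcoordZ.
have prodm d3 (T3 : measurableType d3) d4 (T4 : measurableType d4)
    (A : T3 -> 'cV[R]_p) (B : T4 -> 'cV[R]_p) : mcoord A -> mcoord B ->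
    measurable_fun setT (fun z : T3 * T4 => cos (dotp a (A z.1 + B z.2) + theta)).
  move=> mA mB; apply: cmeas_cos_dotp; apply: mcoordD.
    exact: (mcoord_comp (X := A) measurable_fst).
  exact: (mcoord_comp (X := B) measurable_snd).
(* The order of integration is exchanged so that the new summand is frozen and enters the phase of
   the induction hypothesis. A second exchange then freezes [U1] and lets the formula for [Y i]
   act. *)
rewrite (@Ex_swap R _ _ _ _ P P (fun z => cos (dotp a (Sum k z.1 + lam *: Y i z.2) + theta)) 1)//;
  last exact: (prodm _ _ _ _ _ _ mST mYT).
set e1 := expR (- (lam ^+ 2 * (\sum_(j < n | (j < k)%N) dotp a (S j *m a)) / 2)) in E1 *.
transitivity (Ex P (fun w => e1 * Ex Q1 (fun w' => cos (dotp a (U1 w' + lam *: Y i w) + theta)))).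
  apply: eq_Ex => w.
  transitivity (Ex P (fun w' => cos (dotp a (Sum k w') + (dotp a (lam *: Y i w) + theta)))).
    by apply: eq_Ex => w'; rewrite dotpDr addrA.
  by rewrite E1; congr (_ * _); apply: eq_Ex => w'; rewrite dotpDr addrA.
rewrite RintegralZl//; last first.
  apply: (@bounded_integrable _ _ _ _ _ 1) => [|w].
    apply: (@measurable_Ex2 R _ _ _ _ Q1 P (fun z => cos (dotp a (U1 z.1 + lam *: Y i z.2) + theta)) 1) => //.
    exact: (prodm _ _ _ _ _ _ mU1 mYT).
  apply: le_normr_Ex => [|x]; last exact: cos1.
  by apply: cmeas_cos_dotp; apply: mcoordD => //; exact: mcoord_cst.
rewrite -(@Ex_swap R _ _ _ _ Q1 P (fun z => cos (dotp a (U1 z.1 + lam *: Y i z.2) + theta)) 1)//;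
  last exact: (prodm _ _ _ _ _ _ mU1 mYT).
set e2 := expR (- (lam ^+ 2 * dotp a (S i *m a) / 2)).
transitivity (e1 * Ex Q1 (fun w => e2 * Ex Q2 (fun w' => cos (dotp a (U1 w + lam *: U2 w') + theta)))).
  congr (_ * _); apply: eq_Ex => w.
  transitivity (Ex P (fun w' => cos (dotp (lam *: a) (Y i w') + (dotp a (U1 w) + theta)))).
    by apply: eq_Ex => w'; rewrite dotpDr dotpZr dotpZl addrCA addrA.
  rewrite E2; congr (_ * _).
    by rewrite /e2 -scalemxAr dotpZr dotpZl mulrA expr2.
  by apply: eq_Ex => w'; rewrite dotpDr dotpZr dotpZl addrCA addrA.
rewrite RintegralZl//; last first.
  apply: (@bounded_integrable _ _ _ _ _ 1) => [|w].
    apply: (@measurable_Ex1 R _ _ _ _ Q1 Q2 (fun z => cos (dotp a (U1 z.1 + lam *: U2 z.2) + theta)) 1) => //.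
    exact: (prodm _ _ _ _ _ _ mU1 mU2l).
  apply: le_normr_Ex => [|x]; last exact: cos1.
  by apply: cmeas_cos_dotp; apply: mcoordD; [exact: mcoord_cst|exact: mcoordZ].
rewrite -(@Ex_prod1 R _ _ _ _ Q1 Q2 (fun z => cos (dotp a (U1 z.1 + lam *: U2 z.2) + theta)) 1)//;
  last exact: (prodm _ _ _ _ _ _ mU1 mU2l).
rewrite mulrA; congr (_ * _).
by rewrite /e1 /e2 -expRD QS; congr expR; ring.
Qed.

Lemma cf_sum : exists d' (T' : measurableType d') (Q : probability T' R)
  (U : T' -> 'cV[R]_p), mcoord U /\ forall a theta,
  Ex P (fun w => cos (dotp a (lam *: \sum_(j < n) Y j w) + theta)) =
  expR (- (lam ^+ 2 * (\sum_(j < n) dotp a (S j *m a)) / 2)) *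
  Ex Q (fun w => cos (dotp a (U w) + theta)).
Proof.
have [d' [T' [Q [U [mU E]]]]] := cf_partial_sum (leqnn n).
exists d', T', Q, U; split => // a theta.
have -> : \sum_(j < n) dotp a (S j *m a) = \sum_(j < n | (j < n)%N) dotp a (S j *m a).
  by apply: eq_bigl => j; rewrite ltn_ord.
rewrite -E; apply: eq_Ex => w; rewrite scaler_sumr /Sum; congr (cos (dotp a _ + theta)).
by apply: eq_bigl => j; rewrite ltn_ord.
Qed.

End cf_sum.

(* The law of [S] is that of [sigma G + W] for a standard Gaussian vector [G]
   independent of [W]. *)
Lemma cf_smoothing {R : realType} {p : nat} {d} {T : measurableType d}
    (P : probability T R) (S : T -> 'cV[R]_p) (q : 'cV[R]_p -> R) (sigma : R) (A : 'M[R]_p)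
    {d1} {T1 : measurableType d1} (Q1 : probability T1 R) (U : T1 -> 'cV[R]_p) :
  A^T = A -> (forall a, q a = sigma ^+ 2 * normsq a + normsq (A *m a)) ->
  mcoord U ->
  (forall a theta, Ex P (fun w => cos (dotp a (S w) + theta)) =
    expR (- (q a / 2)) * Ex Q1 (fun w => cos (dotp a (U w) + theta))) ->
  exists d' (T' : measurableType d') (Q : probability T' R) (W : T' -> 'cV[R]_p),
    mcoord W /\ forall a theta, Ex P (fun w => cos (dotp a (S w) + theta)) =
      expR (- (sigma ^+ 2 * normsq a / 2)) * Ex Q (fun w => cos (dotp a (W w) + theta)).
Proof.
move=> Asym qE mU E1.
have [d2 [T2 [Q2 [G gG]]]] := @standard_gaussian_exists R p.
have mG : mcoord G by case: gG.
have mAG : mcoord (fun w => A *m G w) by exact: mcoord_mulmx.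
pose W (z : T1 * T2) := U z.1 + A *m G z.2.
have mW : mcoord W.
  apply: mcoordD; first exact: (mcoord_comp (X := U) measurable_fst).
  exact: (mcoord_comp (X := fun w => A *m G w) measurable_snd).
exists _, _, (Q1 \x Q2)%E, W; split => // a theta.
have cos1 (c : R) : `|cos c| <= 1 by exact: normr_cos_le1.
rewrite (@Ex_prod1 R _ _ _ _ Q1 Q2 (fun z => cos (dotp a (W z) + theta)) 1)//;
  last exact: cmeas_cos_dotp.
transitivity (expR (- (sigma ^+ 2 * normsq a / 2)) * Ex Q1 (fun w =>
   expR (- (normsq (A *m a) / 2)) * cos (dotp a (U w) + theta))); last first.
  congr (_ * _); apply: eq_Ex => w; rewrite -(Ex_gaussian_cos gG); apply: eq_Ex => w'.
  by rewrite /W dotpDr dotp_mulmx// addrCA addrA.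
rewrite RintegralZl//; last first.
  by apply: (@bounded_integrable _ _ _ _ _ 1) => [|x]; [exact: cmeas_cos_dotp|exact: cos1].
by rewrite E1 qE mulrA -expRD; congr (expR _ * _); ring.
Qed.

(** * Conclusion *)

Section ball_comparison.
Context {R : realType} {p : nat} (K : nat).
Context {d} {T : measurableType d} (P : probability T R).
Variables (S S' : T -> 'cV[R]_p).
Hypotheses (mS : mcoord S) (mS' : mcoord S').
Variables (Delta : R -> R) (D : R).
Hypothesis smoothSS' : forall c r eps, 0 <= r -> 0 < eps ->
  `|Ex P (fun w => smooth_ball K c r eps (S w)) -
    Ex P (fun w => smooth_ball K c r eps (S' w))| <= Delta eps.
Hypothesis shellS' : forall c r eps, 0 < eps ->
  fine (P [set w | r < enorm (S' w - c) <= r + eps]) <= D * eps.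

Let measurable_ball_le (X : T -> 'cV[R]_p) c r : mcoord X ->
  measurable ([set w | enorm (X w - c) <= r] : set T).
Proof.
move=> mX; apply: measurable_preimage_le; apply: measurable_enorm.
by apply: mcoordB => //; exact: mcoord_cst.
Qed.

Let measurable_shell c r r' : measurable ([set w | r < enorm (S' w - c) <= r'] : set T).
Proof.
rewrite (_ : [set _ | _] = [set w | enorm (S' w - c) <= r'] `\` [set w | enorm (S' w - c) <= r]).
  by apply: measurableD; exact: measurable_ball_le.
apply/seteqP; split => w /=; first by move=> /andP[rw wr]; split => //; apply/negP; rewrite -ltNge.
by move=> [wr /negP]; rewrite -ltNge => ->.
Qed.

Let smooth_integrable (X : T -> 'cV[R]_p) c r eps : mcoord X ->
  P.-integrable setT (EFin \o (fun w => smooth_ball K c r eps (X w))).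
Proof.
move=> mX; apply: (@bounded_integrable _ _ _ _ _ 1); first exact: cmeas_smooth_ball.
by move=> w; have /andP[? ?] := smooth_ball_itv K c r eps (X w); rewrite ger0_norm.
Qed.

Let indic_integrable (A : set T) : measurable A ->
  P.-integrable setT (EFin \o (\1_A : T -> R)).
Proof.
move=> mA; apply: (@bounded_integrable _ _ _ _ _ 1); first exact: measurable_indic.
by move=> w; rewrite indicE; case: (_ \in _); rewrite ?normr1 ?normr0.
Qed.

Let ball_le_smooth (X : T -> 'cV[R]_p) c r eps : mcoord X -> 0 <= r -> 0 < eps ->
  fine (P [set w | enorm (X w - c) <= r]) <= Ex P (fun w => smooth_ball K c r eps (X w)).
Proof.
move=> mX r0 e0; have mB := measurable_ball_le c r mX.
rewrite -Ex_indic//; apply: le_Ex; [exact: indic_integrable|exact: smooth_integrable|].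
move=> w; rewrite indicE; have [/set_mem wB|_] := boolP (w \in _).
  by rewrite smooth_ball_in.
by have /andP[] := smooth_ball_itv K c r eps (X w).
Qed.

Let smooth_le_ball (X : T -> 'cV[R]_p) c r eps : mcoord X -> 0 <= r -> 0 < eps ->
  Ex P (fun w => smooth_ball K c r eps (X w)) <= fine (P [set w | enorm (X w - c) <= r + eps]).
Proof.
move=> mX r0 e0; have mB := measurable_ball_le c (r + eps) mX.
rewrite -Ex_indic//; apply: le_Ex; [exact: smooth_integrable|exact: indic_integrable|].
move=> w; rewrite indicE; have [_|/negP wB] := boolP (w \in _).
  by have /andP[] := smooth_ball_itv K c r eps (X w).
rewrite smooth_ball_out//; have [//|/ltW h] := leP (r + eps) (enorm (X w - c)).
by exfalso; apply: wB; rewrite inE.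
Qed.

Let ball_split c r eps : 0 < eps ->
  fine (P [set w | enorm (S' w - c) <= r + eps]) <=
  fine (P [set w | enorm (S' w - c) <= r]) + D * eps.
Proof.
move=> e0; apply: le_trans (lerD (lexx _) (shellS' c r e0)).
have m1 := measurable_ball_le c r mS'; have m2 := measurable_shell c r (r + eps).
rewrite -fineD ?fin_num_measure// fine_le ?fin_numD ?fin_num_measure//.
  by exact: measurable_ball_le.
apply: le_trans (measureU2 _ m1 m2); apply: le_measure; rewrite ?inE.
- exact: measurable_ball_le.
- exact: measurableU.
move=> w /= wr; have [h|h] := leP (enorm (S' w - c)) r; [by left|].
by right; rewrite wr andbT.
Qed.

(** For r >= eps, the smoothed balls of radii r and r - eps sandwich the indicator, at the cost of
    one shell of width eps on either side. The factor 2 comes from the small balls. *)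
Lemma ball_comparison c r eps : 0 <= r -> 0 < eps ->
  `|fine (P [set w | enorm (S w - c) <= r]) -
    fine (P [set w | enorm (S' w - c) <= r])| <= Delta eps + D * (2 * eps).
Proof.
move=> r0 e0.
have D0 : 0 <= D * eps.
  by apply: le_trans (shellS' c 0 e0); apply: fine_ge0; exact: measure_ge0.
have := smoothSS' c r0 e0; have [re|re] := leP eps r; rewrite !ler_norml => /andP[s1 s2].
  have re0 : 0 <= r - eps by rewrite subr_ge0.
  have := smoothSS' c re0 e0; rewrite ler_norml => /andP[t1 t2].
  have h1 := ball_le_smooth c mS r0 e0.
  have h2 := smooth_le_ball c mS' r0 e0.
  have h3 := ball_split c r e0.
  have h4 := ball_le_smooth c mS' re0 e0.
  have h5 := smooth_le_ball c mS re0 e0.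
  have h6 := ball_split c (r - eps) e0.
  rewrite subrK in h5 h6.
  clear -D0 s1 s2 t1 t2 h1 h2 h3 h4 h5 h6.
  by apply/andP; split; lra.
have h1 := ball_le_smooth c mS r0 e0.
have h2 := smooth_le_ball c mS' r0 e0.
have h3 := ball_split c r e0.
have e20 : 0 < 2 * eps by rewrite mulr_gt0.
have h4 := shellS' c (- eps) e20.
(* For r < eps there is no ball of radius r - eps. The whole ball is then small: it lies in the
   shell of radii -eps and eps, which is why shells with a negative inner radius are allowed. *)
have h5 : fine (P [set w | enorm (S' w - c) <= r]) <=
    fine (P [set w | - eps < enorm (S' w - c) <= - eps + 2 * eps]).
  apply: fine_prob_le; [exact: measurable_ball_le|exact: measurable_shell|].
  move=> w /= wr; apply/andP; split; last by lra.
  by apply: lt_le_trans (enorm_ge0 _); rewrite oppr_lt0.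
have h6 : 0 <= fine (P [set w | enorm (S w - c) <= r]) by apply: fine_ge0; exact: measure_ge0.
have h7 : 0 <= Delta eps by apply: le_trans (smoothSS' c r0 e0).
clear -D0 s1 s2 h1 h2 h3 h4 h5 h6 h7.
by apply/andP; split; lra.
Qed.

End ball_comparison.

(** For x^(K+1) = Cz^K delta, the choice eps = x / Cz makes both delta / eps^K and Cz eps equal to
    x. When delta = 0 this radius is 0, and eps is sent to 0 instead. *)
Lemma optimize_radius {R : realType} (K : nat) (D A1 A2 Cz delta : R) :
  0 <= A2 -> 0 < Cz -> 0 <= delta -> 0 <= A1 ->
  (forall eps, 0 < eps -> D <= A1 * (delta / eps ^+ K) + A2 * (Cz * eps)) ->
  D <= (A1 + A2) * (Cz ^+ K * delta) `^ (1 / (K%:R + 1)).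
Proof.
move=> A20 C0 d0 A10.
set x := _ `^ _.
have Cd0 : 0 <= Cz ^+ K * delta by rewrite mulr_ge0// exprn_ge0// ltW.
have xK : x ^+ K.+1 = Cz ^+ K * delta.
  by rewrite -powR_mulrn ?powR_ge0// /x -powRrM -natr1 divfK ?gt_eqF ?powRr1.
have x_ge0 : 0 <= x by exact: powR_ge0.
clearbody x => H.
have [x0|x0] := ltP 0 x.
  have E1 : delta / (x / Cz) ^+ K = x.
    rewrite expr_div_n invf_div mulrA (mulrC delta) -xK exprS mulfK//.
    by rewrite gt_eqF// exprn_gt0.
  have E2 : Cz * (x / Cz) = x by rewrite mulrC divfK// gt_eqF.
  by have := H (x / Cz) (divr_gt0 x0 C0); rewrite E1 E2 -mulrDl.
have xE : x = 0 by apply/eqP; rewrite eq_le x0 x_ge0.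
have delta0 : delta = 0.
  move: xK; rewrite xE expr0n/= => /esym/eqP; rewrite mulf_eq0 expf_eq0 (gt_eqF C0) andbF.
  by move=> /eqP.
rewrite xE mulr0; apply/ler_addgt0Pr => e e0; rewrite add0r.
(* The denominator has A2 + 1 in place of A2, which may be 0. *)
have e1 : 0 < e / ((A2 + 1) * Cz) by rewrite divr_gt0// mulr_gt0// ltr_wpDl.
apply: le_trans (H _ e1) _; rewrite delta0 mul0r mulr0 add0r.
have A21 : 0 < A2 + 1 by rewrite ltr_wpDl.
have -> : A2 * (Cz * (e / ((A2 + 1) * Cz))) = A2 / (A2 + 1) * e.
  by field; rewrite !gt_eqF.
by rewrite ler_piMl ?(ltW e0)// ler_pdivrMr// mul1r lerDl.
Qed.

Lemma integrable_moment {R : realType} {d} {T : measurableType d}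
    (P : probability T R) {p} (K : nat) (X : T -> 'cV[R]_p) : mcoord X ->
  (moment P K X < +oo)%E ->
  P.-integrable setT (EFin \o (fun w => enorm (X w) ^+ K)).
Proof.
move=> mX; rewrite /moment unlock => XK; apply/integrableP; split.
  by apply/measurable_EFinP; apply: measurable_funX; exact: measurable_enorm.
apply: le_lt_trans XK; rewrite le_eqVlt; apply/orP; left; apply/eqP.
by apply: eq_integral => w _ /=; rewrite ger0_norm// exprn_ge0// enorm_ge0.
Qed.

Lemma posdef_mean {R : realType} {p n} (S : 'I_n -> 'M[R]_p) : (0 < n)%N ->
  (forall i, posdefmx (S i)) -> posdefmx (n%:R^-1 *: \sum_(i < n) S i).
Proof.
move=> n0 Spd; split.
  rewrite linearZ /= linear_sum; congr (_ *: _); apply: eq_bigr => i _.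
  by case: (Spd i).
move=> x x0; rewrite -scalemxAr -scalemxAl mxE mulr_gt0 ?invr_gt0 ?ltr0n//.
rewrite mulmx_sumr mulmx_suml summxE (bigD1 (Ordinal n0))//= ltr_pwDl//.
  by case: (Spd (Ordinal n0)) => _; apply.
by apply: sumr_ge0 => i _; apply: ltW; case: (Spd i) => _; apply.
Qed.

Theorem theorem2p2 (R : realType) (K : nat) (hK : (3 <= K)%N) :
  exists C : R, 0 < C /\
  forall (n p : nat) (hn : (1 <= n)%N) (hp : (1 <= p)%N)
    (d : measure_display) (T : measurableType d) (P : probability T R)
    (X Y : 'I_n -> {RV P >-> 'cV[R]_p}) (Sigma_z : 'I_n -> 'M[R]_p),
    mutually_independent_RV X ->
    (forall i, [/\ centered P (X i), posdefmx (covmx P (X i))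
      & (moment P K (X i) < +oo)%E]) ->
    mutually_independent_RV Y ->
    independent_families X Y ->
    (forall i, [/\ (moment P K (Y i) < +oo)%E,
      forall k, (1 <= k <= K - 1)%N -> same_tensor_moment P k (X i) (Y i),
      posdefmx (Sigma_z i)
      & exists (d' : measure_display) (T' : measurableType d')
          (Q : probability T' R) (Z U : {RV Q >-> 'cV[R]_p}),
        [/\ independent_RV Z U, centered Q Z, centered Q U,
            centered_normal Q (Sigma_z i) Z
          & eq_in_law P Q (Y i) (fun w => Z w + U w)]]) ->
    let Sigma_bar := n%:R^-1 *: \sum_(i < n) Sigma_z i in
    let C_z := opnorm (invmx (sqrtmx Sigma_bar)) in
    let S_n := normalized_sum X in
    let S_n' := normalized_sum Y in
    (ereal_sup [set `|P (S_n @^-1` B) - P (S_n' @^-1` B)| | B in closed_balls R p]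
     <= C%:E * ((C_z ^+ K)%:E
          * (\sum_(i < n)
               'E_P[fun w => enorm (X i w) ^+ K + enorm (Y i w) ^+ K]%R)
          * (n%:R `^ (- (K%:R / 2)))%:E) `^ (1 / (K%:R + 1)))%E.
Proof.
(* The shell constant is fixed before n, p and the laws are introduced. *)
have [C0 [C00 shellC]] : exists C0 : R, 0 < C0 /\
    forall (p : nat), (0 < p)%N -> forall d' (T' : measurableType d')
      (P' : probability T' R) (G : T' -> 'cV[R]_p), standard_gaussian P' G ->
    forall u r eps, 0 <= r -> 0 < eps ->
      fine (P' [set w | r <= enorm (G w + u) <= r + eps]) <= C0 * eps.
  exists 220; split => [|p p0 d' T' P' G gG u r eps r0 e0]; first by rewrite ltr0n.
  exact: (gaussian_shell gG p0 u r0 e0).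
have [M M0 MP] := @smooth_step_bounded R K.
(* In [A1], 2^K comes from the powers of 2 / eps in the Taylor remainder. In [A2], 3 comes from the
   enlarged shell, the inner 2 from sigma = 1 / (2 C_z) and the outer 2 from the comparison of
   balls. *)
pose A1 := M * comp_const K 0 * 2 ^+ K; pose A2 := 2 * (2 * (3 * C0)).
have A10 : 0 <= A1 by rewrite !mulr_ge0 ?comp_const_ge0 ?exprn_ge0.
have A20 : 0 < A2 by rewrite !mulr_gt0.
exists (A1 + A2); split; first by rewrite ltr_wpDl.
move=> n p hn hp d T P X Y Sigma_z indX hX indY indXY hY; cbv zeta.
set Sigma_bar := _ *: _; set C_z := opnorm _.
set S_n := normalized_sum X; set S_n' := normalized_sum Y.
have K0 : (0 < K)%N by apply: leq_trans hK.
have Sz i : posdefmx (Sigma_z i) by case: (hY i).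
have Spd : posdefmx Sigma_bar by exact: posdef_mean.
have C_z0 : 0 < C_z by exact: opnorm_invsqrt_gt0.
have XK i : P.-integrable setT (EFin \o (fun w => enorm (X i w) ^+ K)).
  by apply: integrable_moment; [exact: mcoord_RV|case: (hX i)].
have YK i : P.-integrable setT (EFin \o (fun w => enorm (Y i w) ^+ K)).
  by apply: integrable_moment; [exact: mcoord_RV|case: (hY i)].
pose lam : R := (Num.sqrt n%:R)^-1.
have lam0 : 0 <= lam by rewrite invr_ge0 sqrtr_ge0.
have mSn (Z : 'I_n -> {RV P >-> 'cV[R]_p}) : mcoord (normalized_sum Z).
  by apply: mcoordZ; apply: mcoord_sum => i _; exact: mcoord_RV.
have cfY i : exists d' (T' : measurableType d') (Q : probability T' R)
    (U : T' -> 'cV[R]_p), mcoord U /\ forall a theta,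
    Ex P (fun w => cos (dotp a (Y i w) + theta)) =
    expR (- (dotp a (Sigma_z i *m a) / 2)) * Ex Q (fun w => cos (dotp a (U w) + theta)).
  have [_ _ Si [d' [T' [Q [Z [U [indZU _ _ nZ lawY]]]]]]] := hY i.
  exists d', T', Q, U; split; first exact: mcoord_RV.
  by move=> a theta; exact: (cf_gaussian_component Si indZU nZ lawY).
have [d1 [T1 [Q1 [U [mU cfU]]]]] := cf_sum lam indX indY indXY cfY.
pose sigma := (2 * C_z)^-1.
have sigma0 : 0 < sigma by rewrite invr_gt0 mulr_gt0.
have [A [Asym splitA]] := covariance_split Spd hp (erefl sigma).
(* Since lam^2 = 1 / n, the covariance of the Gaussian part of the normalized sum is exactly
   [Sigma_bar]. *)
have quadE a : lam ^+ 2 * (\sum_(j < n) dotp a (Sigma_z j *m a)) =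
    sigma ^+ 2 * normsq a + normsq (A *m a).
  rewrite -splitA /Sigma_bar -scalemxAl dotpZr mulmx_suml dotp_sumr.
  by rewrite /lam exprVn sqr_sqrtr.
have [d2 [T2 [Q2 [W [mW cfW]]]]] := cf_smoothing Asym quadE mU cfU.
have shellS' c r eps : 0 < eps ->
    fine (P [set w | r < enorm (S_n' w - c) <= r + eps]) <= (2 * (3 * C0) * C_z) * eps.
  move=> e0; apply: le_trans (shell_bound (mSn Y) sigma0 (ltW C00)
    (shellC p hp) mW cfW c r e0) _.
  by rewrite /sigma invrK le_eqVlt; apply/orP; left; apply/eqP; ring.
pose EK := \sum_(i < n) (Ex P (fun w => enorm (X i w) ^+ K) + Ex P (fun w => enorm (Y i w) ^+ K)).
have EK0 : 0 <= EK.
  by apply: sumr_ge0 => i _; apply: addr_ge0; apply: Rintegral_ge0 => w _;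
    rewrite exprn_ge0 ?enorm_ge0.
have lamK : lam ^+ K = n%:R `^ (- (K%:R / 2)).
  by rewrite /lam exprVn powRN mulrC powRrM powR12_sqrt// powR_mulrn ?sqrtr_ge0.
pose delta := EK * n%:R `^ (- (K%:R / 2)).
have delta0 : 0 <= delta by rewrite mulr_ge0 ?powR_ge0.
have smoothSS' c r eps : 0 <= r -> 0 < eps ->
    `|Ex P (fun w => smooth_ball K c r eps (S_n w)) -
      Ex P (fun w => smooth_ball K c r eps (S_n' w))| <= A1 * (delta / eps ^+ K).
  move=> r0 e0; have XY i : forall k, (1 <= k <= K - 1)%N ->
    same_tensor_moment P k (X i) (Y i) by case: (hY i).
  apply: le_trans (lindeberg_smooth_ball indX indY indXY XK YK XY c r0 e0 lam0 K0 MP) _.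
  rewrite le_eqVlt; apply/orP; left; apply/eqP.
  by rewrite lamK /A1 /delta -/EK expr_div_n; ring.
have sumE : (\sum_(i < n) 'E_P[fun w => enorm (X i w) ^+ K + enorm (Y i w) ^+ K]%R)%E = EK%:E.
  rewrite /EK -sumEFin; apply: eq_bigr => i _.
  rewrite unlock -RintegralD// /Rintegral fineK//.
  exact: integrable_fin_num (integrable_addr (XK i) (YK i)).
rewrite sumE -!EFinM.
apply: ge_ereal_sup => _ [_ [c [r [r0 ->]]] <-].
have mball (Z : 'I_n -> {RV P >-> 'cV[R]_p}) :
    measurable (normalized_sum Z @^-1` eball c r).
  apply: measurable_preimage_le; apply: measurable_enorm.
  by apply: mcoordB => //; exact: mcoord_cst.
rewrite -(fineK (fin_num_measure P _ (mball X))) -(fineK (fin_num_measure P _ (mball Y))).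
rewrite -EFinB abse_EFin lee_fin -mulrA -/delta.
apply: optimize_radius => //; first exact: ltW.
move=> eps e0.
apply: le_trans (ball_comparison (mSn X) (mSn Y) smoothSS' shellS' c r0 e0) _.
by rewrite lerD2l /A2 le_eqVlt; apply/orP; left; apply/eqP; ring.
Qed.
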